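(* Let $T>0$ and $R:=1/(4\sqrt{3T})$. The image of the end point map $$F_T: B_R[L^2(0,T)]\to L^2(\mathbb{R})\cap C^0_b(\mathbb{R}),\qquad F_T(w):=Z(T,\cdot),$$ where $Z$ is the solution of $$Z(t,\omega)=-\left(\int_0^t w(\tau)\sqrt{1-|Z(\tau,\omega)|^2}\,e^{-i\omega\tau}\,d\tau\right)e^{i\omega t},\qquad \forall (t,\omega)\in[0,T]\times\mathbb{R},$$ is a strict submanifold of $L^2(\mathbb{R})\cap C^0_b(\mathbb{R})$ of infinite codimension that does not coincide with its tangent space at zero.
   Context: All function spaces consist of complex-valued functions. $B_R[L^2(0,T)]:=\{w\in L^2(0,T):\ \|w\|_{L^2(0,T)}<R\}$. $C^0_b(\mathbb{R})$ (resp. $C^0_b([0,T]\times\mathbb{R})$) is the space of bounded continuous functions with the sup norm, and $L^2(\mathbb{R})\cap C^0_b(\mathbb{R})$ carries the norm $\|\cdot\|_{L^2}+\|\cdot\|_{L^\infty}$; Banach spaces and Banach manifolds are regarded over the field $\mathbb{R}$. For every $w\in L^2(0,T)$ with $\|w\|_{L^2(0,T)}<1/(2\sqrt{T})$ (in particular for $w\in B_R[L^2(0,T)]$), the integral equation has a unique solution $Z\in C^0([0,T],L^2(\mathbb{R}))\cap C^0_b([0,T]\times\mathbb{R})$; this is the solution meant in the definition of $F_T$. ''Submanifold'' means ($C^1$) Banach submanifold; ''strict'' means proper (not the whole space). The tangent space at zero is the tangent space to the image at the point $0=F_T(0)$, viewed as a linear subspace of $L^2(\mathbb{R})\cap C^0_b(\mathbb{R})$.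 *)

(* Defs.v *)
From HB Require Import structures.
From mathcomp Require Import all_boot all_order all_algebra.
From mathcomp Require Import complex.
From mathcomp Require Import all_classical all_reals all_analysis.
From mathcomp Require Import measurable_realfun.

Set Implicit Arguments.
Unset Strict Implicit.
Unset Printing Implicit Defensive.
Import Order.TTheory GRing.Theory Num.Theory.
Import numFieldNormedType.Exports.

Local Open Scope classical_set_scope.
Local Open Scope ring_scope.

Section Rcomplex_normedModType.
Variable R : realType.
Local Notation C := (Rcomplex R).

HB.instance Definition _ := PseudoMetric.copy C (pseudoMetric_normed C).
HB.instance Definition _ := isPointed.Build C 0.
HB.instance Definition _ := NormedZmod_PseudoMetric_eq.Build R C erefl.

Lemma Rcomplex_normE (z : C) :
  `|z| = Num.sqrt (complex.Re z ^+ 2 + complex.Im z ^+ 2).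
Proof. by case: z. Qed.

Lemma Rcomplex_normrZ (a : R) (z : C) : `|a *: z| = `|a| * `|z|.
Proof.
case: z => x y; rewrite !Rcomplex_normE /= !exprMn -mulrDr sqrtrM ?sqr_ge0//.
by rewrite sqrtr_sqr.
Qed.

HB.instance Definition _ :=
  PseudoMetricNormedZmod_Lmodule_isNormedModule.Build R C Rcomplex_normrZ.

Lemma ReD (z w : C) : complex.Re (z + w) = complex.Re z + complex.Re w.
Proof. by case: z w => [? ?] [? ?]. Qed.

Lemma ReB (z w : C) : complex.Re (z - w) = complex.Re z - complex.Re w.
Proof. by case: z w => [? ?] [? ?]. Qed.

Lemma ReZ (a : R) (z : C) : complex.Re (a *: z) = a * complex.Re z.
Proof. by case: z. Qed.

Lemma ImD (z w : C) : complex.Im (z + w) = complex.Im z + complex.Im w.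
Proof. by case: z w => [? ?] [? ?]. Qed.

Lemma ImB (z w : C) : complex.Im (z - w) = complex.Im z - complex.Im w.
Proof. by case: z w => [? ?] [? ?]. Qed.

Lemma ImZ (a : R) (z : C) : complex.Im (a *: z) = a * complex.Im z.
Proof. by case: z. Qed.

Lemma Re_le_norm (z : C) : `|complex.Re z| <= `|z|.
Proof. by rewrite Rcomplex_normE -sqrtr_sqr ler_wsqrtr// lerDl sqr_ge0. Qed.

Lemma Im_le_norm (z : C) : `|complex.Im z| <= `|z|.
Proof. by rewrite Rcomplex_normE -sqrtr_sqr ler_wsqrtr// lerDr sqr_ge0. Qed.

End Rcomplex_normedModType.

Section Rcomplex_complete.
Variable R : realType.
Local Notation C := (Rcomplex R).

Lemma norm_le_ReIm (z : C) : `|z| <= `|complex.Re z| + `|complex.Im z|.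
Proof.
rewrite Rcomplex_normE -[leRHS]ger0_norm ?addr_ge0// -sqrtr_sqr ler_wsqrtr//.
by rewrite sqrrD !real_normK ?num_real// addrAC lerDl mulrn_wge0// mulr_ge0.
Qed.

Lemma Rcomplex_complete (F : set_system C) :
  ProperFilter F -> cauchy F -> cvg F.
Proof.
move=> FF /cauchyP Fc.
have cvg_part (p : C -> R) : (forall z w, `|p z - p w| <= `|z - w|) ->
    cvg (p @ F).
  move=> p1; apply: cauchy_cvg; apply/cauchyP => e e0.
  have [z Fz] := Fc e e0; exists (p z); apply: (@filterS _ F _ _ _ _ Fz) => w.
  by rewrite -!ball_normE /=; apply: le_lt_trans.
have /cvg_ex[a /cvgrPdist_le Fa] : cvg ((@complex.Re R : C -> R) @ F).
  by apply: cvg_part => z w; rewrite -ReB; exact: Re_le_norm.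
have /cvg_ex[b /cvgrPdist_le Fb] : cvg ((@complex.Im R : C -> R) @ F).
  by apply: cvg_part => z w; rewrite -ImB; exact: Im_le_norm.
apply/cvg_ex; exists (Complex a b : C); apply/cvgrPdist_le => e e0; near=> z.
rewrite (le_trans (norm_le_ReIm _))// [leRHS]splitr lerD//.
- by rewrite ReB; near: z; apply: Fa; rewrite divr_gt0.
- by rewrite ImB; near: z; apply: Fb; rewrite divr_gt0.
Unshelve. all: by end_near. Qed.

HB.instance Definition _ := Uniform_isComplete.Build C Rcomplex_complete.

End Rcomplex_complete.

Section L2_Cb.
Variable R : realType.
Local Notation C := (Rcomplex R).
Local Notation mu := (@lebesgue_measure R).
Implicit Types (D : set R) (f g : R -> C).

Definition L2norm D f : \bar R :=
  ((\int[mu]_(x in D) (`|f x| ^+ 2)%:E) `^ 2^-1)%E.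

(* Elements are representatives: two of them that agree a.e. on [D] stand for
   the same point of the Lebesgue space. *)
Definition L2 D : set (R -> C) := [set f |
  [/\ measurable_fun D (fun x => complex.Re (f x)),
      measurable_fun D (fun x => complex.Im (f x)) &
      (L2norm D f < +oo)%E]].

Lemma L2norm_Lnorm f :
  L2norm setT f = ('N[mu]_2%:E [EFin \o (fun x => `|f x|%R)])%E.
Proof.
rewrite unlock /L2norm; congr (_ `^ _)%E; apply: eq_integral => x _ /=.
by rewrite normr_id powR_mulrn.
Qed.

Lemma measurable_Rcomplex_norm D f : measurable D ->
  measurable_fun D (fun x => complex.Re (f x)) ->
  measurable_fun D (fun x => complex.Im (f x)) ->
  measurable_fun D (fun x => `|f x|).
Proof.
move=> mD mr mi.
rewrite (_ : (fun x => _) = Num.sqrt \o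
  (fun x => complex.Re (f x) ^+ 2 + complex.Im (f x) ^+ 2)); last first.
  by apply/funext => x /=; rewrite Rcomplex_normE.
apply: measurableT_comp.
  apply: continuous_measurable_fun. exact: sqrt_continuous.
by apply: measurable_funD; apply: measurable_funX.
Qed.

Lemma L2norm_leD f g : L2 setT f -> L2 setT g ->
  (L2norm setT (f + g)%R <= L2norm setT f + L2norm setT g)%E.
Proof.
move=> Lf Lg; have [rf jf _] := Lf; have [rg jg _] := Lg.
have mf := measurable_Rcomplex_norm measurableT rf jf.
have mg := measurable_Rcomplex_norm measurableT rg jg.
rewrite [X in (_ <= X + _)%E]L2norm_Lnorm [X in (_ <= _ + X)%E]L2norm_Lnorm.
apply: le_trans (minkowski_EFin _ _ _ _) => //; last by rewrite ler1n.
rewrite unlock /L2norm gt0_ler_poweR ?invr_gt0//.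
- by rewrite in_itv/= leey andbT integral_ge0// => x _; rewrite lee_fin.
- by rewrite in_itv/= leey andbT integral_ge0.
- apply: ge0_le_integral => //=.
  + apply/measurable_EFinP; apply: measurable_funX.
    apply: (@measurable_Rcomplex_norm setT (f + g)) => //.
      under eq_fun do rewrite /= ReD.
      exact: measurable_funD.
    under eq_fun do rewrite /= ImD.
    exact: measurable_funD.
  + rewrite -[X in measurable_fun _ X]/(EFin \o (fun x => (`| `|f x| + `|g x| |%R `^ 2)%R)); apply/measurable_EFinP.
        apply: (@measurableT_comp _ _ _ _ _ _ (fun x : R => x `^ 2)) => //.
    apply: measurableT_comp => //; exact: measurable_funD.
  + move=> x _; rewrite lee_fin (@ger0_norm _ (_ + _)) ?addr_ge0// powR_mulrn ?addr_ge0//.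
    by rewrite lerXn2r ?nnegrE ?addr_ge0// ler_normD.
Qed.

Lemma L2normZ (a : R) f : L2 setT f ->
  L2norm setT (a *: f) = (`|a|%:E * L2norm setT f)%E.
Proof.
move=> Lf; have [rf jf _] := Lf; have mf := measurable_Rcomplex_norm measurableT rf jf.
rewrite /L2norm.
under eq_integral => x _ do rewrite /= Rcomplex_normrZ exprMn EFinM.
rewrite ge0_integralZl//; last first.
  exact/measurable_EFinP/measurable_funX.
rewrite poweRM ?lee_fin ?sqr_ge0//; last by rewrite integral_ge0.
congr (_ * _)%E; rewrite poweR_EFin; congr EFin.
by rewrite -powR_mulrn// -powRrM mulfV// powRr1.
Qed.

End L2_Cb.

(* Functions rather than classes modulo a.e. equality: continuous functions
   that agree a.e. are equal. *)
Section L2Cb.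
Variable R : realType.
Local Notation C := (Rcomplex R).
Local Notation mu := (@lebesgue_measure R).
Implicit Types f g : R -> C.

Definition bounded_on (A : Type) (D : set A) (f : A -> C) :=
  exists M : R, forall x, D x -> `|f x| <= M.

Definition supnorm f : R := sup [set `|f x| | x in setT].

Definition L2Cb_pred : {pred R -> C} :=
  mem [set f | [/\ L2 setT f, continuous f & bounded_on setT f]].

Lemma supnorm_ub f x : bounded_on setT f -> `|f x| <= supnorm f.
Proof.
move=> [M fM]; apply: ub_le_sup; last by exists x.
by exists M => _ [y _ <-]; exact: fM.
Qed.

Lemma supnorm_le f (M : R) : (forall x, `|f x| <= M) -> supnorm f <= M.
Proof.
move=> fM; apply: ge_sup; first by exists `|f 0|, 0.
by move=> _ [x _ <-].
Qed.

Lemma supnorm_ge0 f : bounded_on setT f -> 0 <= supnorm f.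
Proof. by move=> bf; apply: le_trans (supnorm_ub 0 bf). Qed.

Lemma bounded_onD f g :
  bounded_on setT f -> bounded_on setT g -> bounded_on setT (f + g).
Proof.
move=> bf bg; exists (supnorm f + supnorm g) => x _.
by rewrite (le_trans (ler_normD _ _))// lerD// supnorm_ub.
Qed.

Lemma bounded_onZ (a : R) f : bounded_on setT f -> bounded_on setT (a *: f).
Proof.
move=> bf; exists (`|a| * supnorm f) => x _.
by rewrite /= normrZ ler_wpM2l// supnorm_ub.
Qed.

Lemma L2D f g : L2 setT f -> L2 setT g -> L2 setT (f + g).
Proof.
move=> Lf Lg; have [rf jf nf] := Lf; have [rg jg ng] := Lg; split.
- by under eq_fun do rewrite /= ReD; exact: measurable_funD.
- by under eq_fun do rewrite /= ImD; exact: measurable_funD.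
- by rewrite (le_lt_trans (L2norm_leD Lf Lg))// lte_add_pinfty.
Qed.

Lemma L2Z (a : R) f : L2 setT f -> L2 setT (a *: f).
Proof.
move=> Lf; have [rf jf nf] := Lf; split.
- by under eq_fun do rewrite /= ReZ; exact: measurable_funM.
- by under eq_fun do rewrite /= ImZ; exact: measurable_funM.
- by rewrite L2normZ// lte_mul_pinfty// ?lee_fin.
Qed.

Lemma L2_0 : L2 setT (0 : R -> C).
Proof.
split; [exact: measurable_cst|exact: measurable_cst|].
rewrite /L2norm; under eq_integral => x _ do rewrite /= normr0 expr0n.
by rewrite integral0 poweR0r.
Qed.

Lemma L2Cb_submod_closed : submod_closed L2Cb_pred.
Proof.
split.
  rewrite inE; split; first exact: L2_0.
    exact: cst_continuous.
  by exists 0 => x _; rewrite normr0.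
move=> a f g; rewrite !inE => -[Lf cf bf] [Lg cg bg]; split.
- by apply: L2D => //; apply: L2Z.
- by move=> x; apply: cvgD; [apply: cvgZr; exact: cf|exact: cg].
- by apply: bounded_onD => //; apply: bounded_onZ.
Qed.

HB.instance Definition _ :=
  GRing.isSubmodClosed.Build R (R -> C) L2Cb_pred L2Cb_submod_closed.

Record L2Cb := MkL2Cb {
  L2Cb_fun :> R -> C ;
  L2Cb_funP : L2Cb_fun \in L2Cb_pred }.

HB.instance Definition _ := [isSub for L2Cb_fun].
HB.instance Definition _ := [Choice of L2Cb by <:].
HB.instance Definition _ := [SubChoice_isSubLmodule of L2Cb by <:].

Lemma L2CbP (f : L2Cb) : [/\ L2 setT f, continuous f & bounded_on setT f].
Proof. by have := L2Cb_funP f; rewrite inE. Qed.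

Definition L2Cb_norm (f : L2Cb) : R := fine (L2norm setT f) + supnorm f.

Lemma L2norm_ge0 (D : set R) f : (0 <= L2norm D f)%E.
Proof. exact: poweR_ge0. Qed.

Lemma L2norm_fin_num f : L2 setT f -> L2norm setT f \is a fin_num.
Proof. by case=> _ _ fy; rewrite ge0_fin_numE// L2norm_ge0. Qed.

Lemma L2Cb_normD (f g : L2Cb) :
  L2Cb_norm (f + g) <= L2Cb_norm f + L2Cb_norm g.
Proof.
have [Lf _ bf] := L2CbP f; have [Lg _ bg] := L2CbP g.
rewrite /L2Cb_norm addrACA lerD//.
  rewrite -fineD ?L2norm_fin_num// fine_le ?fin_numD ?L2norm_fin_num//.
    exact: L2D.
  exact: L2norm_leD.
apply: supnorm_le => x.
by rewrite (le_trans (ler_normD _ _))// lerD// supnorm_ub.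
Qed.

Lemma L2Cb_normZ (a : R) (f : L2Cb) : L2Cb_norm (a *: f) = `|a| * L2Cb_norm f.
Proof.
have [Lf _ bf] := L2CbP f.
rewrite /L2Cb_norm mulrDr L2normZ// fineM ?L2norm_fin_num//=; congr (_ + _).
have le1 b (g : L2Cb) : supnorm (b *: (g : R -> C)) <= `|b| * supnorm g.
  have [_ _ bg] := L2CbP g.
  by apply: supnorm_le => x; rewrite /= normrZ ler_wpM2l// supnorm_ub.
apply/eqP; rewrite eq_le le1/=.
have [->|a0] := eqVneq a 0.
  by rewrite normr0 mul0r (supnorm_ge0 (bounded_onZ _ bf)).
rewrite -ler_pdivlMl ?normr_gt0// -normfV.
rewrite (le_trans _ (le1 a^-1 (a *: f)))//.
by rewrite [_ *: _](_ : _ = f :> (R -> C))//= scalerA mulVf// scale1r.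
Qed.

Lemma L2Cb_norm0_eq0 (f : L2Cb) : L2Cb_norm f = 0 -> f = 0.
Proof.
have [Lf _ bf] := L2CbP f.
move/eqP; rewrite paddr_eq0 ?supnorm_ge0//; last first.
  by rewrite fine_ge0// L2norm_ge0.
move=> /andP[_ /eqP f0]; apply/val_inj/funext => x /=.
by apply/eqP; rewrite -normr_le0 -f0; exact: supnorm_ub.
Qed.

HB.instance Definition _ :=
  Lmodule_isNormed.Build R L2Cb L2Cb_normD L2Cb_normZ L2Cb_norm0_eq0.


Lemma L2Cb_ler_norm (f : L2Cb) (x : R) : `|f x| <= `|f|.
Proof.
have [Lf _ bf] := L2CbP f.
by rewrite (le_trans (supnorm_ub x bf))// lerDr fine_ge0// L2norm_ge0.
Qed.

Lemma L2norm_le_L2Cb (f : L2Cb) : (L2norm setT f <= `|f|%:E)%E.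
Proof.
have [Lf _ bf] := L2CbP f.
by rewrite -[leLHS]fineK ?L2norm_fin_num// lee_fin lerDl supnorm_ge0.
Qed.

Lemma continuous_L2_measurable f : continuous f ->
  measurable_fun setT (fun x => complex.Re (f x)) /\
  measurable_fun setT (fun x => complex.Im (f x)).
Proof.
move=> cf; split; apply: continuous_measurable_fun => x;
  apply/cvgrPdist_le => e e0; near=> y.
- rewrite (@le_trans _ _ `|f x - f y|)//.
    by rewrite -ReB; exact: Re_le_norm.
  by near: y; apply/cvgrPdist_le : e e0; exact: cf.
- rewrite (@le_trans _ _ `|f x - f y|)//.
    by rewrite -ImB; exact: Im_le_norm.
  by near: y; apply/cvgrPdist_le : e e0; exact: cf.
Unshelve. all: by end_near. Qed.

Lemma L2norm_fatou (h : (R -> C)^nat) f (M : R) : 0 <= M ->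
  (forall n, continuous (h n)) -> (forall x, h ^~ x @ \oo --> f x) ->
  (forall n, (L2norm setT (h n) <= M%:E)%E) -> (L2norm setT f <= M%:E)%E.
Proof.
move=> M0 ch hf hM.
have hM2 n : (\int[mu]_x (`|h n x| ^+ 2)%:E <= (M ^+ 2)%:E)%E.
  have := hM n; rewrite /L2norm => /(@gt0_ler_poweR _ 2).
  rewrite !in_itv/= !leey !andbT poweR_ge0 lee_fin M0 => /(_ (ler0n _ _) isT isT).
  rewrite -poweRrM mulVf// poweRe1 ?integral_ge0// => /le_trans; apply.
  by rewrite powR_mulrn.
suff : (\int[mu]_x (`|f x| ^+ 2)%:E <= (M ^+ 2)%:E)%E.
  move=> /(@gt0_ler_poweR _ 2^-1).
  rewrite !in_itv/= !leey !andbT lee_fin sqr_ge0 integral_ge0//.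
  rewrite invr_ge0 ler0n => /(_ isT isT isT) /le_trans; apply.
  by rewrite -powR_mulrn// -powRrM mulfV// powRr1.
rewrite (_ : (fun x => _) =
  (fun x => limn_einf (fun n => (`|h n x| ^+ 2)%:E))); last first.
  apply/funext => x; apply/esym.
  apply: (fst (cvg_limn_einf_sup (_ : _ @ \oo --> (`|f x| ^+ 2)%:E))).
  apply: cvg_EFin; first exact: nearW.
  apply: cvgM; apply: cvg_norm; exact: hf.
apply: le_trans (fatou _ _ _ _) _ => //.
- move=> n; apply/measurable_EFinP/measurable_funX.
  by have [? ?] := continuous_L2_measurable (ch n); exact: measurable_Rcomplex_norm.
rewrite limn_einf_lim; apply: lime_le; first exact: is_cvg_einfs.
near=> n; apply: le_trans (hM2 n); apply: ereal_inf_lbound.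
by exists n => /=.
Unshelve. all: by end_near. Qed.

Lemma L2Cb_complete (F : set_system L2Cb) : ProperFilter F -> cauchy F -> cvg F.
Proof.
move=> FF /cauchy_ballP Fc.
have pt x : cvg ((fun g : L2Cb => g x) @ F).
  apply: cauchy_cvg; apply/cauchyP => e e0.
  have /cauchyP/(_ e e0)[g Fg] : cauchy F by apply/cauchy_ballP.
  exists (g x); apply: (@filterS _ F _ _ _ _ Fg) => h.
  rewrite -!ball_normE /=; apply: le_lt_trans.
  exact: (L2Cb_ler_norm (g - h) x).
pose f x : C := lim ((fun g : L2Cb => g x) @ F).
have fE x : (fun g : L2Cb => g x) @ F --> f x by exact: pt.
have Fsup e : 0 < e -> \forall g \near F, forall x, `|f x - (g : L2Cb) x| <= e.
  move=> e0; have e20 : 0 < e / 2 by rewrite divr_gt0.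
  have /cauchyP/(_ _ e20)[k Fk] : cauchy F by apply/cauchy_ballP.
  near=> g => x; apply/ler_addgt0Pr => d d0.
  have /filter_ex[h [hx kh]] : \forall h \near F,
      `|f x - (h : L2Cb) x| <= d /\ ball k (e / 2) h.
    near=> h; split; last by near: h.
    by near: h; apply/cvgrPdist_le : d d0; exact: fE.
  rewrite -(subrKA (h x)) addrC (le_trans (ler_normD _ _))// lerD//.
  rewrite (le_trans (L2Cb_ler_norm (h - g) x))//.
  rewrite -(subrKA k) (le_trans (ler_normD _ _))// [leRHS]splitr lerD//.
    by move: kh; rewrite -ball_normE /= distrC => /ltW.
  have : ball k (e / 2) g by near: g.
  by rewrite -ball_normE /= => /ltW.
have cf : continuous f.
  move=> x; apply/cvgrPdist_le => e e0.
  have e30 : 0 < e / 3 by rewrite divr_gt0.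
  have /filter_ex[g fg] := Fsup _ e30.
  have [_ cg _] := L2CbP g.
  have /cvgrPdist_le/(_ _ e30) cgx := cg x.
  near=> y.
  rewrite -(subrKA (g x)) -[g x - f y](subrKA (g y)).
  rewrite (le_trans (ler_normD _ _))//.
  rewrite (le_trans (lerD (fg x) (ler_normD _ _)))//.
  have gxy : `|g x - g y| <= e / 3.
    by near: y; exact: cgx.
  have fgy : `|g y - f y| <= e / 3 by rewrite distrC.
  rewrite (le_trans (lerD (lexx _) (lerD gxy fgy)))//.
  by rewrite addrA -!mulrDl -mulr2n -mulrSr -[X in X / _]mulr_natr mulfK.
have FL2 e : 0 < e -> \forall g \near F, (L2norm setT (f - L2Cb_fun g)%R <= e%:E)%E.
  move=> e0; have e20 : 0 < e / 2 by rewrite divr_gt0.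
  have /cauchyP/(_ _ e20)[k Fk] : cauchy F by apply/cauchy_ballP.
  have /choice[h hP] (n : nat) : exists h : L2Cb,
      ball k (e / 2) h /\ forall x, `|f x - h x| <= n.+1%:R^-1.
    apply: (@filter_ex _ F); near=> h; split; first by near: h.
    by near: h; apply: Fsup; rewrite invr_gt0.
  near=> g.
  apply: (@L2norm_fatou (fun n => (h n : R -> C) - (g : R -> C))).
  - exact: ltW.
  - move=> n; have [_ ch _] := L2CbP (h n); have [_ cg _] := L2CbP g.
    by move=> x; apply: cvgB; [exact: ch|exact: cg].
  - move=> x; apply: cvgB; last exact: cvg_cst.
    apply/cvgrPdist_le => d d0; near=> n.
    rewrite (le_trans ((hP n).2 x))//.
    by apply: ltW; near: n; exact: near_infty_natSinv_lt (PosNum d0).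
  - move=> n; rewrite (le_trans (L2norm_le_L2Cb (h n - g)))// lee_fin.
    rewrite -(subrKA k) (le_trans (ler_normD _ _))// [leRHS]splitr lerD//.
      by have := (hP n).1; rewrite -ball_normE /= distrC => /ltW.
    have : ball k (e / 2) g by near: g.
    by rewrite -ball_normE /= => /ltW.
have fP : f \in L2Cb_pred.
  have /filter_ex[g [g1 g2]] : \forall g \near F,
      (forall x, `|f x - L2Cb_fun g x| <= 1) /\ (L2norm setT (f - L2Cb_fun g)%R <= 1%:E)%E.
    by near=> g; split; near: g; [exact: Fsup|exact: FL2].
  have [Lg cg bg] := L2CbP g.
  rewrite inE; split => //.
  - rewrite -(subrK (g : R -> C) f); apply: L2D => //; split.
    + by apply: (continuous_L2_measurable _).1 => x; apply: cvgB; [exact: cf|exact: cg].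
    + by apply: (continuous_L2_measurable _).2 => x; apply: cvgB; [exact: cf|exact: cg].
    + by rewrite (le_lt_trans g2)// ltry.
  - rewrite -(subrK (g : R -> C) f); apply: bounded_onD => //.
    by exists 1 => x _; exact: g1.
apply/cvg_ex; exists (MkL2Cb fP); apply/cvgrPdist_le => e e0.
have e20 : 0 < e / 2 by rewrite divr_gt0.
near=> g.
rewrite [leRHS]splitr lerD//; last first.
  by apply: supnorm_le; near: g; exact: Fsup.
rewrite -lee_fin fineK; first by near: g; exact: FL2.
by apply: L2norm_fin_num; have [] := L2CbP (MkL2Cb fP - g).
Unshelve. all: by end_near. Qed.

HB.instance Definition _ := Uniform_isComplete.Build L2Cb L2Cb_complete.

End L2Cb.

Section Banach_submanifold.
Variables (R : realType) (X : completeNormedModType R).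

(* Continuity of [x |-> 'd f x] is meant in the operator norm. *)
Definition C1_on (V W : normedModType R) (U : set V) (f : V -> W) :=
  (forall x, U x -> differentiable f x) /\
  (forall x, U x -> forall e : R, 0 < e ->
     \forall y \near x, forall v, `|'d f y v - 'd f x v| <= e * `|v|).

Definition C1_diffeo (V W : normedModType R) (U : set V) (U' : set W)
    (f : V -> W) (g : W -> V) :=
  [/\ open U, open U', f @` U = U', {in U, cancel f g} &
      C1_on U f /\ C1_on U' g].

Definition linear_subspace (E : set X) :=
  E 0 /\ forall (a : R) x y, E x -> E y -> E (a *: x + y).

Definition closed_subspace (E : set X) := linear_subspace E /\ closed E.

(* [E] splits: it is closed and has a closed complement. *)
Definition split_subspace (E : set X) :=
  closed_subspace E /\ exists F : set X, [/\ closed_subspace F,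
    E `&` F = [set 0] & forall x, exists y z, [/\ E y, F z & x = y + z]].

(* Near each of its points, [M] is straightened onto an open piece of a split
   subspace by a local diffeomorphism of the ambient space. *)
Definition C1_submanifold (M : set X) := forall p, M p ->
  exists (E U U' : set X) (phi psi : X -> X),
    [/\ split_subspace E, U p, C1_diffeo U U' phi psi &
        phi @` (U `&` M) = U' `&` E].

(* Velocities at [p] of C^1 curves lying in [M]. *)
Definition tangent_space (M : set X) (p : X) : set X := [set v |
  exists (I : set R) (gamma : R -> X),
    [/\ open I, I 0, C1_on I gamma, gamma @` I `<=` M &
        gamma 0 = p /\ derive1 gamma 0 = v]].

(* For a linear subspace [E]: the quotient of the whole space by [E] contains
   [n] linearly independent vectors, for every [n]. *)
Definition infinite_codim_subspace (E : set X) := forall n : nat,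
  exists v : 'I_n -> X, forall c : 'I_n -> R,
    E (\sum_i c i *: v i) -> forall i, c i = 0.

Definition infinite_codim (M : set X) :=
  forall p, M p -> infinite_codim_subspace (tangent_space M p).

End Banach_submanifold.

Section end_point_map.
Variable R : realType.
Local Notation C := (Rcomplex R).
Local Notation mu := (@lebesgue_measure R).

(* e^{i x} *)
Definition expi (x : R) : C := Complex (cos x) (sin x).

Definition Cintegral (D : set R) (f : R -> C) : C :=
  Complex (\int[mu]_(x in D) complex.Re (f x))
          (\int[mu]_(x in D) complex.Im (f x)).

(* [Num.sqrt] vanishes on negative numbers; solutions have norm below 1 when
   the L^2(0, T) norm of [w] is less than 1 / (2 sqrt T), whatever the value
   chosen there. *)
Definition solves_equation (T : R) (w : R -> C) (Z : R -> R -> C) :=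
  forall t omega, t \in `[0, T] ->
    Z t omega = - Cintegral `[0, t] (fun tau =>
        Num.sqrt (1 - `|Z tau omega| ^+ 2) *: w tau * expi (- (omega * tau)))
      * expi (omega * t).

(* [Z] belongs to C^0([0, T], L^2(R)) and to C^0_b([0, T] x R). *)
Definition solution_space (T : R) : set (R -> R -> C) := [set Z |
  [/\ forall t, t \in `[0, T] -> L2 setT (Z t),
      forall t, t \in `[0, T] ->
        L2norm setT (Z s - Z t) @[s --> within `[0, T] (nbhs t)] --> 0%E,
      {within `[0, T] `*` setT, continuous (fun p : R * R => Z p.1 p.2)} &
      bounded_on (`[0, T] `*` setT) (fun p : R * R => Z p.1 p.2)]].

(* The set below is a singleton when the L^2(0, T) norm of [w] is less than
   1 / (2 sqrt T). *)
Definition end_point_map (T : R) (w : R -> C) : L2Cb R :=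
  get [set f : L2Cb R | exists2 Z, solution_space T Z &
    solves_equation T w Z /\ f = Z T :> (R -> C)].

Definition L2_ball (D : set R) (r : R) : set (R -> C) :=
  [set w | L2 D w /\ (L2norm D w < r%:E)%E].

End end_point_map.

(* Main.v *)
Require Import Defs.
From HB Require Import structures.
From mathcomp Require Import all_boot all_order all_algebra.
From mathcomp Require Import complex ring lra.
From mathcomp Require Import all_classical all_reals all_analysis.
From mathcomp Require Import measurable_realfun.
(** The equation is made linear before anything is estimated. Let [w] be minus the
    control and [u t om = Z t om * exp (i om (T - t))]: then [u] is the integral from 0 to
    [t] of [w * exp (i om (T - tau)) * m], where [m = sqrt (1 - |u|^2)], and [u] and [Z]
    agree at time [T]. Formally [m] has the derivative [- Re (conj u * w * exp (..))], so
    that the pair [(u, m - 1)] solves a linear Volterra system in which each component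
    drives the other one. Conversely the solution of this linear system conserves
    [|u|^2 + m^2 = 1] ([conservation]) and has [m >= 0] for small [w], hence it solves the
    original equation ([flow_sqrt]), whose solution is unique ([end_point_mapE]).

    The system is solved by a Neumann series whose parameter is [sqrt T] times the norm of
    [w] (section [volterra]). Its final state is [Ft w] plus a remainder of second order,
    where [Ft w], the integral of [w tau * exp (i om (T - tau))], is a Fourier transform.
    By Plancherel's formula ([plancherel]) [Ft] is an isometry from controls into
    square-integrable functions, up to a constant, so it has a bounded left inverse [S]
    ([left_inverse_exists]). Let [q x] be [sqrt T] times the norm of [S x], let [P = Ft S]
    be the projection onto the range of [Ft] and let [K x] be the remainder for the control
    [S x]. The image of the end point map is the graph of [x + K x] for [q x < r] and
    [P x = x], with [r = 1 / (4 sqrt 3)] ([image_end_point_map]).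

    On the set [q < r <= 1 / 6] the map [K] is of class C1, contracts for [q] with the
    constant [11 / 25] and is Lipschitz from [q] to the norm ([volterra_rest_C1],
    [remainder_lipschitz]). The norm of the space is stronger than [q], and [K] need not
    contract for it, but [q] is enough: [x |-> x + K x] is a C1 diffeomorphism of
    the open set [q < r] onto an open set ([perturbation_C1_diffeo]), which carries a piece
    of the split subspace [P x = x] to the image. This is the submanifold property. On the
    image the norm of a difference [x - y] is at most a multiple of [q (x - y)]; this passes
    to velocities, so that no tangent space contains a nonzero element of the kernel of
    [q]. That kernel contains the transforms of all intervals beyond [T], an infinite
    orthogonal family ([kernel_infinite]): the codimension is infinite, and the image is
    proper. Finally the image is bounded and is not reduced to 0, while its tangent space at
    0 is stable under scaling. *)

Set Implicit Arguments.
Unset Strict Implicit.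
Unset Printing Implicit Defensive.
Import Order.TTheory GRing.Theory Num.Theory.
Import numFieldNormedType.Exports.
Local Open Scope classical_set_scope.
Local Open Scope ring_scope.

(** * Perturbations of the identity and graphs over a subspace *)

Section frechet_criterion.
Context {R : realType} {V W : normedModType R}.

(** The differential is recognised from an explicit bounded linear candidate: this
    avoids handling little-o terms later on. *)
Lemma frechet_criterion (f D : V -> W) (x : V) (M : R) :
  linear D -> (forall v, `|D v| <= M * `|v|) ->
  (forall e, 0 < e -> \forall h \near (0 : V),
     `|f (h + x) - f x - D h| <= e * `|h|) ->
  differentiable f x /\ 'd f x = D :> (V -> W).
Proof.
move=> linD DM fD.
pose D' : {linear V -> W} := HB.pack D (GRing.isLinear.Build R V W _ D linD).
have cD : continuous D'.
  apply: bounded_linear_continuous; apply/linear_boundedP.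
  exists M; split; first exact: num_real.
  by move=> M' /ltW MM' v; rewrite (le_trans (DM v))// ler_wpM2r.
have fE : f \o shift x = cst (f x) + D' +o_ (0 : V) id.
  apply/eqaddoP => e e0; near=> h.
  rewrite !fctE/= opprD addrA.
  by near: h; exact: fD.
split; last by rewrite (diff_unique cD fE).
apply/diff_locallyP; rewrite (diff_unique cD fE); split => //.
Unshelve. all: by end_near. Qed.

Lemma diff_remainder (f : V -> W) (x : V) : differentiable f x ->
  forall e, 0 < e -> \forall h \near (0 : V),
     `|f (h + x) - f x - 'd f x h| <= e * `|h|.
Proof.
move=> /diff_locallyP[_ /eqaddoP fE] e e0.
have := fE e e0; apply: filterS => h; by rewrite !fctE/= opprD addrA.
Qed.

(** Differentiation along a line: a Lipschitz bound between seminorms passes to the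
    limit of difference quotients, so the differential inherits it. *)
Lemma diff_seminorm_le (p : W -> R) (q : V -> R) (Cp c : R) (f : V -> W) x v :
  (forall y z, p (y + z) <= p y + p z) ->
  (forall a y, p (a *: y) = `|a| * p y) ->
  (forall y, p y <= Cp * `|y|) ->
  (forall a y, q (a *: y) = `|a| * q y) ->
  differentiable f x ->
  (\forall h \near (0 : V), p (f (h + x) - f x) <= c * q h) ->
  p ('d f x v) <= c * q v.
Proof.
move=> pD pZ pC qZ df fc; apply/ler_addgt0Pr => e e0.
have pN y : p (- y) = p y by rewrite -scaleN1r pZ normrN1 mul1r.
pose d := e / ((`|Cp| + 1) * (`|v| + 1)).
have d0 : 0 < d by rewrite divr_gt0// mulr_gt0// ltr_wpDl.
have tv : (t *: v : V) @[t --> (0:R)^'] --> (0 : V).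
  apply: cvg_within_filter.
  by rewrite -(scale0r v); apply: cvgZ; [exact: cvg_id|exact: cvg_cst].
pose good h := p (f (h + x) - f x) <= c * q h /\
  `|f (h + x) - f x - 'd f x h| <= d * `|h|.
have /tv H : \forall h \near (0 : V), good h.
  by apply: filterI => //; exact: diff_remainder.
have {}H : \forall t \near (0 : R)^', good (t *: v) := H.
have [t [t1 t2] t0] : exists2 t : R, good (t *: v) & t != 0.
  by near (0 : R)^' => t; exists t; near: t; [exact: H|exact: nbhs_dnbhs_neq].
have t00 : 0 < `|t| by rewrite normr_gt0.
rewrite -(ler_pM2l t00) -pZ -linearZ/= mulrDr mulrCA -qZ.
rewrite -[X in p X](subrK (f (t *: v + x) - f x)) (le_trans (pD _ _))// addrC lerD//.
rewrite -pN opprB (le_trans (pC _))//.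
rewrite (@le_trans _ _ (`|Cp| * `|f (t *: v + x) - f x - 'd f x (t *: v)|))//.
  by rewrite ler_wpM2r// ler_norm.
have D0 : 0 < (`|Cp| + 1) * (`|v| + 1) by rewrite mulr_gt0// ltr_wpDl.
have -> : `|t| * e = `|t| * (d * ((`|Cp| + 1) * (`|v| + 1))).
  by rewrite /d divfK// gt_eqF.
rewrite (@le_trans _ _ (`|Cp| * (d * `|t *: v|)))//; first exact: ler_wpM2l.
rewrite normrZ (_ : _ * _ = `|t| * (d * (`|Cp| * `|v|))); last by ring.
by rewrite ler_pM2l// ler_pM2l// ler_pM// lerDl.
Unshelve. all: by end_near. Qed.

End frechet_criterion.

Section geometric.
Context {R : realType} {X : completeNormedModType R}.

(** Completeness for sequences with geometrically decreasing increments, with the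
    distance to the limit. *)
Lemma geometric_cvg (u : nat -> X) (B c : R) : 0 <= c < 1 ->
  (forall n, `|u n.+1 - u n| <= B * c ^+ n) ->
  exists l, u @ \oo --> l /\ forall n, `|l - u n| <= B / (1 - c) * c ^+ n.
Proof.
move=> /andP[c0 c1] uB.
have B0 : 0 <= B by have := uB 0%N; rewrite expr0 mulr1; apply: le_trans.
have c1' : 0 < 1 - c by rewrite subr_gt0.
have ubd n k : `|u (n + k)%N - u n| <= B / (1 - c) * c ^+ n.
  have H : `|u (n + k)%N - u n| <= B / (1 - c) * c ^+ n * (1 - c ^+ k).
    elim: k => [|k IH]; first by rewrite addn0 subrr normr0 expr0 subrr mulr0.
    rewrite addnS -(subrKA (u (n + k)%N)) (le_trans (ler_normD _ _))//.
    rewrite (le_trans (lerD (uB _) IH))// exprD exprS.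
    rewrite le_eqVlt; apply/orP; left; apply/eqP; field.
    by rewrite lt0r_neq0.
  rewrite (le_trans H)// ler_piMr//; last by rewrite gerBl exprn_ge0.
  by rewrite mulr_ge0 ?exprn_ge0// divr_ge0// ltW.
have bc0 : B / (1 - c) * c ^+ n @[n --> \oo] --> (0 : R).
  rewrite -[X in _ --> X](mulr0 (B / (1 - c))); apply: cvgMr.
  by apply: cvg_expr; rewrite ger0_norm.
have cu : cvg (u @ \oo).
  apply: cauchy_cvg; apply/cauchyP => e e0.
  have /cvgrPdist_lt/(_ e e0) := bc0; move=> -[N _ Ne].
  exists (u N); exists N => // n /= Nn.
  rewrite -ball_normE/= distrC -(subnKC Nn) (le_lt_trans (ubd _ _))//.
  have := Ne N (leqnn N); rewrite sub0r normrN; apply: le_lt_trans.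
  exact: ler_norm.
exists (lim (u @ \oo)); split => // n.
have : `|u (k + n)%N - u n| @[k --> \oo] --> `|lim (u @ \oo) - u n|.
  by apply: cvg_norm; apply: cvgB; [rewrite cvg_shiftn|exact: cvg_cst].
move=> /cvg_lim <-//; apply: limr_le; last by apply: nearW => k; rewrite addnC.
by apply/cvg_ex; eexists; apply: cvg_norm; apply: cvgB; [rewrite cvg_shiftn; exact: cu|exact: cvg_cst].
Qed.

End geometric.

Section perturbation.
Context {R : realType} {X : completeNormedModType R}.
Variables (q : X -> R) (Cq c C : R).
Hypothesis qD : forall x y, q (x + y) <= q x + q y.
Hypothesis qZ : forall a x, q (a *: x) = `|a| * q x.
Hypothesis qC : forall x, q x <= Cq * `|x|.
Hypothesis c01 : 0 <= c < 1.
Hypothesis C0 : 0 <= C.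

Let c1 : 0 < 1 - c. Proof. by case/andP : c01 => _; rewrite subr_gt0. Qed.
Let c0 : 0 <= c. Proof. by case/andP : c01. Qed.

Lemma seminorm0 : q 0 = 0.
Proof. by rewrite -(scale0r 0) qZ normr0 mul0r. Qed.

Lemma seminormN x : q (- x) = q x.
Proof. by rewrite -scaleN1r qZ normrN1 mul1r. Qed.

Lemma seminorm_ge0 x : 0 <= q x.
Proof.
have := qD x (- x); rewrite subrr seminorm0 seminormN -mulr2n.
by rewrite pmulrn_lge0.
Qed.

Lemma seminormB x y : q (x - y) <= q x + q y.
Proof. by rewrite (le_trans (qD _ _))// seminormN. Qed.

Lemma seminorm_distC x y : q (x - y) = q (y - x).
Proof. by rewrite -seminormN opprB. Qed.

Lemma seminorm_ge_bound x : q x <= (`|Cq| + 1) * `|x|.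
Proof.
by rewrite (le_trans (qC x))// ler_wpM2r// (le_trans (ler_norm _))// lerDl.
Qed.

Lemma seminorm_cvg (u : nat -> X) l : u @ \oo --> l -> q (u n) @[n --> \oo] --> q l.
Proof.
move=> ul; apply/cvgrPdist_le => e e0.
have C1 : 0 < `|Cq| + 1 by rewrite ltr_wpDl.
near=> n.
rewrite (@le_trans _ _ (q (l - u n)))//.
  rewrite ler_norml lerBrDr addrC lerBlDr; apply/andP; split.
    by rewrite seminorm_distC -[X in q X <= _](subrK l) addrC.
  by rewrite lerBlDr -{1}(subrK (u n) l).
rewrite (le_trans (seminorm_ge_bound _))// -ler_pdivlMl//.
near: n; move/cvgrPdist_le : ul; apply.
by rewrite mulr_gt0// invr_gt0.
Unshelve. all: by end_near. Qed.

(** Two bounds in terms of the seminorm alone: contraction for [q], and a mere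
    Lipschitz bound for the norm. This form passes to the differentials of [K]. *)
Definition q_lipschitz (A : set X) (K : X -> X) := forall x y, A x -> A y ->
  q (K x - K y) <= c * q (x - y) /\ `|K x - K y| <= C * q (x - y).

(** A Lipschitz constant of the inverse of [id + K]: the seminorm is controlled first,
    by contraction, and then controls the norm. *)
Definition pert_lip : R := 1 + C * (`|Cq| + 1) / (1 - c).

Lemma pert_lip_gt0 : 0 < pert_lip.
Proof.
rewrite ltr_wpDr// divr_ge0//; last exact: ltW.
by rewrite mulr_ge0// addr_ge0.
Qed.

Lemma perturbation_expansive A K x y : q_lipschitz A K -> A x -> A y ->
  q (x - y) <= q ((x + K x) - (y + K y)) / (1 - c) /\
  `|x - y| <= `|(x + K x) - (y + K y)| + C * q (x - y).
Proof.
move=> LK Ax Ay; have [L1 L2] := LK _ _ Ax Ay.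
have E : x - y = ((x + K x) - (y + K y)) - (K x - K y).
  by rewrite opprD addrACA addrK.
split.
  rewrite ler_pdivlMr// mulrBr mulr1 mulrC lerBlDr.
  rewrite {1}E (le_trans (seminormB _ _))// lerD//.
by rewrite {1}E (le_trans (ler_normB _ _))// lerD.
Qed.

Lemma perturbation_lipschitz A K x y : q_lipschitz A K -> A x -> A y ->
  `|x - y| <= pert_lip * `|(x + K x) - (y + K y)|.
Proof.
move=> LK Ax Ay; have [L1 L2] := perturbation_expansive LK Ax Ay.
rewrite (le_trans L2)// /pert_lip mulrDl mul1r lerD// -!mulrA ler_wpM2l//.
rewrite (le_trans L1)// mulrCA mulrC ler_pM2l ?invr_gt0//.
exact: seminorm_ge_bound.
Qed.

(** Picard's iteration of [x |-> y - K x]. It contracts for the seminorm only; the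
    norm bound by the seminorm makes the iterates converge nonetheless. *)
Lemma perturbation_solve K x0 y rho :
  q_lipschitz [set x | q (x - x0) <= rho] K ->
  q (y - (x0 + K x0)) <= (1 - c) * rho ->
  exists2 x, q (x - x0) <= rho & x + K x = y.
Proof.
move=> LK yrho; set A := [set x | _] in LK.
have rho0 : 0 <= rho by rewrite -(pmulr_rge0 _ c1) (le_trans (seminorm_ge0 _) yrho).
have Ax0 : A x0 by rewrite /A/= subrr seminorm0.
pose g x := y - K x; pose u n := iter n g x0.
have Ag x : A x -> A (g x).
  move=> Ax; rewrite /A/= /g.
  have -> : y - K x - x0 = (y - (x0 + K x0)) - (K x - K x0).
    by rewrite opprB opprD [X in _ = X + _]addrA subrKA addrAC.
  rewrite (le_trans (seminormB _ _))// (_ : rho = (1 - c) * rho + c * rho); last by ring.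
  by rewrite lerD//; apply: le_trans (LK _ _ Ax Ax0).1 _; rewrite ler_wpM2l.
have Au n : A (u n) by elim: n => //= n IH; exact: Ag.
have uS n : u n.+1 = y - K (u n) by [].
have subl a b : (y - a) - (y - b) = b - a by rewrite opprB addrC addrA subrK.
have uq n : q (u n.+1 - u n) <= c ^+ n * q (u 1%N - u 0%N).
  elim: n => [|n IH]; first by rewrite expr0 mul1r.
  rewrite (uS n.+1) {2}(uS n) subl seminorm_distC.
  rewrite (le_trans (LK _ _ (Au _) (Au _)).1)// exprS -mulrA ler_wpM2l//.
pose v n := u n.+1.
have vB n : `|v n.+1 - v n| <= C * q (u 1%N - u 0%N) * c ^+ n.
  rewrite /v (uS n.+1) {2}(uS n) subl distrC.
  rewrite (le_trans (LK _ _ (Au _) (Au _)).2)// -mulrA ler_wpM2l//.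
  by rewrite mulrC.
have [x [vx _]] := geometric_cvg c01 vB.
have Ax : A x.
  rewrite /A/=; have : q (v n - x0) @[n --> \oo] --> q (x - x0).
    by apply: seminorm_cvg; apply: cvgB => //; exact: cvg_cst.
  move=> qv; rewrite -(cvg_lim _ qv)//; apply: limr_le; first by apply/cvg_ex; exists (q (x - x0)).
  by apply: nearW => n; exact: (Au n.+1).
exists x => //.
suff E : y - K x = x by rewrite -{1}E subrK.
have gv : g (v n) @[n --> \oo] --> x.
  by rewrite -(@cvg_shiftS _ v) in vx.
apply: (cvg_unique _ _ gv) => //=.
apply: cvgB; first exact: cvg_cst.
have qvx : C * q (x - v n) @[n --> \oo] --> (0 : R).
  rewrite -(mulr0 C) -seminorm0 -(subrr x); apply: cvgMr.
  by apply: seminorm_cvg; apply: cvgB => //; exact: cvg_cst.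
apply/cvgrPdist_le => e e0; near=> n.
rewrite (le_trans (LK _ _ Ax (Au n.+1)).2)//.
rewrite -[leLHS]subr0 (le_trans (ler_norm _))// distrC.
by near: n; move/cvgrPdist_le : qvx; apply.
Unshelve. all: by end_near. Qed.

End perturbation.

Section inverse_function.
Context {R : realType} {X : completeNormedModType R}.
Variables (q : X -> R) (Cq c C r : R) (K : X -> X).
Hypothesis qD : forall x y, q (x + y) <= q x + q y.
Hypothesis qZ : forall a x, q (a *: x) = `|a| * q x.
Hypothesis qC : forall x, q x <= Cq * `|x|.
Hypothesis c01 : 0 <= c < 1.
Hypothesis C0 : 0 <= C.
Let Omega := [set x : X | q x < r].
Hypothesis LK : q_lipschitz q c C Omega K.
Hypothesis KC1 : C1_on Omega K.

Let c1 : 0 < 1 - c. Proof. by case/andP : c01 => _; rewrite subr_gt0. Qed.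
Let c0 : 0 <= c. Proof. by case/andP : c01. Qed.

Let psi x := x + K x.
Let U := psi @` Omega.
Let phi (y : X) : X := get [set x : X | Omega x /\ psi x = y].
Let Lip := pert_lip Cq c C.
Let Lip0 : 0 < Lip. Proof. exact: pert_lip_gt0. Qed.

Lemma seminorm_ball_open x0 rho : open [set x | q (x - x0) < rho].
Proof.
rewrite openE => x /= xr.
have Cq1 : 0 < `|Cq| + 1 by rewrite ltr_wpDl.
have d0 : 0 < (rho - q (x - x0)) / (`|Cq| + 1) by rewrite divr_gt0 ?subr_gt0.
apply/nbhs_ballP; exists ((rho - q (x - x0)) / (`|Cq| + 1)) => //= y.
rewrite -ball_normE /= ltr_pdivlMr// => xy.
rewrite -(subrK x y) -addrA (le_lt_trans (qD _ _))// -ltrBrDr (le_lt_trans (seminorm_ge_bound qC _))//.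
by rewrite distrC mulrC.
Qed.

Let openOmega : open Omega.
Proof.
have := @seminorm_ball_open 0 r; congr open; apply/seteqP; split => x /=;
  by rewrite subr0.
Qed.

Lemma inverse_inj x y : Omega x -> Omega y -> psi x = psi y -> x = y.
Proof.
move=> hOx hOy xy; apply/eqP; rewrite -subr_eq0 -normr_le0.
rewrite (le_trans (perturbation_lipschitz qD qZ qC c01 C0 LK hOx hOy))//.
by rewrite -/(psi x) -/(psi y) xy subrr normr0 mulr0.
Qed.

Let phiP y : U y -> Omega (phi y) /\ psi (phi y) = y.
Proof. by move=> [x hOx <-]; apply: (@getPex _ [set z | Omega z /\ psi z = _]); exists x. Qed.

Let phiK x : Omega x -> phi (psi x) = x.
Proof.
move=> hOx; have [|hO1 E] := @phiP (psi x); first by exists x.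
exact: inverse_inj.
Qed.

Let openU : open U.
Proof.
rewrite openE => _ [x0 Ox0 <-].
pose rho := (r - q x0) / 2.
have rho0 : 0 < rho by rewrite divr_gt0// subr_gt0.
have sub x : q (x - x0) <= rho -> Omega x.
  move=> xr; rewrite /Omega/= -(subrK x0 x) (le_lt_trans (qD _ _))//.
  rewrite (@le_lt_trans _ _ (rho + q x0)) ?lerD2r// /rho.
  by have : q x0 < r by []; lra.
have := @seminorm_ball_open (psi x0) ((1 - c) * rho).
rewrite openE => /(_ (psi x0)); rewrite /= subrr (seminorm0 qZ) mulr_gt0// => /(_ isT).
apply: filterS => y /= /ltW yr.
have [|x xr xy] := perturbation_solve qD qZ qC c01 C0 _ yr.
  by move=> x y' /sub hOx /sub hOy; exact: LK.
by exists x => //; exact: sub.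
Qed.

Let phi_lip y y' : U y -> U y' -> `|phi y - phi y'| <= Lip * `|y - y'|.
Proof.
move=> /phiP[hO1 E1] /phiP[hO2 E2].
have := perturbation_lipschitz qD qZ qC c01 C0 LK hO1 hO2.
by rewrite -/(psi _) -/(psi (phi y')) E1 E2.
Qed.

Let diffK_lip x : Omega x -> q_lipschitz q c C setT ('d K x).
Proof.
move=> hOx v w _ _; rewrite -linearB.
have nearO : \forall h \near (0 : X), Omega (h + x).
  have : \forall z \near x, Omega z by exact: open_nbhs_nbhs.
  by rewrite (near_shift 0)/= subr0.
have dK := (KC1.1 x hOx).
split.
- apply: (@diff_seminorm_le _ _ _ q q Cq) => //.
  apply: filterS nearO => h Oh; have := (LK Oh hOx).1; by rewrite addrK.
- apply: (@diff_seminorm_le _ _ _ Num.norm q 1) => //.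
  + by move=> y z; exact: ler_normD.
  + by move=> a y; rewrite normrZ.
  + by move=> y; rewrite mul1r.
  + apply: filterS nearO => h Oh; have := (LK Oh hOx).2; by rewrite addrK.
Qed.

(* Candidate for the differential of the inverse: the inverse of [id + 'd K x]. *)
Let G (x v : X) : X := get [set z : X | z + 'd K x z = v].

Let GP x v : Omega x -> G x v + 'd K x (G x v) = v.
Proof.
move=> hOx; apply: (@getPex _ [set z | z + 'd K x z = v]).
have [||z _ zv] := @perturbation_solve _ _ q Cq c C qD qZ qC c01 C0 ('d K x) (0 : X) v (q v / (1 - c)).
- by move=> y z _ _; exact: diffK_lip.
- by rewrite linear0 addr0 subr0 mulrC divfK// gt_eqF.
- by exists z.
Qed.

Let G_uniq x v z : Omega x -> z + 'd K x z = v -> z = G x v.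
Proof.
move=> hOx zv; apply/eqP; rewrite -subr_eq0 -normr_le0.
rewrite (le_trans (perturbation_lipschitz qD qZ qC c01 C0 (diffK_lip hOx) I I))//.
by rewrite zv GP// subrr normr0 mulr0.
Qed.

Let G_bound x v : Omega x -> `|G x v| <= Lip * `|v|.
Proof.
move=> hOx; have := perturbation_lipschitz qD qZ qC c01 C0 (diffK_lip hOx) (x := G x v) (y := (0 : X)) I I.
by rewrite GP// (linear0 ('d K x)) addr0 !subr0.
Qed.

Let G_linear x : Omega x -> linear (G x).
Proof.
move=> hOx a v w; apply/esym/G_uniq => //.
by rewrite linearP addrACA -scalerDr !GP.
Qed.

Let phi_diff y : U y -> differentiable phi y /\ 'd phi y = G (phi y) :> (X -> X).
Proof.
move=> Uy; have [hOx xy] := phiP Uy; set x := phi y in hOx xy *.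
apply: (@frechet_criterion _ _ _ _ _ _ Lip); [exact: G_linear|by move=> v; exact: G_bound|].
move=> e e0; have e1 : 0 < e / (Lip * Lip) by rewrite divr_gt0// mulr_gt0.
have nearU : \forall h \near (0 : X), U (h + y).
  have : \forall z \near y, U z by exact: open_nbhs_nbhs.
  by rewrite (near_shift 0)/= subr0.
have rem := diff_remainder (KC1.1 x hOx) e1.
have cv : (fun h : X => phi (h + y) - x) @ (0 : X) --> (0 : X).
  apply/cvgrPdist_le => d d0; near=> h.
  rewrite sub0r normrN (le_trans (phi_lip _ Uy))//; first by near: h.
  rewrite addrK -ler_pdivlMl//.
  have : `|0 - h| <= Lip^-1 * d; last by rewrite sub0r normrN.
  near: h; apply/nbhs_ballP; exists (Lip^-1 * d).
    by rewrite /= mulr_gt0// invr_gt0.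
  by move=> h; rewrite -ball_normE /= => /ltW.
pose good k := `|K (k + x) - K x - 'd K x k| <= e / (Lip * Lip) * `|k|.
have remk : \forall h \near (0 : X), good (phi (h + y) - x) := cv _ rem.
near=> h.
have Uh : U (h + y) by near: h.
have [hOxh xh] := phiP Uh; set k := phi (h + y) - x.
have kE : k + x = phi (h + y) by rewrite subrK.
have hE : h = k + 'd K x k + (K (k + x) - K x - 'd K x k).
  rewrite addrACA subrr addr0 kE.
  rewrite {1}(_ : h = psi (phi (h + y)) - psi x); last by rewrite xh xy addrK.
  by rewrite /psi opprD addrACA.
have -> : G x h = k + G x (K (k + x) - K x - 'd K x k).
  have G1 : k = G x (k + 'd K x k) by exact: G_uniq.
  have := G_linear hOx 1 (k + 'd K x k) (K (k + x) - K x - 'd K x k).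
  by rewrite !scale1r -G1 -hE.
rewrite opprD addrA subrr add0r normrN (le_trans (G_bound _ hOx))//.
rewrite (@le_trans _ _ (Lip * (e / (Lip * Lip) * `|k|)))//.
  rewrite ler_pM2l// -/(good k) /k; near: h; exact: remk.
have kh : `|k| <= Lip * `|h|.
  by have := phi_lip Uh Uy; rewrite addrK.
rewrite (@le_trans _ _ (Lip * (e / (Lip * Lip) * (Lip * `|h|))))//.
  by rewrite ler_pM2l// ler_pM2l.
rewrite le_eqVlt; apply/orP; left; apply/eqP; field.
by rewrite gt_eqF.
Unshelve. all: by end_near. Qed.

Let psi_diff x : Omega x -> differentiable psi x /\ 'd psi x = id \+ 'd K x :> (X -> X).
Proof.
move=> hOx; have dK := KC1.1 _ hOx.
apply: (@frechet_criterion _ _ _ _ (fun v => v + 'd K x v) _ (1 + C * (`|Cq| + 1))).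
- by move=> a v w; rewrite linearP addrACA -scalerDr.
- move=> v; rewrite (le_trans (ler_normD _ _))// mulrDl mul1r lerD2l.
  have [_] := (diffK_lip hOx : q_lipschitz _ _ _ _ _) v (0 : X) I I.
  rewrite (linear0 ('d K x)) !subr0 => /le_trans; apply.
  by rewrite -mulrA ler_wpM2l// seminorm_ge_bound.
- move=> e e0; have := diff_remainder (KC1.1 x hOx) e0.
  apply: filterS => h; congr (`|_| <= _).
  rewrite /psi !opprD; apply/esym.
  by rewrite (addrACA (h + x)) addrK (addrACA h) subrr add0r.
Qed.

(** The inverse function theorem for [id + K]. The map is onto an open set by
    [perturbation_solve], injective by expansiveness, and the same two facts applied to
    the differentials of [K] invert [id + 'd K x]. *)
Theorem perturbation_C1_diffeo : C1_diffeo U Omega phi psi.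
Proof.
split; [exact: openU|exact: openOmega| | |].
- apply/seteqP; split => x.
    by move=> [y Uy <-]; exact: (phiP Uy).1.
  by move=> hOx; exists (psi x); [exists x|exact: phiK].
- by move=> y /set_mem Uy; exact: (phiP Uy).2.
- split; split.
  + by move=> y /phi_diff[].
  + move=> y Uy e e0.
    have [hOx xy] := phiP Uy.
    have e1 : 0 < e / (Lip * Lip) by rewrite divr_gt0// mulr_gt0.
    have phic : phi z @[z --> y] --> phi y.
      exact: differentiable_continuous (phi_diff Uy).1.
    have H := phic _ (KC1.2 _ hOx _ e1).
    have nU : \forall z \near y, U z by exact: open_nbhs_nbhs.
    near=> z => v.
    have Uz : U z by near: z.
    have [hOz zE] := phiP Uz.
    rewrite (phi_diff Uy).2 (phi_diff Uz).2.
    set a := G (phi z) v; set b := G (phi y) v.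
    have abE : a - b = G (phi z) ('d K (phi y) b - 'd K (phi z) b).
      apply: G_uniq => //; rewrite linearB/= addrACA {1}/a GP//.
      by rewrite -{1}(GP v hOx) -/b addrACA subrr add0r.
    rewrite abE (le_trans (G_bound _ hOz))// distrC.
    rewrite (@le_trans _ _ (Lip * (e / (Lip * Lip) * `|b|)))//.
      rewrite ler_pM2l//; move: (b); near: z; exact: H.
    rewrite (@le_trans _ _ (Lip * (e / (Lip * Lip) * (Lip * `|v|))))//.
      by rewrite ler_pM2l// ler_pM2l// G_bound.
    rewrite le_eqVlt; apply/orP; left; apply/eqP; field.
    by rewrite gt_eqF.
  + by move=> x /psi_diff[].
  + move=> x hOx e e0; near=> y => v.
    have hOy : Omega y by near: y; exact: open_nbhs_nbhs.
    rewrite (psi_diff hOx).2 (psi_diff hOy).2/= opprD addrACA subrr add0r.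
    move: v; near: y; exact: KC1.2.
Unshelve. all: by end_near. Qed.

End inverse_function.

Lemma C1_on_differential (R : realType) (V W : normedModType R) (U : set V)
    (f : V -> W) (D : V -> V -> W) : open U ->
  (forall x, U x -> differentiable f x /\ 'd f x = D x :> (V -> W)) ->
  (forall x, U x -> forall e : R, 0 < e ->
     \forall y \near x, U y -> forall v, `|D y v - D x v| <= e * `|v|) ->
  C1_on U f.
Proof.
move=> oU fD cD; split=> [x /fD[]//|x Ux e e0].
have nU : \forall y \near x, U y by exact: open_nbhs_nbhs.
have := cD x Ux e e0; apply: filterS2 nU => y Uy /(_ Uy) H v.
by rewrite (fD _ Ux).2 (fD _ Uy).2.
Qed.

(** Reparametrisation of a curve by a homothety: the tangent space is stable under
    scaling. *)
Lemma C1_on_scale (R : realType) (V W : normedModType R) (U : set V)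
    (f : V -> W) (a : R) : open U -> C1_on U f ->
  [/\ open [set x | U (a *: x)], C1_on [set x | U (a *: x)] (fun x => f (a *: x)) &
    forall x h, U (a *: x) -> 'd (fun x => f (a *: x)) x h = 'd f (a *: x) (a *: h)].
Proof.
move=> oU [df cf].
have ca : continuous (fun t : V => a *: t) by exact: scaler_continuous.
pose J := [set x | U (a *: x)].
pose g t := f (a *: t).
have oJ : open J by move/continuousP : ca; exact.
have a1 : 0 < `|a| + 1 by rewrite ltr_wpDl.
have le_a e h : 0 < e -> e / (`|a| + 1) * `|a *: h| <= e * `|h|.
  move=> e0; rewrite normrZ mulrA ler_wpM2r// mulrAC ler_pdivrMr//.
  by rewrite ler_wpM2l ?lerDl// ltW.
pose D (t h : V) := 'd f (a *: t) (a *: h).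
have gd t : J t -> differentiable g t /\ 'd g t = D t :> (V -> W).
  move=> Jt; have dft := df _ Jt.
  have /linear_boundedP[M [_ fM]] : bounded_near ('d f (a *: t)) (nbhs (0 : V)).
    by apply/linear_bounded_continuous; exact: diff_continuous.
  apply: (@frechet_criterion _ _ _ _ (D t) _ ((`|M| + 1) * `|a|)).
  - by move=> b x y; rewrite /D scalerDr linearD/= scalerA (mulrC a) -scalerA linearZ.
  - move=> x; rewrite /D -mulrA -normrZ fM// (le_lt_trans (ler_norm _))//.
    by rewrite ltrDl.
  move=> e e0; have e1 : 0 < e / (`|a| + 1) by rewrite divr_gt0.
  pose good h := `|f (h + a *: t) - f (a *: t) - 'd f (a *: t) h|
    <= e / (`|a| + 1) * `|h|.
  have ca0 : a *: h @[h --> (0 : V)] --> (0 : V).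
    by have : a *: h @[h --> (0 : V)] --> a *: (0 : V) := ca 0; rewrite scaler0.
  have H : \forall h \near (0 : V), good (a *: h) := ca0 _ (diff_remainder dft e1).
  apply: filterS H => h; rewrite /good /g /D scalerDr => /le_trans; apply.
  exact: le_a.
split => //; last by move=> x h Jx; rewrite -/(D x h) -(gd x Jx).2.
apply: (@C1_on_differential _ _ _ _ _ D) => // t Jt e e0.
have e1 : 0 < e / (`|a| + 1) by rewrite divr_gt0.
pose good s := forall u, `|'d f s u - 'd f (a *: t) u| <= e / (`|a| + 1) * `|u|.
have H : \forall s \near t, good (a *: s) := ca t _ (cf _ Jt _ e1).
apply: filterS H => s gs _ u.
by rewrite /D (le_trans (gs _))// le_a.
Qed.

Section tangent_facts.
Context {R : realType} {X : completeNormedModType R}.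
Implicit Types (M : set X).

Lemma tangent_spaceZ M p v (a : R) :
  tangent_space M p v -> tangent_space M p (a *: v).
Proof.
move=> [I [gamma [oI I0 Cg gM [gp gv]]]].
have [oJ CJ dJ] := C1_on_scale a oI Cg.
exists [set x | I (a *: (x : R^o))], (fun x => gamma (a *: (x : R^o))); split => //.
- by rewrite /= scaler0.
- by move=> _ [t Jt <-]; apply: gM; exists (a *: (t : R^o)).
- have J0 : I (a *: (0 : R^o)) by rewrite scaler0.
  split; first by rewrite scaler0.
  rewrite derive1E deriveE; last exact: CJ.1.
  rewrite dJ// scaler0 linearZ/=; congr (_ *: _).
  by rewrite -gv derive1E deriveE//; exact: Cg.1.
Qed.

(** An inequality between differences of points of [M] passes to velocities, since a
    velocity is a limit of scaled differences. *)
Lemma tangent_space_seminorm (q : X -> R) (Cq B : R) M p v :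
  (forall x y, q (x + y) <= q x + q y) ->
  (forall a x, q (a *: x) = `|a| * q x) ->
  (forall x, q x <= Cq * `|x|) -> 0 <= B ->
  (forall x y, M x -> M y -> `|x - y| <= B * q (x - y)) ->
  tangent_space M p v -> `|v| <= B * q v.
Proof.
move=> qD qZ qC B0 MB [I [gamma [oI I0 [dg _] gM [gp gv]]]].
apply/ler_addgt0Pr => e e0.
have Cq1 : 0 < B * (`|Cq| + 1) + 1 by rewrite ltr_wpDl// mulr_ge0// addr_ge0.
pose d := e / (B * (`|Cq| + 1) + 1).
have d0 : 0 < d by rewrite divr_gt0.
have dg0 := dg _ I0.
have rem : \forall h \near (0 : R)^', `|gamma (h + 0) - gamma 0 - 'd gamma 0 h| <= d * `|h|.
  by apply: cvg_within; exact: (diff_remainder dg0 d0).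
have nI : \forall h \near (0 : R)^', I h.
  by apply: cvg_within; exact: open_nbhs_nbhs.
have [t [[t1 tI] t0]] : exists t : R, (`|gamma (t + 0) - gamma 0 - 'd gamma 0 t| <= d * `|t| /\ I t) /\ t != 0.
  by near (0 : R)^' => t; exists t; split; [split|]; near: t; [exact: rem|exact: nI|exact: nbhs_dnbhs_neq].
have vE : 'd gamma 0 t = t *: v.
  rewrite -gv derive1E deriveE// -linearZ/=; congr ('d _ _ _).
  by rewrite /GRing.scale/= mulr1.
rewrite vE addr0 in t1.
have tp : 0 < `|t| by rewrite normr_gt0.
have MB1 : `|gamma t - gamma 0| <= B * q (gamma t - gamma 0).
  by apply: MB; apply: gM; [exists t|exists 0].
rewrite -(ler_pM2l tp) -normrZ.
set D := gamma t - gamma 0 in t1 MB1 *.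
rewrite (@le_trans _ _ (`|D| + d * `|t|))//.
  by rewrite -{1}(subrK D (t *: v)) addrC (le_trans (ler_normD _ _))// lerD2l distrC.
have qDv : q D <= `|t| * q v + (`|Cq| + 1) * (d * `|t|).
  rewrite -{1}(subrK (t *: v) D) addrC (le_trans (qD _ _))// qZ lerD2l.
  by rewrite (le_trans (seminorm_ge_bound qC _))// ler_wpM2l// addr_ge0.
rewrite (le_trans (lerD (le_trans MB1 (ler_wpM2l B0 qDv)) (lexx _)))//.
have <- : d * (B * (`|Cq| + 1) + 1) = e by rewrite /d divfK// gt_eqF.
rewrite le_eqVlt; apply/orP; left; apply/eqP; ring.
Unshelve. all: by end_near. Qed.

End tangent_facts.

Section graph_submanifold.
Context {R : realType} {X : completeNormedModType R}.
Variables (q : X -> R) (Cq c C CP r : R) (K P : X -> X).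
Hypothesis qD : forall x y, q (x + y) <= q x + q y.
Hypothesis qZ : forall a x, q (a *: x) = `|a| * q x.
Hypothesis qC : forall x, q x <= Cq * `|x|.
Hypothesis c01 : 0 <= c < 1.
Hypothesis C0 : 0 <= C.
Hypothesis LK : q_lipschitz q c C [set x | q x < r] K.
Hypothesis KC1 : C1_on [set x : X | q x < r] K.
Hypothesis r0 : 0 < r.
Hypothesis K0 : K 0 = 0.
Hypothesis linP : linear P.
Hypothesis PP : forall x, P (P x) = P x.
Hypothesis CP0 : 0 <= CP.
Hypothesis PC : forall x, `|P x| <= CP * q x.
Hypothesis kerq_infinite : forall n, exists v : 'I_n -> X,
  (forall i, q (v i) = 0) /\
  forall a : 'I_n -> R, \sum_i a i *: v i = 0 -> forall i, a i = 0.
Hypothesis rangeP : exists2 e, e != 0 & P e = e.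

Let M := (fun x => x + K x) @` [set x | q x < r /\ P x = x].
Let c1 : 0 < 1 - c. Proof. by case/andP : c01 => _; rewrite subr_gt0. Qed.
Let PB x y : P (x - y) = P x - P y.
Proof.
have := linP (-1) y x; rewrite !scaleN1r => E.
by rewrite addrC E addrC.
Qed.
Let P0 : P 0 = 0. Proof. by have := PB 0 0; rewrite !subrr. Qed.
Let q0 : q 0 = 0. Proof. by rewrite (seminorm0 qZ). Qed.

Let closedP (Q : X -> X) : (forall x, `|Q x| <= (CP * (`|Cq| + 1) + 1) * `|x|) ->
  (forall x y, Q (x - y) = Q x - Q y) -> closed [set x | Q x = 0].
Proof.
move=> QC QB; rewrite -openC openE => x /= Qx.
set B := CP * _ + 1 in QC *.
have B0 : 0 < B by rewrite ltr_wpDl// mulr_ge0// addr_ge0.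
apply/nbhs_ballP; exists (`|Q x| / B); first by rewrite /= divr_gt0// normr_gt0; exact/eqP.
move=> y; rewrite -ball_normE/= ltr_pdivlMr// => xy Qy.
have := QC (x - y); rewrite QB Qy subr0 leNgt => /negP; apply.
by rewrite mulrC.
Qed.

Let PC' x : `|P x| <= CP * (`|Cq| + 1) * `|x|.
Proof.
by rewrite (le_trans (PC x))// -mulrA ler_wpM2l// seminorm_ge_bound.
Qed.

Let rangeE : [set x | P x = x] = [set x | x - P x = 0].
Proof.
apply/seteqP; split => x /=; first by move=> ->; rewrite subrr.
by move=> /eqP; rewrite subr_eq0 => /eqP <-.
Qed.

Let split_range : split_subspace [set x | P x = x].
Proof.
split.
  split; first by split => //= a x y Ex Ey; rewrite linP Ex Ey.
  rewrite rangeE; apply: closedP.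
    by move=> x; rewrite (le_trans (ler_normB _ _))// mulrDl mul1r addrC lerD.
  by move=> x y; rewrite PB !opprD addrACA.
exists [set x | P x = 0]; split.
- split.
    split => //= a x y Ex Ey; by rewrite linP Ex Ey scaler0 addr0.
  apply: closedP => // x; rewrite (le_trans (PC' x))// mulrDl lerDl.
  by rewrite mul1r.
- apply/seteqP; split => x /=; last by move=> ->.
  by move=> [h1 h2]; rewrite -h1 h2.
- move=> x; exists (P x), (x - P x); split => //=.
    by rewrite PB PP subrr.
  by rewrite addrC subrK.
Qed.

Let B := (CP + C) / (1 - c).
Let B0 : 0 <= B. Proof. by rewrite /B divr_ge0 ?(ltW c1)// addr_ge0. Qed.

Let Mq x y : M x -> M y -> `|x - y| <= B * q (x - y).
Proof.
move=> [a [qa Pa] <-] [b [qb Pb] <-].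
have [E1 _] := perturbation_expansive qD qZ c01 LK qa qb.
have ab : `|a - b| <= CP * q (a - b).
  by have := PC (a - b); rewrite PB Pa Pb.
have Kab := (LK qa qb).2.
rewrite opprD addrACA (le_trans (ler_normD _ _))//.
rewrite -addrACA -opprD (le_trans (lerD ab Kab))// -mulrDl /B -mulrA.
by rewrite ler_wpM2l ?addr_ge0// mulrC.
Qed.

Let M0 : M 0.
Proof. by exists 0; rewrite ?K0 ?addr0//; split; rewrite ?q0. Qed.

(** The inverse of [id + K] straightens the graph onto the range of the projection
    [P], which is complemented by the kernel of [P]. *)
Theorem graph_submanifold : C1_submanifold M.
Proof.
move=> p Mp.
exists [set x | P x = x], ((fun x => x + K x) @` [set x | q x < r]), [set x | q x < r].
exists (fun y => get [set x : X | q x < r /\ x + K x = y]), (fun x => x + K x).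
have cd := perturbation_C1_diffeo qD qZ qC c01 C0 LK KC1.
have inj := inverse_inj qD qZ qC c01 C0 LK.
split => //.
  by case: Mp => x [qx _] <-; exists x.
have phiK x : q x < r -> get [set z : X | q z < r /\ z + K z = x + K x] = x.
  move=> qx; have [|qz zx] := @getPex _ [set z : X | q z < r /\ z + K z = x + K x].
    by exists x.
  exact: inj.
apply/seteqP; split => x.
- move=> [_ [[y qy <-] [z [qz Pz] zy]] <-].
  by rewrite -zy phiK.
- by move=> [qx Px]; exists (x + K x); [split; exists x|rewrite phiK].
Qed.

(** Differences of points of the graph cannot lie in the kernel of [q]. *)
Theorem graph_proper : M <> setT.
Proof.
move=> MT; have [v [qv vfree]] := kerq_infinite 1.
have Mv : M (v ord0) by rewrite MT.
have := Mq Mv M0; rewrite subr0 qv mulr0 normr_le0 => /eqP v0.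
have := vfree (fun=> 1); rewrite big_ord1 v0 scaler0 => /(_ erefl ord0)/eqP.
by rewrite oner_eq0.
Qed.

(** A tangent vector [v] satisfies [`|v| <= B * q v], so the tangent spaces meet the
    kernel of [q] in 0 only. *)
Theorem graph_infinite_codim : infinite_codim M.
Proof.
move=> p Mp n; have [v [qv vfree]] := kerq_infinite n.
exists v => a Tv; apply: vfree.
have := tangent_space_seminorm qD qZ qC B0 Mq Tv.
have -> : q (\sum_i a i *: v i) = 0.
  apply/eqP; rewrite eq_le (seminorm_ge0 qD qZ) andbT.
  elim/big_ind : _ => [|x y x0 y0|i _]; first by rewrite q0.
    by rewrite (le_trans (qD _ _))// -(addr0 0) lerD.
  by rewrite qZ qv mulr0.
by rewrite mulr0 normr_le0 => /eqP.
Qed.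

(** The graph is bounded, whereas the tangent space at 0 is stable under scaling. *)
Theorem graph_neq_tangent : M <> tangent_space M 0.
Proof.
move=> MT; have [e e0 Pe] := rangeP.
have qe := seminorm_ge0 qD qZ e.
pose a := r / (q e + 1).
have a0 : 0 < a by rewrite divr_gt0// ltr_wpDl.
pose f := a *: e + K (a *: e).
have qf : q (a *: e) < r.
  by rewrite qZ gtr0_norm// /a mulrAC ltr_pdivrMr ?ltr_wpDl// ltr_pM2l// ltrDl.
have Pf : P (a *: e) = a *: e.
  by have := linP a e 0; rewrite !addr0 P0 addr0 Pe.
have Mf : M f by exists (a *: e).
have f0 : f != 0.
  apply/eqP => f0; have : a *: e = 0.
    apply: (inverse_inj qD qZ qC c01 C0 LK) => //=; first by rewrite q0.
    by rewrite K0 addr0.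
  by move=> /eqP; rewrite scaler_eq0 (gt_eqF a0) (negbTE e0).
have Mb x : M x -> `|x| <= (CP + C) * r.
  move=> [y [qy Py] <-]; rewrite (le_trans (ler_normD _ _))// mulrDl lerD//.
    by rewrite -{1}Py (le_trans (PC y))// ler_wpM2l// ltW.
  have q0r : q 0 < r by rewrite q0.
  have := (LK qy q0r).2; rewrite K0 !subr0 => /le_trans; apply.
  by rewrite ler_wpM2l// ltW.
pose b := ((CP + C) * r + 1) / `|f|.
have b0 : 0 <= b by rewrite divr_ge0// addr_ge0// mulr_ge0 ?addr_ge0// ltW.
have : M (b *: f) by rewrite MT; apply: tangent_spaceZ; rewrite -MT.
move=> /Mb; rewrite normrZ ger0_norm// divfK ?normr_eq0//.
by rewrite leNgt ltrDl ltr01.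
Qed.

End graph_submanifold.

(** * Linear Volterra equations depending on a parameter *)

Lemma near0_norm_small (R : realType) (V : normedModType R) (B e : R) :
  0 <= B -> 0 < e -> \forall h \near (0 : V), B * `|h| <= e.
Proof.
move=> B0 e0; have B1 : 0 < B + 1 by rewrite ltr_wpDl.
apply/nbhs_ballP; exists (e / (B + 1)); first by rewrite /= divr_gt0.
move=> h; rewrite -ball_normE/= sub0r normrN ltr_pdivlMr// => he.
by rewrite (le_trans _ (ltW he))// mulrC ler_wpM2l// lerDl.
Qed.

(** The equation [y = src x + J x y] for families [y] indexed by times and components,
    with a parameter [x] on which [src] and [J] depend linearly. The estimates hold for
    both parts [nu true] and [nu false] of the norm, with the seminorm [q] of the parameter
    as only small quantity. *)
Section volterra.
Context {R : realType} {X : completeNormedModType R} {I : Type}.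
Variables (nu : bool -> X -> R) (q : X -> R) (Cq : R) (kappa : bool -> R).
Variables (traj : set (I -> X)) (J : X -> (I -> X) -> I -> X) (src : X -> I -> X).
Hypothesis nuD : forall b x y, nu b (x + y) <= nu b x + nu b y.
Hypothesis nuZ : forall b a x, nu b (a *: x) = `|a| * nu b x.
Hypothesis nu_le : forall b x, nu b x <= `|x|.
Hypothesis norm_le : forall x, `|x| <= nu true x + nu false x.
Hypothesis qD : forall x y, q (x + y) <= q x + q y.
Hypothesis qZ : forall a x, q (a *: x) = `|a| * q x.
Hypothesis qC : forall x, q x <= Cq * `|x|.
Hypothesis kappa0 : forall b, 0 <= kappa b.
Hypothesis trajP : forall a y z, traj y -> traj z -> traj (a *: y + z).
Hypothesis traj_bounded : forall y, traj y -> exists B, forall i, `|y i| <= B.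
Hypothesis traj_lim : forall (u : nat -> I -> X) y, (forall n, traj (u n)) ->
  (forall e, 0 < e -> \forall n \near \oo, forall i, `|u n i - y i| <= e) -> traj y.
Hypothesis J_traj : forall x y, traj y -> traj (J x y).
Hypothesis J_linr : forall x a y z, traj y -> traj z ->
  J x (a *: y + z) = a *: J x y + J x z.
Hypothesis J_linl : forall a x x' y, traj y ->
  J (a *: x + x') y = a *: J x y + J x' y.
Hypothesis J_bound : forall b x y M, traj y -> (forall i, nu b (y i) <= M) ->
  forall i, nu b (J x y i) <= q x * M.
Hypothesis src_traj : forall x, traj (src x).
Hypothesis src_lin : forall a x x', src (a *: x + x') = a *: src x + src x'.
Hypothesis src_bound : forall b x i, nu b (src x i) <= kappa b * q x.

Let nu1 b x : nu b x <= 1 * `|x|. Proof. by rewrite mul1r. Qed.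

Let trajD y z : traj y -> traj z -> traj (y + z).
Proof. by move=> ty tz; rewrite -[y]scale1r; exact: trajP. Qed.

Let trajB y z : traj y -> traj z -> traj (y - z).
Proof. by move=> ty tz; rewrite addrC -scaleN1r; exact: trajP. Qed.

Let J_B x y z : traj y -> traj z -> J x (y - z) = J x y - J x z.
Proof.
by move=> ty tz; rewrite addrC -scaleN1r J_linr// scaleN1r addrC.
Qed.

Let J_Bl x x' y : traj y -> J (x - x') y = J x y - J x' y.
Proof.
by move=> ty; rewrite addrC -scaleN1r J_linl// scaleN1r addrC.
Qed.

Let src_B x x' : src (x - x') = src x - src x'.
Proof. by rewrite addrC -scaleN1r src_lin scaleN1r addrC. Qed.

Let nu_eq0 x : (forall b, nu b x <= 0) -> x = 0.
Proof.
move=> x0; apply/eqP; rewrite -normr_le0 (le_trans (norm_le x))//.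
by rewrite -(addr0 0) lerD.
Qed.

(** One application of the equation improves a bound [B] to [M + B / 6]; the fixed
    point of this improvement is [6 / 5 * M]. *)
Lemma volterra_bound b x s y M : q x <= 1 / 6 -> traj y -> y = s + J x y ->
  (forall i, nu b (s i) <= M) -> forall i, nu b (y i) <= 6 / 5 * M.
Proof.
move=> qx ty yE sM.
have [B yB] := traj_bounded ty.
have H n i : nu b (y i) <= 6 / 5 * M + B * (1 / 6) ^+ n.
  elim: n i => [|n IH] i.
    rewrite expr0 mulr1 -[leLHS]add0r lerD//; last exact: le_trans (nu_le _ _) (yB i).
    have := le_trans (seminorm_ge0 (nuD b) (nuZ b) _) (sM i); lra.
  have Jn := J_bound x ty IH i.
  have := le_trans (nuD b (s i) (J x y i)) (lerD (sM i) Jn).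
  rewrite -[s i + _]/((s + J x y) i) -yE => /le_trans; apply.
  set t := 6 / 5 * M + _ in IH *.
  have t0 : 0 <= t by apply: le_trans (IH i); exact: seminorm_ge0 (nuD b) (nuZ b) _.
  have : q x * t <= 1 / 6 * t by rewrite ler_wpM2r.
  rewrite exprS /t; lra.
move=> i; have L : 6 / 5 * M + B * (1 / 6) ^+ n @[n --> \oo] --> (6 / 5 * M + B * 0 : R).
  apply: cvgD; first exact: cvg_cst.
  apply: cvgMr; apply: cvg_expr; rewrite ger0_norm; lra.
rewrite mulr0 addr0 in L; rewrite -(cvg_lim _ L)//; apply: limr_ge.
  by apply/cvg_ex; eexists; exact: L.
by apply: nearW => n; exact: H.
Qed.

Lemma volterra_uniq x s y z : q x <= 1 / 6 -> traj y -> traj z ->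
  y = s + J x y -> z = s + J x z -> y = z.
Proof.
move=> qx ty tz yE zE; apply/funext => i; apply/eqP; rewrite -subr_eq0; apply/eqP.
apply: nu_eq0 => b.
have := @volterra_bound b x 0 (y - z) 0 qx (trajB ty tz) _ _ i.
rewrite mulr0; apply.
  by rewrite J_B// add0r {1}yE {1}zE opprD addrACA subrr add0r.
by move=> k; rewrite /= (seminorm0 (nuZ b)).
Qed.

(** Neumann series, converging uniformly in the index. *)
Lemma volterra_solve x s : q x <= 1 / 6 -> traj s ->
  exists2 y, traj y & y = s + J x y.
Proof.
move=> qx ts; pose u := fix u n := if n is k.+1 then s + J x (u k) else s.
have tu n : traj (u n) by elim: n => //= n IH; apply: trajD => //; exact: J_traj.
have [B1 sB1] := traj_bounded ts.
have [B2 JB2] := traj_bounded (J_traj x ts).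
have du b n i : nu b (u n.+1 i - u n i) <= B2 * (1 / 6) ^+ n.
  elim: n i => [|n IH] i.
    rewrite expr0 mulr1 (_ : u 1%N i - u 0%N i = J x s i).
      by rewrite (le_trans (nu_le _ _)).
    by rewrite /= !fctE addrAC subrr add0r.
  have := J_bound x (trajB (tu n.+1) (tu n)) IH i.
  rewrite J_B// (_ : (J x (u n.+1) - J x (u n)) i = u n.+2 i - u n.+1 i).
    move=> /le_trans; apply; rewrite exprS [leRHS]mulrCA ler_wpM2r//.
    by apply: le_trans (IH i); exact: seminorm_ge0 (nuD b) (nuZ b) _.
  by rewrite /= !fctE opprD addrACA subrr add0r.
have du' n i : `|u n.+1 i - u n i| <= 2 * B2 * (1 / 6) ^+ n.
  by rewrite (le_trans (norm_le _))// -mulrA (mulrDl 1 1) mul1r lerD.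
have c01 : 0 <= (1 / 6 : R) < 1 by lra.
have /choice[y yP] i := geometric_cvg c01 (fun n => du' n i).
have yu n i : `|y i - u n i| <= 12 / 5 * B2 * (1 / 6) ^+ n.
  by have := (yP i).2 n; rewrite (_ : 2 * B2 / (1 - 1 / 6) = 12 / 5 * B2)//; field.
have u0 : 12 / 5 * B2 * (1 / 6) ^+ n @[n --> \oo] --> (0 : R).
  rewrite -[X in _ --> X](mulr0 (12 / 5 * B2)); apply: cvgMr.
  by apply: cvg_expr; rewrite ger0_norm; lra.
have unif e : 0 < e -> \forall n \near \oo, forall i, `|u n i - y i| <= e.
  move=> e0; have /cvgrPdist_le/(_ _ e0) := u0.
  apply: filterS => n; rewrite sub0r normrN => /(le_trans (ler_norm _)) ne i.
  by rewrite distrC (le_trans (yu n i)).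
have ty : traj y by exact: traj_lim unif.
exists y => //; apply/funext => i; apply/eqP; rewrite -subr_eq0 -normr_le0.
apply/ler_addgt0Pr => e e0; rewrite add0r.
have e2 : 0 < e / 3 by rewrite divr_gt0.
have [N _ HN] := unif _ e2.
have H1 := HN N (leqnn _); have H2 := HN N.+1 (leqnSn _).
have -> : y i - (s + J x y) i = (y i - u N.+1 i) + J x (u N - y) i.
  by rewrite J_B// !fctE /= !opprD [y i + (- _ + _)]addrA [X in _ = X + _]addrA subrKA.
rewrite (le_trans (ler_normD _ _))// (_ : e = e / 3 + (e / 3 + e / 3)); last by field.
have Jb b : nu b (J x (u N - y) i) <= e / 3.
  have := @J_bound b x (u N - y) (e / 3) (trajB (tu N) ty) _ i.
  move=> /(_ _)/le_trans; apply.
    by move=> k; rewrite (le_trans (nu_le _ _))//; exact: H1.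
  by rewrite ler_piMl//; [exact: ltW|apply: (le_trans qx); lra].
apply: lerD; first by rewrite distrC; exact: H2.
by apply: le_trans (norm_le _) _; apply: lerD; exact: Jb.
Qed.

Definition volterra x s : I -> X := get [set y | traj y /\ y = s + J x y].

Lemma volterraP x s : q x <= 1 / 6 -> traj s ->
  traj (volterra x s) /\ volterra x s = s + J x (volterra x s).
Proof.
move=> qx ts; apply: (@getPex _ [set y | traj y /\ y = s + J x y]).
by have [y ty yE] := volterra_solve qx ts; exists y.
Qed.

Let eta x := volterra x (src x).
Let zeta x v := volterra x (src v + J v (eta x)).

Let etaP x : q x <= 1 / 6 -> traj (eta x) /\ eta x = src x + J x (eta x).
Proof. by move=> qx; exact: volterraP. Qed.

Let zetaP x v : q x <= 1 / 6 ->
  traj (zeta x v) /\ zeta x v = src v + J v (eta x) + J x (zeta x v).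
Proof.
move=> qx; apply: volterraP => //; apply: trajD => //; apply: J_traj.
by have [] := etaP qx.
Qed.

Let q0 x : 0 <= q x. Proof. exact: seminorm_ge0 qD qZ x. Qed.

Let kq b x : 0 <= kappa b * q x. Proof. exact: mulr_ge0. Qed.

Let eta_bound b x i : q x <= 1 / 6 -> nu b (eta x i) <= kappa b / 5.
Proof.
move=> qx; have [te etaE] := etaP qx.
have := volterra_bound qx te etaE (fun i => src_bound b x i) i.
have : kappa b * q x <= kappa b * (1 / 6) by rewrite ler_wpM2l.
lra.
Qed.

Let eta_diffE x x' : q x <= 1 / 6 -> q x' <= 1 / 6 ->
  eta x - eta x' = src (x - x') + J (x - x') (eta x) + J x' (eta x - eta x').
Proof.
move=> qx qx'; have [tx Ex] := etaP qx; have [tx' Ex'] := etaP qx'.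
rewrite {1}Ex {1}Ex' src_B J_Bl// J_B//.
by rewrite opprD addrACA -[in RHS]addrA subrKA.
Qed.

Let eta_diff_bound b x x' i : q x <= 1 / 6 -> q x' <= 1 / 6 ->
  nu b ((eta x - eta x') i) <= 36 / 25 * (kappa b * q (x - x')).
Proof.
move=> qx qx'; have [tx _] := etaP qx; have [tx' _] := etaP qx'.
have s_bound k : nu b ((src (x - x') + J (x - x') (eta x)) k) <=
    6 / 5 * (kappa b * q (x - x')).
  rewrite (le_trans (nuD _ _ _))//.
  have := src_bound b (x - x') k.
  have := J_bound (x - x') tx (fun i => eta_bound b i qx) k.
  lra.
have := volterra_bound qx' (trajB tx tx') (eta_diffE qx qx') s_bound i; lra.
Qed.

Let zeta_bound b x v i : q x <= 1 / 6 ->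
  nu b (zeta x v i) <= 36 / 25 * (kappa b * q v).
Proof.
move=> qx; have [tx _] := etaP qx; have [tz Ez] := zetaP v qx.
have s_bound k : nu b ((src v + J v (eta x)) k) <= 6 / 5 * (kappa b * q v).
  rewrite (le_trans (nuD _ _ _))//.
  have := src_bound b v k.
  have := J_bound v tx (fun i => eta_bound b i qx) k.
  lra.
have := volterra_bound qx tz Ez s_bound i; lra.
Qed.

Let taylor_bound b x v i : q x <= 1 / 6 -> q (v + x) <= 1 / 6 ->
  nu b ((eta (v + x) - eta x - zeta x v) i) <= 2 * (kappa b * q v) * q v.
Proof.
move=> qx qvx; have [tx _] := etaP qx; have [tx' _] := etaP qvx.
have [tz Ez] := zetaP v qx.
have td := trajB tx' tx.
have dE := eta_diffE qvx qx; rewrite addrK in dE.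
have Jvd : J v (eta (v + x) - eta x) = J v (eta (v + x)) - J v (eta x) by exact: J_B.
set d := eta (v + x) - eta x in td dE Jvd *.
have E : d - zeta x v = J v d + J x (d - zeta x v).
  rewrite Jvd (J_B x td tz) {1}dE {1}Ez opprD addrACA; congr (_ + _).
  by rewrite opprD addrACA subrr add0r.
have := volterra_bound qx (trajB td tz) E
  (J_bound v td (fun k => eta_diff_bound b k qvx qx)) i.
rewrite addrK => /le_trans; apply.
have := mulr_ge0 (kq b v) (q0 v); lra.
Qed.

Let zeta_diff_bound b x x' v i : q x <= 1 / 6 -> q x' <= 1 / 6 ->
  nu b ((zeta x v - zeta x' v) i) <= 4 * (kappa b * q (x - x')) * q v.
Proof.
move=> qx qx'; have [tx _] := etaP qx; have [tx' _] := etaP qx'.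
have [tz Ez] := zetaP v qx; have [tz' Ez'] := zetaP v qx'.
have E : zeta x v - zeta x' v = J v (eta x - eta x') + J (x - x') (zeta x v)
    + J x' (zeta x v - zeta x' v).
  rewrite {1}Ez {1}Ez' J_B// J_Bl// J_B//.
  rewrite -[in RHS]addrA subrKA opprD addrACA; congr (_ + _).
  by rewrite opprD addrACA subrr add0r.
have s_bound k : nu b ((J v (eta x - eta x') + J (x - x') (zeta x v)) k) <=
    72 / 25 * (kappa b * q (x - x') * q v).
  rewrite (le_trans (nuD _ _ _))//.
  have := J_bound v (trajB tx tx') (fun k => eta_diff_bound b k qx qx') k.
  have := J_bound (x - x') tz (fun k => zeta_bound b v k qx) k.
  lra.
have := volterra_bound qx' (trajB tz tz') E s_bound i.
have := mulr_ge0 (kq b (x - x')) (q0 v); lra.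
Qed.

Definition volterra_rest (i0 : I) x := volterra x (src x) i0 - src x i0.

Let restE i0 x : q x <= 1 / 6 -> volterra_rest i0 x = J x (eta x) i0.
Proof.
move=> qx; have [_ E] := etaP qx; rewrite /volterra_rest -/(eta x) {1}E.
by rewrite fctE addrAC subrr add0r.
Qed.

(** The rest is [J x] applied to the solution, hence of second order. The constants
    are those of [q x <= 1 / 6]: the solution is bounded by [kappa / 5] and has Lipschitz
    constant [36 / 25], and [1 / 5 + 36 / 25 / 6 = 11 / 25]. *)
Lemma volterra_rest_lipschitz i0 b x x' : q x <= 1 / 6 -> q x' <= 1 / 6 ->
  nu b (volterra_rest i0 x - volterra_rest i0 x') <= 11 / 25 * (kappa b * q (x - x')).
Proof.
move=> qx qx'; have [tx _] := etaP qx; have [tx' _] := etaP qx'.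
rewrite !restE// -[J x _ i0]/((J x (eta x)) i0).
have -> : J x (eta x) i0 - J x' (eta x') i0 =
    J (x - x') (eta x) i0 + J x' (eta x - eta x') i0.
  by rewrite J_Bl// J_B// !fctE subrKA.
rewrite (le_trans (nuD _ _ _))//.
have := J_bound (x - x') tx (fun i => eta_bound b i qx) i0.
have := J_bound x' (trajB tx tx') (fun k => eta_diff_bound b k qx qx') i0.
have : q x' * (36 / 25 * (kappa b * q (x - x'))) <= 1 / 6 * (36 / 25 * (kappa b * q (x - x'))).
  by rewrite ler_wpM2r// mulr_ge0.
lra.
Qed.

(** The differential of the solution in the direction [v] solves the linearised
    equation, of the same kind; the error of first order and the variation of the
    differential solve such equations too, with small sources. *)
Lemma volterra_rest_C1 i0 r : r <= 1 / 6 ->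
  C1_on [set x | q x < r] (volterra_rest i0).
Proof.
move=> r6.
have inr x : q x < r -> q x <= 1 / 6 by move=> /ltW /le_trans; apply.
pose D x v := zeta x v i0 - src v i0.
have zlin x a v w : q x <= 1 / 6 -> zeta x (a *: v + w) = a *: zeta x v + zeta x w.
  move=> qx; have [tx _] := etaP qx.
  have [tv Ev] := zetaP v qx; have [tw Ew] := zetaP w qx; have [tz Ez] := zetaP (a *: v + w) qx.
  apply: (volterra_uniq qx tz (trajP a tv tw) Ez).
  rewrite {1}Ev {1}Ew J_linr// src_lin J_linl// !scalerDr.
  by rewrite (addrACA (a *: src v)) (addrACA (a *: src v + _)).
have oO : open [set x | q x < r].
  have := seminorm_ball_open qD qC 0 r; congr open.
  by apply/seteqP; split => x /=; rewrite subr0.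
pose k := kappa true + kappa false.
have k0 : 0 <= k by rewrite addr_ge0.
pose c := `|Cq| + 1.
have cpos : 0 < c by rewrite ltr_wpDl.
have qc x : q x <= c * `|x| by exact: seminorm_ge_bound qC x.
apply: (@C1_on_differential _ _ _ _ _ D) => //.
- move=> x xO; have qx := inr x xO.
  apply: (@frechet_criterion _ _ _ _ (D x) _ (61 / 25 * (k * c))).
  + move=> a v w; rewrite /D zlin// src_lin !fctE opprD scalerBr addrACA.
    by [].
  + move=> v; rewrite (le_trans (norm_le _))//.
    have nb b : nu b (D x v) <= 61 / 25 * (kappa b * (c * `|v|)).
      rewrite (le_trans (seminormB (nuD b) (nuZ b) _ _))//.
      have := zeta_bound b v i0 qx; have := src_bound b v i0.
      have : kappa b * q v <= kappa b * (c * `|v|) by rewrite ler_wpM2l.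
      lra.
    have := nb true; have := nb false; rewrite /k; lra.
  + move=> e e0.
    have nO : \forall h \near (0 : X), q (h + x) < r.
      have : \forall z \near x, q z < r by exact: open_nbhs_nbhs.
      by rewrite (near_shift 0)/= subr0.
    have Bk : 0 <= 2 * k * c * c by rewrite !mulr_ge0// ltW.
    have := @near0_norm_small _ X _ _ Bk e0.
    apply: filterS2 nO => h /inr qhx he.
    have -> : volterra_rest i0 (h + x) - volterra_rest i0 x - D x h =
        (eta (h + x) - eta x - zeta x h) i0.
      rewrite /volterra_rest -/(eta _) -/(eta x) /D.
      have -> : src (h + x) = src h + src x.
        by have := src_lin 1 h x; rewrite !scale1r.
      rewrite !fctE opprD !opprB !addrA subrK; congr (_ - _).
      by rewrite addrAC subrK.
    rewrite (le_trans (norm_le _))//.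
    have := taylor_bound true i0 qx qhx; have := taylor_bound false i0 qx qhx.
    have : q h * q h <= (c * `|h|) * (c * `|h|) by exact: ler_pM.
    move=> qh.
    have : k * (q h * q h) <= k * (c * `|h| * (c * `|h|)) by exact: ler_wpM2l.
    have : 2 * k * c * c * `|h| * `|h| <= e * `|h| by exact: ler_wpM2r.
    rewrite /k; lra.
- move=> x qxr e e0; have qx := inr x qxr.
  have : \forall y \near x, 4 * k * c * c * `|y - x| <= e.
    rewrite (near_shift 0)/=; have Bk : 0 <= 4 * k * c * c by rewrite !mulr_ge0// ltW.
    have := @near0_norm_small _ X _ _ Bk e0.
    by apply: filterS => h; rewrite /= subr0 addrK.
  apply: filterS => y ye /inr qy v.
  have -> : D y v - D x v = (zeta y v - zeta x v) i0.
    by rewrite /D opprB addrA subrK.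
  rewrite (le_trans (norm_le _))//.
  have := zeta_diff_bound true v i0 qy qx; have := zeta_diff_bound false v i0 qy qx.
  have : q (y - x) * q v <= (c * `|y - x|) * (c * `|v|) by exact: ler_pM.
  move=> qh.
  have : k * (q (y - x) * q v) <= k * (c * `|y - x| * (c * `|v|)) by exact: ler_wpM2l.
  have : 4 * k * c * c * `|y - x| * `|v| <= e * `|v| by exact: ler_wpM2r.
  rewrite /k; lra.
Qed.

End volterra.

(** * Complex-valued functions: integrals and the space of square-integrable functions *)

Section complex_plane.
Context {R : realType}.
Local Notation C := (Rcomplex R).
Implicit Types z w : C.

(** The real inner product of the plane. *)
Definition rip z w : R := complex.Re z * complex.Re w + complex.Im z * complex.Im w.

Lemma rip_sqr z : rip z z = `|z| ^+ 2.
Proof.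
by rewrite Rcomplex_normE sqr_sqrtr ?addr_ge0 ?sqr_ge0// /rip !expr2.
Qed.

Lemma rip_le z w : `|rip z w| <= `|z| * `|w|.
Proof.
rewrite -(@ler_pXn2r _ 2) ?nnegrE ?mulr_ge0// real_normK ?num_real// exprMn.
rewrite -!rip_sqr /rip -subr_ge0.
rewrite (_ : _ - _ = (complex.Re z * complex.Im w - complex.Im z * complex.Re w) ^+ 2).
  exact: sqr_ge0.
ring.
Qed.

Lemma ripC z w : rip z w = rip w z. Proof. by rewrite /rip; ring. Qed.

Lemma ripDl z z' w : rip (z + z') w = rip z w + rip z' w.
Proof. rewrite /rip ReD ImD; ring. Qed.

Lemma ripBl z z' w : rip (z - z') w = rip z w - rip z' w.
Proof. rewrite /rip ReB ImB; ring. Qed.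

Lemma ripZl (a : R) z w : rip (a *: z) w = a * rip z w.
Proof. rewrite /rip ReZ ImZ; ring. Qed.

(** The product of complex numbers, kept inside the real normed plane. *)
Definition cmul z w : C :=
  Complex (complex.Re z * complex.Re w - complex.Im z * complex.Im w)
          (complex.Re z * complex.Im w + complex.Im z * complex.Re w).

Lemma cmulE z w : z * w = cmul z w :> C.
Proof. by case: z w => [? ?] [? ?]. Qed.

Lemma complex_ext z w : complex.Re z = complex.Re w -> complex.Im z = complex.Im w -> z = w.
Proof. by case: z w => [? ?] [? ?] /= -> ->. Qed.

Lemma cmul_norm z w : `|cmul z w| = `|z| * `|w|.
Proof.
rewrite !Rcomplex_normE /= -sqrtrM ?addr_ge0 ?sqr_ge0//; congr Num.sqrt; ring.
Qed.

Lemma cmulC z w : cmul z w = cmul w z.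
Proof. apply: complex_ext => /=; ring. Qed.

Lemma cmulA z w v : cmul z (cmul w v) = cmul (cmul z w) v.
Proof. apply: complex_ext => /=; ring. Qed.

Lemma cmulDl z z' w : cmul (z + z') w = cmul z w + cmul z' w.
Proof. apply: complex_ext; rewrite ?ReD ?ImD /= ?ReD ?ImD; ring. Qed.

Lemma cmulDr z w w' : cmul z (w + w') = cmul z w + cmul z w'.
Proof. by rewrite cmulC cmulDl !(cmulC z). Qed.

Lemma cmulZl (a : R) z w : cmul (a *: z) w = a *: cmul z w.
Proof. apply: complex_ext; rewrite ?ReZ ?ImZ /= ?ReZ ?ImZ; ring. Qed.

Lemma cmulZr (a : R) z w : cmul z (a *: w) = a *: cmul z w.
Proof. by rewrite cmulC cmulZl cmulC. Qed.

Lemma norm_expi (x : R) : `|expi x| = 1.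
Proof. by rewrite Rcomplex_normE /= cos2Dsin2 sqrtr1. Qed.

Lemma expiD (x y : R) : expi (x + y) = cmul (expi x) (expi y).
Proof. by apply: complex_ext; rewrite /= ?cosD ?sinD// addrC. Qed.

Lemma expi0 : expi 0 = Complex 1 0 :> C.
Proof. by apply: complex_ext; rewrite /= ?cos0 ?sin0. Qed.

Lemma cmul1 z : cmul (Complex 1 0) z = z.
Proof. apply: complex_ext => /=; ring. Qed.

End complex_plane.

Section integrable_functions.
Context {R : realType}.
Local Notation C := (Rcomplex R).
Local Notation mu := (@lebesgue_measure R).

Definition intR (f : R -> R) := mu.-integrable setT (EFin \o f).

Definition measC (f : R -> C) := measurable_fun setT (fun x => complex.Re (f x)) /\
  measurable_fun setT (fun x => complex.Im (f x)).

Definition intC (f : R -> C) := intR (fun x => complex.Re (f x)) /\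
  intR (fun x => complex.Im (f x)).

Definition Cint (f : R -> C) : C := Cintegral setT f.

Lemma intR_meas f : intR f -> measurable_fun setT f.
Proof. by move=> /integrableP[/measurable_EFinP]. Qed.

Lemma intR_le (f g : R -> R) : measurable_fun setT f -> (forall x, `|f x| <= g x) ->
  intR g -> intR f.
Proof.
move=> mf fg ig; apply: (le_integrable measurableT _ _ ig).
  exact/measurable_EFinP.
by move=> x _; rewrite /= lee_fin (le_trans (fg x))// ler_norm.
Qed.

Lemma intR_norm f : intR f -> intR (fun x => `|f x|).
Proof. exact: integrable_norm. Qed.

Lemma intRD f g : intR f -> intR g -> intR (fun x => f x + g x).
Proof. by move=> iF ig; have := integrableD measurableT iF ig. Qed.

Lemma intRZ a f : intR f -> intR (fun x => a * f x).
Proof. by move=> iF; have := integrableZl measurableT a iF. Qed.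

Lemma intRB f g : intR f -> intR g -> intR (fun x => f x - g x).
Proof.
move=> iF ig; have := intRD iF (intRZ (-1) ig).
by apply: eq_integrable => // x _ /=; rewrite mulN1r.
Qed.

Lemma RintD f g : intR f -> intR g ->
  (\int[mu]_x (f x + g x) = \int[mu]_x f x + \int[mu]_x g x)%R.
Proof. by move=> iF ig; exact: RintegralD. Qed.

Lemma RintZ a f : intR f -> (\int[mu]_x (a * f x) = a * \int[mu]_x f x)%R.
Proof. by move=> iF; exact: RintegralZl. Qed.

Lemma RintB f g : intR f -> intR g ->
  (\int[mu]_x (f x - g x) = \int[mu]_x f x - \int[mu]_x g x)%R.
Proof. by move=> iF ig; exact: RintegralB. Qed.

Lemma le_Rint f g : intR f -> intR g -> (forall x, f x <= g x) ->
  (\int[mu]_x f x <= \int[mu]_x g x)%R.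
Proof. by move=> iF ig fg; exact: le_Rintegral. Qed.

Lemma Rint_ge0 (f : R -> R) : (forall x, 0 <= f x) -> (0 <= \int[mu]_x f x)%R.
Proof. by move=> f0; apply: Rintegral_ge0. Qed.

Lemma normr_Rint f : intR f -> (`|\int[mu]_x f x| <= \int[mu]_x `|f x|)%R.
Proof. exact: le_normr_Rintegral. Qed.

Lemma eq_Rint (f g : R -> R) : f =1 g -> (\int[mu]_x f x = \int[mu]_x g x)%R.
Proof. by move=> fg; apply: eq_Rintegral => x _; rewrite fg. Qed.

Lemma measC_norm f : measC f -> measurable_fun setT (fun x => `|f x|).
Proof. by move=> [mr mi]; exact: measurable_Rcomplex_norm. Qed.

Lemma intC_meas f : intC f -> measC f.
Proof. by move=> [/intR_meas ? /intR_meas]. Qed.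

Lemma intCP f : measC f -> intR (fun x => `|f x|) -> intC f.
Proof.
move=> [mr mi] iN; split; apply: (intR_le _ _ iN) => // x.
  exact: Re_le_norm.
exact: Im_le_norm.
Qed.

Lemma intC_norm f : intC f -> intR (fun x => `|f x|).
Proof.
move=> iF; have [iR iI] := iF.
apply: (intR_le (measC_norm (intC_meas iF)) _ (intRD (intR_norm iR) (intR_norm iI))).
by move=> x; rewrite normr_id norm_le_ReIm.
Qed.

Lemma intC_le f g : measC f -> (forall x, `|f x| <= g x) -> intR g -> intC f.
Proof.
move=> mf fg ig; apply: intCP => //; apply: (intR_le _ _ ig); first exact: measC_norm.
by move=> x; rewrite normr_id.
Qed.

Lemma intCD f g : intC f -> intC g -> intC (fun x => f x + g x).
Proof.
move=> [fr fi] [gr gi]; split.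
  by under eq_fun do rewrite ReD; exact: intRD.
by under eq_fun do rewrite ImD; exact: intRD.
Qed.

Lemma intCZ (a : R) f : intC f -> intC (fun x => a *: f x).
Proof.
move=> [fr fi]; split.
  by under eq_fun do rewrite ReZ; exact: intRZ.
by under eq_fun do rewrite ImZ; exact: intRZ.
Qed.

Lemma CintD f g : intC f -> intC g -> Cint (fun x => f x + g x) = Cint f + Cint g.
Proof.
move=> [fr fi] [gr gi]; apply: complex_ext; rewrite ?ReD ?ImD/=.
  by under [LHS]eq_Rint do rewrite ReD; exact: RintD.
by under [LHS]eq_Rint do rewrite ImD; exact: RintD.
Qed.

Lemma CintZ (a : R) f : intC f -> Cint (fun x => a *: f x) = a *: Cint f.
Proof.
move=> [fr fi]; apply: complex_ext; rewrite ?ReZ ?ImZ/=.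
  by under [LHS]eq_Rint do rewrite ReZ; exact: RintZ.
by under [LHS]eq_Rint do rewrite ImZ; exact: RintZ.
Qed.

Lemma rip_Cint f z : intC f -> rip (Cint f) z = (\int[mu]_x rip (f x) z)%R.
Proof.
move=> [fr fi]; rewrite /rip /Cint /=.
rewrite mulrC -RintZ// [X in _ + X]mulrC -RintZ// -RintD; [|exact: intRZ|exact: intRZ].
by apply: eq_Rint => x; rewrite mulrC; congr (_ + _); rewrite mulrC.
Qed.

Lemma intR_rip f z : intC f -> intR (fun x => rip (f x) z).
Proof.
move=> [fr fi]; rewrite /rip; apply: intRD.
  by under eq_fun do rewrite mulrC; exact: intRZ.
by under eq_fun do rewrite mulrC; exact: intRZ.
Qed.

Lemma norm_Cint f : intC f -> `|Cint f| <= (\int[mu]_x `|f x|)%R.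
Proof.
move=> iF; have [->|z0] := eqVneq (Cint f) 0; first by rewrite normr0 Rint_ge0.
have z1 : 0 < `|Cint f| by rewrite normr_gt0.
rewrite -(ler_pM2l z1) -RintZ; last exact: intC_norm.
rewrite -expr2 -rip_sqr rip_Cint//; apply: le_Rint; first exact: intR_rip.
  by apply: intRZ; exact: intC_norm.
by move=> x; rewrite (le_trans (ler_norm _))// mulrC; exact: rip_le.
Qed.

Lemma CintM (a : C) f : intC f -> Cint (fun x => cmul a (f x)) = cmul a (Cint f).
Proof.
move=> [fr fi]; apply: complex_ext => /=.
  by rewrite RintB ?RintZ//; exact: intRZ.
by rewrite RintD ?RintZ//; exact: intRZ.
Qed.

Lemma eq_Cint f g : f =1 g -> Cint f = Cint g.
Proof. by move=> fg; congr Cint; apply/funext. Qed.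

Lemma measCD f g : measC f -> measC g -> measC (fun x => f x + g x).
Proof.
move=> [fr fi] [gr gi]; split.
  by under eq_fun do rewrite ReD; exact: measurable_funD.
by under eq_fun do rewrite ImD; exact: measurable_funD.
Qed.

Lemma measCM f g : measC f -> measC g -> measC (fun x => cmul (f x) (g x)).
Proof.
move=> [fr fi] [gr gi]; split.
  by apply: measurable_funB; exact: measurable_funM.
by apply: measurable_funD; exact: measurable_funM.
Qed.

Lemma measCZ (h : R -> R) f : measurable_fun setT h -> measC f -> measC (fun x => h x *: f x).
Proof.
move=> mh [fr fi]; split.
  by under eq_fun do rewrite ReZ; exact: measurable_funM.
by under eq_fun do rewrite ImZ; exact: measurable_funM.
Qed.

Lemma continuous_measC f : continuous f -> measC f.
Proof. exact: continuous_L2_measurable. Qed.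

Lemma rip_meas f g : measC f -> measC g -> measurable_fun setT (fun x => rip (f x) (g x)).
Proof. by move=> [fr fi] [gr gi]; apply: measurable_funD; exact: measurable_funM. Qed.

End integrable_functions.

Section L2_inner_product.
Context {R : realType}.
Local Notation C := (Rcomplex R).
Local Notation mu := (@lebesgue_measure R).
Implicit Types f g : R -> C.

Definition n2 f : R := fine (L2norm setT f).

Definition ip f g : R := (\int[mu]_x rip (f x) (g x))%R.

Lemma L2_sqr_int f : L2 setT f <-> measC f /\ intR (fun x => `|f x| ^+ 2).
Proof.
split=> [[mr mi nf]|[[mr mi] iF]].
  split=> //; apply/integrableP; split.
    by apply/measurable_EFinP/measurable_funX; exact: measurable_Rcomplex_norm.
  under eq_integral => x _ do rewrite /= ger0_norm ?sqr_ge0//.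
  exact: lty_poweRy nf.
split=> //; move: iF => /integrableP[_]; rewrite /L2norm.
under eq_integral => x _ do rewrite /= ger0_norm ?sqr_ge0//.
exact: poweR_lty.
Qed.

Lemma L2_meas f : L2 setT f -> measC f.
Proof. by move=> /L2_sqr_int[]. Qed.

Lemma n2_ge0 f : 0 <= n2 f.
Proof. by rewrite fine_ge0// L2norm_ge0. Qed.

Lemma n2_sqr f : L2 setT f -> n2 f ^+ 2 = (\int[mu]_x `|f x| ^+ 2)%R.
Proof.
move=> /L2_sqr_int[_ iF]; rewrite /n2 /L2norm /Rintegral.
have : (\int[mu]_x (`|f x| ^+ 2)%:E)%E \is a fin_num by exact: integrable_fin_num.
have : (0 <= \int[mu]_x (`|f x| ^+ 2)%:E)%E by rewrite integral_ge0.
case: (integral _ _ _) => //= r; rewrite lee_fin => r0 _.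
by rewrite powR12_sqrt// sqr_sqrtr.
Qed.

Lemma ip_sqr f : L2 setT f -> ip f f = n2 f ^+ 2.
Proof. by move=> Lf; rewrite n2_sqr// /ip; apply: eq_Rint => x; rewrite rip_sqr. Qed.

Lemma normM_int f g : L2 setT f -> L2 setT g -> intR (fun x => `|f x| * `|g x|).
Proof.
move=> /L2_sqr_int[mf iF] /L2_sqr_int[mg ig].
apply: (intR_le _ _ (intRD iF ig)).
  by apply: measurable_funM; exact: measC_norm.
move=> x; rewrite ger0_norm ?mulr_ge0//.
have := sqr_ge0 (`|f x| - `|g x|); have := mulr_ge0 (normr_ge0 (f x)) (normr_ge0 (g x)).
nra.
Qed.

Lemma rip_int f g : L2 setT f -> L2 setT g -> intR (fun x => rip (f x) (g x)).
Proof.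
move=> Lf Lg; apply: (intR_le _ _ (normM_int Lf Lg)); last by move=> x; exact: rip_le.
by apply: rip_meas; exact: L2_meas.
Qed.

Lemma ipC f g : ip f g = ip g f.
Proof. by apply: eq_Rint => x; exact: ripC. Qed.

Lemma ipDl f f' g : L2 setT f -> L2 setT f' -> L2 setT g ->
  ip (f + f') g = ip f g + ip f' g.
Proof.
move=> Lf Lf' Lg; rewrite /ip -RintD; [|exact: rip_int|exact: rip_int].
by apply: eq_Rint => x; exact: ripDl.
Qed.

Lemma ipZl a f g : L2 setT f -> L2 setT g -> ip (a *: f) g = a * ip f g.
Proof.
move=> Lf Lg; rewrite /ip -RintZ; last exact: rip_int.
by apply: eq_Rint => x; exact: ripZl.
Qed.

Lemma L2N f : L2 setT f -> L2 setT (- f).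
Proof. by rewrite -scaleN1r; exact: L2Z. Qed.

Lemma L2B f g : L2 setT f -> L2 setT g -> L2 setT (f - g).
Proof. by move=> Lf Lg; apply: L2D => //; exact: L2N. Qed.

Lemma ipBl f f' g : L2 setT f -> L2 setT f' -> L2 setT g ->
  ip (f - f') g = ip f g - ip f' g.
Proof.
move=> Lf Lf' Lg; rewrite ipDl//; last exact: L2N.
by rewrite -scaleN1r ipZl// mulN1r.
Qed.

Lemma n2D f g : L2 setT f -> L2 setT g -> n2 (f + g) <= n2 f + n2 g.
Proof.
move=> Lf Lg; rewrite /n2 -fineD ?L2norm_fin_num//.
by rewrite fine_le ?fin_numD ?L2norm_fin_num//; [exact: L2D|exact: L2norm_leD].
Qed.

Lemma n2Z a f : L2 setT f -> n2 (a *: f) = `|a| * n2 f.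
Proof. by move=> Lf; rewrite /n2 L2normZ// fineM ?L2norm_fin_num. Qed.

Lemma n2N f : L2 setT f -> n2 (- f) = n2 f.
Proof. by move=> Lf; rewrite -scaleN1r n2Z// normrN1 mul1r. Qed.

Lemma n2B f g : L2 setT f -> L2 setT g -> n2 (f - g) <= n2 f + n2 g.
Proof. by move=> Lf Lg; rewrite (le_trans (n2D Lf (L2N Lg)))// n2N. Qed.

Lemma ipDr f g g' : L2 setT f -> L2 setT g -> L2 setT g' ->
  ip f (g + g') = ip f g + ip f g'.
Proof. by move=> Lf Lg Lg'; rewrite ipC ipDl// !(ipC f). Qed.

Lemma n2_sqrD f g : L2 setT f -> L2 setT g ->
  n2 (f + g) ^+ 2 = n2 f ^+ 2 + 2 * ip f g + n2 g ^+ 2.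
Proof.
move=> Lf Lg; have Lfg := L2D Lf Lg.
by rewrite -!ip_sqr// ipDl// !ipDr// (ipC g f); ring.
Qed.

(** Polarisation turns the triangle inequality of the norm into this one. *)
Lemma ip_le f g : L2 setT f -> L2 setT g -> `|ip f g| <= n2 f * n2 g.
Proof.
have H f' g' : L2 setT f' -> L2 setT g' -> ip f' g' <= n2 f' * n2 g'.
  move=> Lf Lg; have Lfg := L2D Lf Lg.
  have := n2D Lf Lg; rewrite -(@ler_pXn2r _ 2) ?nnegrE ?addr_ge0 ?n2_ge0//.
  by rewrite n2_sqrD// sqrrD; lra.
move=> Lf Lg; rewrite ler_norml H// andbT lerNl -mulN1r -ipZl//.
by rewrite (le_trans (H _ _ _ _))//; [exact: L2Z|rewrite n2Z// normrN1 mul1r].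
Qed.

Lemma normM_le f g : L2 setT f -> L2 setT g ->
  (\int[mu]_x (`|f x| * `|g x|) <= n2 f * n2 g)%R.
Proof.
have absE (h : R -> C) x : `|(Complex (`|h x|) 0 : C)| = `|h x|.
  by rewrite Rcomplex_normE/= expr0n/= addr0 sqrtr_sqr normr_id.
have H h : L2 setT h -> L2 setT (fun x => Complex (`|h x|) 0 : C) /\
    n2 (fun x => Complex (`|h x|) 0 : C) = n2 h.
  move=> Lh; have [mh ih] := (L2_sqr_int h).1 Lh.
  have E : (fun x => `|(Complex (`|h x|) 0 : C)| ^+ 2) = (fun x => `|h x| ^+ 2).
    by apply/funext => x; rewrite absE.
  split; last by rewrite /n2 /L2norm; under eq_integral => x _ do rewrite absE.
  apply/L2_sqr_int; split; last by rewrite E.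
  by split; [exact: measC_norm|exact: measurable_cst].
move=> /H[Lf <-] /H[Lg <-]; apply: le_trans (ler_norm _) _.
apply: le_trans (ip_le Lf Lg); rewrite le_eqVlt; apply/orP; left; apply/eqP; congr `|_|.
by apply: eq_Rint => x; rewrite /rip /= mulr0 addr0.
Qed.

Lemma n2_le f g : L2 setT g -> measC f -> (forall x, `|f x| <= `|g x|) ->
  L2 setT f /\ n2 f <= n2 g.
Proof.
move=> Lg mf fg; have [mg ig] := (L2_sqr_int g).1 Lg.
have sq x : `|f x| ^+ 2 <= `|g x| ^+ 2 by rewrite ler_pXn2r ?nnegrE.
have Lf : L2 setT f.
  apply/L2_sqr_int; split => //; apply: (intR_le _ _ ig).
    by apply: measurable_funX; exact: measC_norm.
  by move=> x; rewrite ger0_norm ?sqr_ge0.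
split => //; rewrite -(@ler_pXn2r _ 2) ?nnegrE ?n2_ge0// !n2_sqr//.
by apply: le_Rint => //; have [] := (L2_sqr_int f).1 Lf.
Qed.

End L2_inner_product.

Section L2_complete.
Context {R : realType}.
Local Notation C := (Rcomplex R).
Local Notation mu := (@lebesgue_measure R).

Definition indC (A : set R) : R -> C := fun x => Complex (\1_A x) 0.

Lemma indC_norm A x : `|indC A x| = \1_A x.
Proof.
rewrite Rcomplex_normE/= expr0n/= addr0 sqrtr_sqr ger0_norm//.
Qed.

Lemma measC_ind A : measurable A -> measC (indC A).
Proof. by move=> mA; split; [exact: measurable_indic|exact: measurable_cst]. Qed.

Lemma L2_ind_itv (a b : R) : a <= b -> L2 setT (indC `]a, b[) /\
  n2 (indC `]a, b[) ^+ 2 = b - a.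
Proof.
move=> ab.
have E : (fun x => `|indC `]a, b[ x| ^+ 2) = \1_(`]a, b[).
  by apply/funext => x; rewrite indC_norm indicE; case: (x \in _); rewrite ?expr1n ?expr0n.
have L : L2 setT (indC `]a, b[).
  apply/L2_sqr_int; split; first by apply: measC_ind.
  by rewrite E; exact: integrable_indic_itv.
split=> //; rewrite n2_sqr// E /Rintegral integral_indic//= setIT.
by rewrite lebesgue_measure_itv/= lte_fin; case: ltP => //= ba; apply/eqP; rewrite eq_sym subr_eq0 eq_le ba ab.
Qed.

(** Cauchy-Schwarz inequality against the indicator of the interval. *)
Lemma L1_le_L2 (a b : R) (f : R -> C) : a <= b -> L2 setT f ->
  (forall x, ~ `]a, b[%classic x -> f x = 0) ->
  intC f /\ (\int[mu]_x `|f x| <= Num.sqrt (b - a) * n2 f)%R.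
Proof.
move=> ab Lf f0; have [Li ni] := L2_ind_itv ab.
have E : (fun x => `|indC `]a, b[ x| * `|f x|) = (fun x => `|f x|).
  apply/funext => x; rewrite indC_norm indicE; have [xab|xab] := boolP (x \in _).
    by rewrite mul1r.
  by rewrite f0 ?normr0 ?mulr0//; apply/negP; move: xab; rewrite notin_setE => xab; apply/negP.
have iF : intR (fun x => `|f x|) by rewrite -E; exact: normM_int.
split; first by apply: intCP => //; exact: L2_meas.
have := normM_le Li Lf; rewrite (_ : n2 (indC _) = Num.sqrt (b - a)).
  by rewrite (eq_Rint (fun x => congr1 (fun F => F x) E)).
by rewrite -ni sqrtr_sqr ger0_norm ?n2_ge0.
Qed.

Lemma L2norm_ae (f g : R -> C) (Z : set R) : measC f -> measC g ->
  measurable Z -> mu Z = 0%E -> (forall x, ~ Z x -> f x = g x) ->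
  L2norm setT f = L2norm setT g.
Proof.
move=> mf mg mZ Z0 fg; rewrite /L2norm; congr (_ `^ _)%E.
apply: ge0_ae_eq_integral => //.
- by apply/measurable_EFinP/measurable_funX; exact: measC_norm.
- by apply/measurable_EFinP/measurable_funX; exact: measC_norm.
- exists Z; split => // x /= H; apply: contrapT => nZ; apply: H => _.
  by rewrite fg.
Qed.

Lemma n2_ae (f g : R -> C) (Z : set R) : L2 setT f -> measC g ->
  measurable Z -> mu Z = 0%E -> (forall x, ~ Z x -> f x = g x) ->
  L2 setT g /\ n2 f = n2 g.
Proof.
move=> Lf mg mZ Z0 fg; have mf := L2_meas Lf; have [_ _ nf] := Lf.
have E := L2norm_ae mf mg mZ Z0 fg.
by split; [split; [exact: mg.1|exact: mg.2|rewrite -E]|rewrite /n2 E].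
Qed.

(** Fatou's lemma: the norm is lower semicontinuous for pointwise convergence. *)
Lemma n2_fatou (h : (R -> C)^nat) (f : R -> C) (M : R) : 0 <= M ->
  (forall n, L2 setT (h n)) -> (forall x, h ^~ x @ \oo --> f x) ->
  (forall n, n2 (h n) <= M) -> L2 setT f /\ n2 f <= M.
Proof.
move=> M0 Lh hf hM.
have cvgp (p : C -> R) x : (forall z w, `|p z - p w| <= `|z - w|) ->
    p (h n x) @[n --> \oo] --> p (f x).
  move=> p1; apply/cvgrPdist_le => e e0; have /cvgrPdist_le/(_ e e0) := hf x.
  by apply: filterS => n; exact: le_trans.
have mf : measC f.
  split.
    apply: (@measurable_fun_cvg _ _ _ _ (fun n x => complex.Re (h n x))).
      by move=> n; exact: (L2_meas (Lh n)).1.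
    by move=> x _; apply: cvgp => z w; rewrite -ReB; exact: Re_le_norm.
  apply: (@measurable_fun_cvg _ _ _ _ (fun n x => complex.Im (h n x))).
    by move=> n; exact: (L2_meas (Lh n)).2.
  by move=> x _; apply: cvgp => z w; rewrite -ImB; exact: Im_le_norm.
have hM2 n : (\int[mu]_x (`|h n x| ^+ 2)%:E <= (M ^+ 2)%:E)%E.
  have [_ ih] := (L2_sqr_int _).1 (Lh n).
  rewrite -[leLHS]fineK ?lee_fin; last exact: integrable_fin_num ih.
  by rewrite -[leLHS](n2_sqr (Lh n)) ler_pXn2r ?nnegrE ?n2_ge0.
have F : (\int[mu]_x (`|f x| ^+ 2)%:E <= (M ^+ 2)%:E)%E.
  rewrite (_ : (fun x => _) =
    (fun x => limn_einf (fun n => (`|h n x| ^+ 2)%:E))); last first.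
    apply/funext => x; apply/esym.
    apply: (fst (cvg_limn_einf_sup (_ : _ @ \oo --> (`|f x| ^+ 2)%:E))).
    apply: cvg_EFin; first exact: nearW.
    apply: cvgM; apply: cvg_norm; exact: hf.
  apply: le_trans (fatou _ _ _ _) _ => //.
    move=> n; apply/measurable_EFinP/measurable_funX; apply: measC_norm.
    exact: L2_meas.
  rewrite limn_einf_lim; apply: lime_le; first exact: is_cvg_einfs.
  near=> n; apply: le_trans (hM2 n); apply: ereal_inf_lbound.
  by exists n => /=.
have Lf : L2 setT f.
  apply/L2_sqr_int; split => //; apply/integrableP; split.
    by apply/measurable_EFinP/measurable_funX; exact: measC_norm.
  under eq_integral => x _ do rewrite /= ger0_norm ?sqr_ge0//.
  by rewrite (le_lt_trans F)// ltry.
split => //; rewrite -(@ler_pXn2r _ 2) ?nnegrE ?n2_ge0// n2_sqr//.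
have [_ iF] := (L2_sqr_int _).1 Lf.
by rewrite -lee_fin fineK//; exact: integrable_fin_num iF.
Unshelve. all: by end_near. Qed.

Lemma n2_geometric (w : nat -> R -> C) (B c : R) : 0 <= c < 1 ->
  (forall n, L2 setT (w n)) -> (forall n, n2 (w n.+1 - w n) <= B * c ^+ n) ->
  forall n k, n2 (w (n + k)%N - w n) <= B / (1 - c) * c ^+ n.
Proof.
move=> /andP[c0 c1] Lw wB n k.
have B0 : 0 <= B by have := wB 0%N; rewrite expr0 mulr1; apply: le_trans; exact: n2_ge0.
have c1' : 0 < 1 - c by rewrite subr_gt0.
have n20 : n2 (0 : R -> C) = 0.
  by rewrite -(scale0r (w 0%N)) n2Z// normr0 mul0r.
have H : n2 (w (n + k)%N - w n) <= B / (1 - c) * c ^+ n * (1 - c ^+ k).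
  elim: k => [|k IH]; first by rewrite addn0 subrr n20 expr0 subrr mulr0.
  rewrite addnS -(subrKA (w (n + k)%N)) (le_trans (n2D (L2B _ _) (L2B _ _)))//.
  rewrite (le_trans (lerD (wB _) IH))// exprD exprS.
  rewrite le_eqVlt; apply/orP; left; apply/eqP; field.
  by rewrite lt0r_neq0.
rewrite (le_trans H)// ler_piMr//; last by rewrite gerBl exprn_ge0.
by rewrite mulr_ge0 ?exprn_ge0// divr_ge0// ltW.
Qed.

(** Square-integrable functions on a bounded interval are complete: a rapidly
    convergent sequence converges in L1 fast enough for the telescoping series
    to converge almost everywhere. *)
Lemma L2_complete (w : nat -> R -> C) (a b B c : R) : a <= b -> 0 <= c < 1 ->
  (forall n, L2 setT (w n)) ->
  (forall n x, ~ `]a, b[%classic x -> w n x = 0) ->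
  (forall n, n2 (w n.+1 - w n) <= B * c ^+ n) ->
  exists l, [/\ L2 setT l, forall x, ~ `]a, b[%classic x -> l x = 0 &
    forall n, n2 (l - w n) <= B / (1 - c) * c ^+ n].
Proof.
move=> ab c01 Lw w0 wB; have /andP[c0 c1] := c01.
have B0 : 0 <= B by have := wB 0%N; rewrite expr0 mulr1; apply: le_trans; exact: n2_ge0.
pose h n := w n.+1 - w n.
have Lh n : L2 setT (h n) by exact: L2B.
have h0 n x : ~ `]a, b[%classic x -> h n x = 0.
  by move=> nx; rewrite /h !fctE !w0// subrr.
have ih n := (L1_le_L2 ab (Lh n) (h0 n)).1.
have mh n : measurable_fun setT (fun x => (`|h n x|)%:E).
  by apply/measurable_EFinP; apply: measC_norm; exact: L2_meas.
pose G x := (\sum_(0 <= n <oo) (`|h n x|)%:E)%E.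
have mG : measurable_fun setT G.
  by apply: ge0_emeasurable_sum => // n x _ _; rewrite lee_fin.
have G0 x : (0 <= G x)%E by apply: nneseries_ge0 => n _ _; rewrite lee_fin.
pose S := Num.sqrt (b - a) * B.
have S0 : 0 <= S by rewrite mulr_ge0.
have iG : mu.-integrable setT G.
  apply/integrableP; split => //.
  under eq_integral => x _ do rewrite gee0_abs//.
  rewrite /G integral_nneseries//.
  apply: (@le_lt_trans _ _ (\sum_(0 <= n <oo) (S * c ^+ n)%:E)%E).
    apply: lee_nneseries => n _; first by rewrite integral_ge0.
    have [_ inth] := (L1_le_L2 ab (Lh n) (h0 n)).
    rewrite -[leLHS]fineK; last exact: integrable_fin_num (intC_norm (ih n)).
    by rewrite lee_fin (le_trans inth)// /S -mulrA ler_wpM2l//; exact: wB.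
  have cv : series (geometric S c) @ \oo --> S / (1 - c).
    by apply: cvg_geometric_series; rewrite ger0_norm.
  rewrite (_ : (\sum_(0 <= n <oo) _)%E = (S / (1 - c))%:E) ?ltry//.
  apply/cvg_lim => //; under eq_cvg do rewrite sumEFin.
  by apply: cvg_EFin; [exact: nearW|exact: cv].
have [Z [mZ Z0 GZ]] := integrable_ae measurableT iG.
have Gfin x : ~ Z x -> G x \is a fin_num.
  by move=> nZ; apply: contrapT => nG; apply: nZ; apply: GZ => /= /(_ I).
have cw x : ~ Z x -> cvg (w n x @[n --> \oo]).
  move=> nZ; have Gx := Gfin x nZ.
  have cs : cvgn (series (fun n => `|h n x|)).
    apply: nondecreasing_is_cvgn.
      apply/nondecreasing_seqP => n; rewrite /series/= big_nat_recr//= lerDl.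
      by [].
    exists (fine (G x)) => _ [n _ <-].
    rewrite -lee_fin fineK// /series/= -sumEFin.
    by apply: nneseries_lim_ge => k _; rewrite lee_fin.
  have : cvgn (series (fun n => h n x : C)) by exact: normed_cvg.
  have E n : w n x = w 0%N x + series (fun n => h n x : C) n.
    rewrite /series /=; elim: n => [|n IH]; first by rewrite big_geq// addr0.
    by rewrite big_nat_recr//= addrA -IH /h !fctE addrC subrK.
  move=> /cvg_ex[l hl]; apply/cvg_ex; exists (w 0%N x + l).
  rewrite (_ : (fun n => w n x) = (fun n => w 0%N x + series (fun n => h n x : C) n)).
    by apply: cvgD => //; exact: cvg_cst.
  by apply/funext => n; exact: E.
pose w' n (x : R) : C := \1_(~` Z) x *: w n x.
pose l (x : R) : C := lim (w' n x @[n --> \oo]).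
have w'l x : w' n x @[n --> \oo] --> l x.
  have [Zx|Zx] := pselect (Z x).
    have E : (fun n => w' n x) = (fun=> 0).
      apply/funext => n; rewrite /w' indicE memNset ?scale0r//=.
    by rewrite /l E; apply: is_cvg_cst.
  have E : (fun n => w' n x) = (fun n => w n x).
    by apply/funext => n; rewrite /w' indicE mem_set ?scale1r//=.
  by rewrite /l E; exact: cw.
have mw' n : measC (w' n).
  apply: measCZ; last exact: L2_meas.
  by apply: measurable_indic; exact: measurableC.
have key n : L2 setT (l - w n) /\ n2 (l - w n) <= B / (1 - c) * c ^+ n.
  have H k := n2_geometric c01 Lw wB n k.
  have H' k : L2 setT (w' (n + k)%N - w n) /\ n2 (w (n + k)%N - w n) = n2 (w' (n + k)%N - w n).
    apply: (@n2_ae _ _ Z) => //; first exact: L2B.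
      have := measCD (mw' (n + k)%N) (L2_meas (L2N (Lw n))).
      by [].
    by move=> x nZ; rewrite !fctE /w' indicE mem_set//= scale1r.
  apply: (@n2_fatou (fun k => w' (n + k)%N - w n)).
  - by apply: le_trans (H 0%N); exact: n2_ge0.
  - by move=> k; exact: (H' k).1.
  - move=> x; apply: cvgB; last exact: cvg_cst.
    exact: cvg_comp _ _ (@cvg_addnl n) (w'l x).
  - by move=> k; rewrite -(H' k).2.
exists l; split.
- by rewrite -(subrK (w 0%N) l); apply: L2D => //; exact: (key 0%N).1.
- move=> x nx; have E : (fun n => w' n x) = (fun=> 0).
    by apply/funext => n; rewrite /w' w0// scaler0.
  by rewrite /l E; apply: cvg_lim => //; exact: cvg_cst.
- by move=> n; exact: (key n).2.
Qed.

End L2_complete.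

Lemma L2norm_n2 {R : realType} (f : R -> Rcomplex R) :
  L2 setT f -> L2norm setT f = (n2 f)%:E.
Proof. by move=> Lf; rewrite fineK// L2norm_fin_num. Qed.

(** * The Fourier transform of controls *)

Section fourier.
Context {R : realType} (th : R).
Local Notation C := (Rcomplex R).
Local Notation mu := (@lebesgue_measure R).

(** Controls on an interval are represented by functions on the line which vanish
    at every point outside it, so that all integrals run over the line. *)
Definition L2supp (b : R) : set (R -> C) :=
  [set w | L2 setT w /\ forall x, ~ `]0, b[%classic x -> w x = 0].

Definition wave (om tau : R) : C := expi (om * (th - tau)).

Definition wave_transform (w : R -> C) (om : R) : C :=
  Cint (fun tau => cmul (w tau) (wave om tau)).
Local Notation Ft := wave_transform.

Lemma wave_norm om tau : `|wave om tau| = 1. Proof. exact: norm_expi. Qed.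

Lemma cvg_complex {T : Type} {F : set_system T} {FF : Filter F} (f : T -> C) (l : C) :
  complex.Re (f x) @[x --> F] --> complex.Re l ->
  complex.Im (f x) @[x --> F] --> complex.Im l -> f @ F --> l.
Proof.
move=> /cvgrPdist_le H1 /cvgrPdist_le H2; apply/cvgrPdist_le => e e0.
have e2 : 0 < e / 2 by rewrite divr_gt0.
near=> y; rewrite (le_trans (norm_le_ReIm _))// ReB ImB /= [leRHS]splitr lerD//.
  by near: y; exact: H1.
by near: y; exact: H2.
Unshelve. all: by end_near. Qed.

Lemma cvg_expi {T : Type} {F : set_system T} {FF : Filter F} (h : T -> R) (l : R) :
  h @ F --> l -> expi (h x) @[x --> F] --> (expi l : C).
Proof.
move=> hl; apply: cvg_complex.
  exact: cvg_comp hl (@continuous_cos R l).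
exact: cvg_comp hl (@continuous_sin R l).
Qed.

Lemma continuous_wave_tau om : continuous (wave om).
Proof.
move=> x; apply: cvg_expi; apply: cvgMr; apply: cvgB; first exact: cvg_cst.
exact: cvg_id.
Qed.

Lemma continuous_wave tau : continuous (wave ^~ tau).
Proof. by move=> x; apply: cvg_expi; apply: cvgMl; exact: cvg_id. Qed.

Lemma measC_wave_tau om : measC (wave om).
Proof. exact/continuous_measC/continuous_wave_tau. Qed.

Lemma intC_cmul_wave w om : intC w -> intC (fun tau => cmul (w tau) (wave om tau)).
Proof.
move=> iw; apply: (@intC_le _ _ (fun tau => `|w tau|)).
- by apply: measCM; [exact: intC_meas|exact: measC_wave_tau].
- by move=> x; rewrite cmul_norm wave_norm mulr1.
- exact: intC_norm.
Qed.

Lemma Ft_norm w om : intC w -> `|Ft w om| <= (\int[mu]_x `|w x|)%R.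
Proof.
move=> iw; rewrite (le_trans (norm_Cint (intC_cmul_wave om iw)))//.
by rewrite le_eqVlt; apply/orP; left; apply/eqP/eq_Rint => x; rewrite cmul_norm wave_norm mulr1.
Qed.

(** Dominated convergence for integrals depending continuously on a real
    parameter. *)
Lemma continuous_Cint (F : R -> R -> C) (g : R -> R) :
  (forall om, measC (F om)) -> intR g -> (forall om tau, `|F om tau| <= g tau) ->
  (forall tau, continuous (F ^~ tau)) -> continuous (fun om => Cint (F om)).
Proof.
move=> mF ig Fg cF om.
have cr (p : C -> R) : (forall z w, `|p z - p w| <= `|z - w|) -> (forall z, `|p z| <= `|z|) ->
    (forall om, measurable_fun setT (fun tau => p (F om tau))) ->
    {in `]om - 1, om + 1[%classic, continuous (fun om => \int[mu]_tau p (F om tau))%R}.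
  move=> p1 p2 mp; apply: (@continuity_under_integral _ _ _ mu (fun om tau => p (F om tau)) _ measurableT _ _ _ _ g) => //.
  - move=> x _; apply: (intR_le (mp x) _ ig) => tau.
    exact: le_trans (p2 _) (Fg _ _).
  - apply: aeW => y _ x _; apply/cvgrPdist_le => e e0.
    have /cvgrPdist_le/(_ _ e0) := cF y x; apply: filterS => z.
    exact: le_trans.
  - by move=> x _; apply: aeW => y _; exact: le_trans (p2 _) (Fg _ _).
have om1 : om \in `]om - 1, om + 1[%classic.
  by rewrite inE/= in_itv/= ltrBlDr !ltrDl ltr01.
apply: cvg_complex.
  apply: (cr _ _ _ _ om om1) => [z w|z|x]; [rewrite -ReB| |exact: (mF x).1]; exact: Re_le_norm.
apply: (cr _ _ _ _ om om1) => [z w|z|x]; [rewrite -ImB| |exact: (mF x).2]; exact: Im_le_norm.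
Qed.

Lemma cvg_cmul {T : Type} {F : set_system T} {FF : Filter F} (f g : T -> C) (a b : C) :
  f @ F --> a -> g @ F --> b -> cmul (f x) (g x) @[x --> F] --> cmul a b.
Proof.
move=> fa gb.
have cvgp (p : C -> R) (h : T -> C) (c : C) : (forall z w, `|p z - p w| <= `|z - w|) ->
    h @ F --> c -> p (h n) @[n --> F] --> p c.
  move=> p1 hc; apply/cvgrPdist_le => e e0; have /cvgrPdist_le/(_ e e0) := hc.
  by apply: filterS => n; exact: le_trans.
have re1 (z w : C) : `|complex.Re z - complex.Re w| <= `|z - w| by rewrite -ReB; exact: Re_le_norm.
have im1 (z w : C) : `|complex.Im z - complex.Im w| <= `|z - w| by rewrite -ImB; exact: Im_le_norm.
have fr := cvgp _ _ _ re1 fa; have fi := cvgp _ _ _ im1 fa.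
have gr := cvgp _ _ _ re1 gb; have gi := cvgp _ _ _ im1 gb.
apply: cvg_complex => /=; [apply: cvgB|apply: cvgD]; exact: cvgM.
Qed.

Lemma Ft_continuous w : intC w -> continuous (Ft w).
Proof.
move=> iw; apply: (@continuous_Cint _ (fun tau => `|w tau|)).
- by move=> om; apply: intC_meas; exact: intC_cmul_wave.
- exact: intC_norm.
- by move=> om tau; rewrite cmul_norm wave_norm mulr1.
- move=> tau om; apply: cvg_cmul; first exact: cvg_cst.
  exact: continuous_wave.
Qed.

Lemma FtD w w' : intC w -> intC w' -> Ft (w + w') = Ft w + Ft w'.
Proof.
move=> iw iw'; apply/funext => om; rewrite /wave_transform !fctE -CintD; [|exact: intC_cmul_wave..].
by apply: eq_Cint => x; exact: cmulDl.
Qed.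

Lemma FtZ a w : intC w -> Ft (a *: w) = a *: Ft w.
Proof.
move=> iw; apply/funext => om; rewrite /wave_transform !fctE -CintZ; last exact: intC_cmul_wave.
by apply: eq_Cint => x; exact: cmulZl.
Qed.

Lemma FtB w w' : intC w -> intC w' -> Ft (w - w') = Ft w - Ft w'.
Proof.
move=> iw iw'; rewrite -scaleN1r FtD//; last exact: intCZ.
by rewrite FtZ// scaleN1r.
Qed.

Lemma FtM z w om : intC w -> Ft (fun tau => cmul z (w tau)) om = cmul z (Ft w om).
Proof.
move=> iw; rewrite /wave_transform -CintM; last exact: intC_cmul_wave.
by apply: eq_Cint => x; rewrite cmulA.
Qed.

Lemma Rint_ind_FTC (p q : R) (f F : R -> R) : p <= q -> continuous f ->
  (forall x : R, is_derive x 1 F (f x)) ->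
  (\int[mu]_x (\1_(`]p, q[%classic) x * f x) = F q - F p)%R.
Proof.
move=> pq cf dF.
have [->|pq'] := eqVneq p q.
  rewrite subrr (eq_Rint (g := fun=> 0)); last first.
    by move=> x; rewrite set_itvoo0 indic0 mul0r.
  by rewrite Rintegral_cst// mul0r.
have ltpq : p < q by rewrite lt_neqAle pq' pq.
have cF : continuous F.
  by move=> x; apply: differentiable_continuous; apply/derivable1_diffP; have := dF x.
have cI : mu.-integrable `[p, q] (EFin \o f).
  apply: continuous_compact_integrable; first exact: segment_compact.
  exact: continuous_subspaceT.
have -> : (\int[mu]_x (\1_(`]p, q[%classic) x * f x) = \int[mu]_(x in `]p, q[) f x)%R.
  rewrite [RHS]Rintegral_mkcond; apply: eq_Rint => x.
  by rewrite patchE indicE; case: ifP; rewrite ?mul1r ?mul0r.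
rewrite Rintegral_itv_bndo_bndc; last first.
  by apply: (integrableS _ _ _ cI) => //; exact: subset_itv_oo_cc.
rewrite Rintegral_itv_obnd_cbnd; last first.
  by apply: (integrableS _ _ _ cI) => //; exact: subset_itv_oc_cc.
rewrite /Rintegral (continuous_FTC2 ltpq (F := F))//.
- exact: continuous_subspaceT.
- split; first by move=> x _; have := dF x.
    by apply: cvg_at_right_filter; exact: cF.
  by apply: cvg_at_left_filter; exact: cF.
- by move=> x _; rewrite derive1E; apply: derive_val.
Qed.

Lemma is_derive_affine_comp (k om : R) (f f' : R -> R) (x : R) :
  (forall y : R, is_derive y 1 f (f' y)) ->
  is_derive x 1 (fun x => k * f (om * (th - x))) (- (k * om) * f' (om * (th - x))).
Proof.
move=> df; pose phi x := om * (th - x).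
have dphi : is_derive x 1 phi (- om).
  have -> : phi = om *: (cst th - id) by apply/funext.
  by apply: is_derive_eq; rewrite sub0r scalerN /GRing.scale/= mulr1.
have dc : is_derive x 1 (k *: (f \o phi)) (k *: (f' (phi x) * - om)).
  by apply: is_deriveZ; exact: is_derive1_comp.
rewrite (_ : - (k * om) * _ = k *: (f' (phi x) * - om))//.
by rewrite /GRing.scale/= /phi; ring.
Qed.

(** The fundamental theorem of calculus; the squared modulus does not depend on
    [th], nor on the position of the interval. *)
Lemma Ft_ind_norm (p q om : R) : p <= q ->
  `|Ft (indC `]p, q[) om| ^+ 2 = if om == 0 then (q - p) ^+ 2
    else (2 - 2 * cos (om * (q - p))) / om ^+ 2.
Proof.
move=> pq.
have -> : Ft (indC `]p, q[) om = Complex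
    (\int[mu]_x (\1_(`]p, q[%classic) x * cos (om * (th - x))))
    (\int[mu]_x (\1_(`]p, q[%classic) x * sin (om * (th - x)))) :> C.
  by apply: complex_ext; apply: eq_Rint => x /=; rewrite mul0r ?subr0 ?addr0.
have ca : continuous (fun x => om * (th - x)).
  by move=> x; apply: cvgMr; apply: cvgB; [exact: cvg_cst|exact: cvg_id].
have cc : continuous (fun x => cos (om * (th - x))).
  by move=> x; exact: cvg_comp (ca x) (@continuous_cos R _).
have cs : continuous (fun x => sin (om * (th - x))).
  by move=> x; exact: cvg_comp (ca x) (@continuous_sin R _).
rewrite -rip_sqr /rip /=.
have [om0|om0] := eqVneq om 0.
  have D1 (x : R) : is_derive x 1 (fun x => x) (cos (om * (th - x))).
    by rewrite om0 mul0r cos0; exact: is_derive_id.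
  have D2 (x : R) : is_derive x 1 (fun=> 0) (sin (om * (th - x))).
    by rewrite om0 mul0r sin0; exact: is_derive_cst.
  by rewrite (Rint_ind_FTC pq cc D1) (Rint_ind_FTC pq cs D2) subrr mul0r addr0 expr2.
have D1 (x : R) : is_derive x 1 (fun x => - om^-1 * sin (om * (th - x))) (cos (om * (th - x))).
  have := is_derive_affine_comp (- om^-1) om x (@is_derive_sin R).
  by rewrite (_ : - (- om^-1 * om) = 1) ?mul1r// mulNr mulVf// opprK.
have D2 (x : R) : is_derive x 1 (fun x => om^-1 * cos (om * (th - x))) (sin (om * (th - x))).
  have := is_derive_affine_comp om^-1 om x (@is_derive_cos R).
  by rewrite (_ : - (om^-1 * om) * - _ = sin (om * (th - x)))// mulVf// mulN1r opprK.
rewrite (Rint_ind_FTC pq cc D1) (Rint_ind_FTC pq cs D2).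
have -> : om * (q - p) = om * (th - p) - om * (th - q) by ring.
set A := om * (th - p); set B := om * (th - q); rewrite cosB.
transitivity (((cos A ^+ 2 + sin A ^+ 2) + (cos B ^+ 2 + sin B ^+ 2)
    - 2 * (cos A * cos B + sin A * sin B)) / om ^+ 2); last by rewrite !cos2Dsin2.
by field.
Qed.

End fourier.

Lemma FtE {R : realType} (th : R) (w : R -> Rcomplex R) om :
  wave_transform th w om = Cint (fun tau => cmul (w tau) (wave th om tau)).
Proof. by []. Qed.

(** * Transforms of indicators of intervals *)

Section reflection.
Context {R : realType}.
Local Notation mu := (@lebesgue_measure R).

Lemma ge0_integral_halves (f : R -> R) : (forall x, 0 <= f x) -> continuous f ->
  (\int[mu]_x (f x)%:E = \int[mu]_(x in `[0%R, +oo[) (f x)%:E +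
     \int[mu]_(x in `[0%R, +oo[) (f (- x))%:E)%E.
Proof.
move=> f0 cf.
have mf : measurable_fun [set: R] f by exact: continuous_measurable_fun.
rewrite -(setUv (`[0, +oo[%classic : set R)) ge0_integral_setU//=; last 4 first.
  exact: measurableC.
  by rewrite setUv; exact/measurable_EFinP.
  by move=> x _; rewrite lee_fin.
  exact/disj_setPCl.
congr (_ + _)%E; rewrite setCitvr.
rewrite integral_itv_bndo_bndc; last exact/measurable_EFinP/measurable_funTS.
rewrite -{1}oppr0 ge0_integration_by_substitutionNy//.
exact: continuous_subspaceT.
Qed.

Lemma ge0_integral_oppr (f : R -> R) : (forall x, 0 <= f x) -> continuous f ->
  (\int[mu]_x (f x)%:E = \int[mu]_x (f (- x))%:E)%E.
Proof.
move=> f0 cf; rewrite !ge0_integral_halves//; last first.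
  by move=> x; exact: cvg_comp (@oppr_continuous _ R x) (cf _).
by under [X in (_ = _ + X)%E]eq_integral do rewrite opprK; rewrite addeC.
Qed.

(** The positive functions [`|f| + f] and [`|f| - f] are exchanged by the reflection,
    so their integrals agree. *)
Lemma Rint_odd (f : R -> R) : continuous f -> intR f -> (forall x, f (- x) = - f x) ->
  (\int[mu]_x f x = 0)%R.
Proof.
move=> cf iF fN.
have G0 x : 0 <= `|f x| + f x by have := ler_norm (- f x); rewrite normrN; lra.
have cG : continuous (fun x => `|f x| + f x).
  by move=> x; apply: cvgD; [apply: cvg_norm|]; exact: cf.
have E : (\int[mu]_x (`|f x| + f x) = \int[mu]_x (`|f x| - f x))%R.
  rewrite /Rintegral ge0_integral_oppr//; congr fine; apply: eq_integral => x _.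
  by rewrite fN normrN.
move: E; rewrite RintD ?RintB//; try exact: intR_norm.
move=> /addrI /eqP; rewrite -addr_eq0 -mulr2n mulrn_eq0/= => /eqP.
by [].
Qed.

Lemma intR_oneDsqrV : intR (fun x : R => (1 + x ^+ 2)^-1).
Proof.
have c1 : continuous (fun x : R => (1 + x ^+ 2)^-1) := @continuous_oneDsqrV R.
have g0 (x : R) : 0 <= (1 + x ^+ 2)^-1 by rewrite invr_ge0 addr_ge0// sqr_ge0.
apply/integrableP; split.
  by apply/measurable_EFinP; exact: continuous_measurable_fun.
under eq_integral do rewrite /= ger0_norm//.
rewrite ge0_integral_halves//.
have E : (\int[mu]_(x in `[0%R, +oo[) ((1 + x ^+ 2)^-1)%:E = (pi / 2)%:E)%E.
  exact: integral0y_oneDsqr.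
under [X in (_ + X)%E]eq_integral do rewrite sqrrN.
by rewrite E -EFinD ltry.
Qed.

End reflection.

Section fourier_intervals.
Context {R : realType} (th : R).
Local Notation C := (Rcomplex R).
Local Notation mu := (@lebesgue_measure R).
Local Notation Ft := (wave_transform th).
Local Notation h p q := (Ft (indC `]p, q[)).

Lemma indCE (A : set R) x : indC A x = Complex (\1_A x) 0 :> C. Proof. by []. Qed.

Lemma indC_off (p q x : R) : ~ `]p, q[%classic x -> indC `]p, q[ x = 0 :> C.
Proof. by move=> nx; rewrite /indC indicE memNset. Qed.

Lemma intC_ind (p q : R) : p <= q -> intC (indC `]p, q[ : R -> C).
Proof.
move=> pq; apply: (L1_le_L2 pq (L2_ind_itv pq).1 _).1 => x.
exact: indC_off.
Qed.

Lemma Ft_ind_le (p q om : R) : p <= q -> `|h p q om| <= q - p.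
Proof.
move=> pq; rewrite (le_trans (@Ft_norm _ th _ om (intC_ind pq)))//.
have [_ L] := L1_le_L2 pq (L2_ind_itv pq).1 (@indC_off p q).
rewrite (le_trans L)// -[n2 _]ger0_norm ?n2_ge0// -sqrtr_sqr (L2_ind_itv pq).2.
by rewrite -expr2 sqr_sqrtr// subr_ge0.
Qed.

Lemma Ft_ind_L2 (p q : R) : p <= q -> L2 setT (h p q).
Proof.
move=> pq; have ch := @Ft_continuous _ th _ (intC_ind pq).
apply/L2_sqr_int; split; first exact: continuous_measC.
apply: (intR_le _ _ (intRZ ((q - p) ^+ 2 + 4) intR_oneDsqrV)).
  by apply: measurable_funX; apply: measC_norm; exact: continuous_measC.
move=> om; rewrite ger0_norm ?sqr_ge0//.
have om1 : 0 < 1 + om ^+ 2 by rewrite ltr_pwDl// sqr_ge0.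
rewrite ler_pdivlMr// mulrDr mulr1 lerD//.
  by rewrite ler_pXn2r ?nnegrE ?subr_ge0// Ft_ind_le.
rewrite Ft_ind_norm//; case: eqVneq => [->|om0].
  by rewrite expr0n/= mulr0.
rewrite divfK ?sqrf_eq0//.
have := cos_geN1 (om * (q - p)); lra.
Qed.

Lemma n2_0 : n2 (0 : R -> C) = 0.
Proof. by rewrite -(scale0r 0) n2Z ?normr0 ?mul0r//; exact: L2_0. Qed.

(** Plancherel's constant, which is [2 * pi]. As the squared norm of one
    transform it comes without the evaluation of an integral: scaling relates it to
    the other intervals. *)
Definition planch : R := n2 (h 0 1) ^+ 2.

(** The transform is continuous, with modulus 1 at the frequency 0. *)
Lemma planch_gt0 : 0 < planch.
Proof.
have L := Ft_ind_L2 (@ler01 R); have ch := @Ft_continuous _ th _ (intC_ind (@ler01 R)).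
rewrite /planch n2_sqr//.
have g1 : `|h 0 1 0| = 1.
  apply/eqP; rewrite -(@eqrXn2 _ 2)// Ft_ind_norm// eqxx.
  by rewrite subr0.
have /cvgrPdist_le/(_ (1/2)) := ch 0 => /(_ _)/nbhs_ballP[|d d0 dh]; first lra.
have {}dh x : `]- d, d[%classic x -> 1 / 2 <= `|h 0 1 x|.
  rewrite /= in_itv/= => xd.
  have : ball 0 d x by rewrite -ball_normE/= sub0r normrN ltr_norml.
  move=> /dh /=; have := ler_normD (h 0 1 0 - h 0 1 x) (h 0 1 x).
  by rewrite subrK g1; lra.
have dd : - d <= d by rewrite ge0_cp// ltW.
have [Ld nd] := L2_ind_itv dd.
have id : intR (fun x => `|indC `]- d, d[ x| ^+ 2) by have [] := (L2_sqr_int _).1 Ld.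
apply: (@lt_le_trans _ _ (\int[mu]_x (1 / 4 * `|indC `]- d, d[ x| ^+ 2))).
  rewrite RintZ// -n2_sqr// nd opprK; move: d0 => /= d0; lra.
apply: le_Rint; [exact: intRZ|by have [] := (L2_sqr_int _).1 L|].
move=> x; rewrite indC_norm indicE; have [xd|xd] := boolP (x \in _).
  have := dh _ (set_mem xd); have := normr_ge0 (h 0 1 x); rewrite expr1n.
  nra.
by rewrite expr0n/= mulr0 sqr_ge0.
Qed.

(** By the explicit modulus, transforms of intervals are obtained from one another by
    dilation of the frequency. *)
Lemma Ft_ind_n2 (p q : R) : p <= q -> n2 (h p q) ^+ 2 = planch * (q - p).
Proof.
move=> pq; have [->|pq'] := eqVneq p q.
  rewrite subrr mulr0 (_ : h q q = 0) ?n2_0 ?expr0n//; apply/funext => om.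
  by apply/eqP; rewrite -normr_le0 (le_trans (Ft_ind_le om (lexx q)))// subrr.
have L0 : 0 < q - p by rewrite subr_gt0 lt_neqAle pq' pq.
have E1 := n2_sqr (Ft_ind_L2 pq).
have E2 := n2_sqr (Ft_ind_L2 (@ler01 R)).
rewrite E1 /planch E2.
pose G x : R := `|h 0 1 x| ^+ 2.
have cG : continuous G.
  move=> x; rewrite /G; apply: cvgM; apply: cvg_norm; exact: (@Ft_continuous _ th _ (intC_ind (@ler01 R))).
pose F (x : R) := (q - p) * x.
have dF (x : R) : is_derive x 1 F (q - p).
  have -> : F = (q - p) *: (id : R -> R) by apply/funext.
  by apply: is_derive_eq; rewrite /GRing.scale/= mulr1.
have F'E : derive1 F = cst (q - p).
  by apply/funext => x; rewrite derive1E; exact: derive_val.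
have -> : (\int[mu]_x `|h 0 1 x| ^+ 2 = \int[mu]_x ((q - p)^-1 * `|h p q x| ^+ 2))%R.
  rewrite /Rintegral (@increasing_ge0_integration_by_substitutionT _ F G).
  - congr fine; apply: eq_integral => x _; congr EFin.
    rewrite !fctE F'E /= /G !Ft_ind_norm// subr0 mulr1 /F.
    have [->|x0] := eqVneq x 0.
      by rewrite mulr0 eqxx expr1n mul1r expr2 mulKf// gt_eqF.
    rewrite mulf_eq0 (gt_eqF L0) (negbTE x0)/= (mulrC x).
    by field; rewrite x0 gt_eqF.
  - by move=> x y xy; rewrite /F ltr_pM2l.
  - by rewrite F'E => x; exact: cvg_cst.
  - by rewrite F'E; exact: is_cvg_cst.
  - by rewrite F'E; exact: is_cvg_cst.
  - by move=> x; have := dF x.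
  - by apply: gt0_cvgMrNy => //; exact: cvg_id.
  - by apply: gt0_cvgMry => //; exact: cvg_id.
  - exact: cG.
  - by move=> x; exact: sqr_ge0.
rewrite RintZ; last by have [] := (L2_sqr_int _).1 (Ft_ind_L2 pq).
by move: (Rintegral _ _ _) => J; field; rewrite gt_eqF.
Qed.

Lemma Ft_ind_opp (p q om : R) : complex.Re (h p q (- om)) = complex.Re (h p q om) /\
  complex.Im (h p q (- om)) = - complex.Im (h p q om).
Proof.
split; first by apply: eq_Rint => x /=; rewrite mulNr cosN sinN !mul0r.
have -> : complex.Im (h p q om) =
  (\int[mu]_x complex.Im (cmul (indC `]p, q[ x) (wave th om x)))%R by [].
rewrite -[RHS]mulN1r -RintZ.
  by apply: eq_Rint => x /=; rewrite mulNr sinN !mul0r !addr0 mulN1r mulrN.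
have [qp|pq] := leP q p; last by have [] := intC_cmul_wave th om (intC_ind (ltW pq)).
apply: (@eq_integrable _ _ _ _ _ _ (EFin \o (fun=> 0))) => //.
  by move=> x _ /=; rewrite set_itv_ge ?bnd_simp -?leNgt// indic0 !mul0r addr0.
by rewrite (_ : EFin \o _ = fun=> 0%E)//; exact: integrable0.
Qed.

#[local] Opaque wave_transform n2 indC.

Lemma Ft_null (a b : R) (w : R -> C) : a <= b -> L2 setT w ->
  (forall x, ~ `]a, b[%classic x -> w x = 0) -> n2 w = 0 -> Ft w = 0.
Proof.
move=> ab Lw w0 nw; apply/funext => om; apply/eqP; rewrite -normr_le0.
have [iw w1] := L1_le_L2 ab Lw w0.
by rewrite (le_trans (@Ft_norm _ th _ om iw))// (le_trans w1)// nw mulr0.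
Qed.

Lemma Ft_ind_add (p q s : R) : p <= q -> q <= s -> h p q + h q s = h p s.
Proof.
move=> pq qs; have ps := le_trans pq qs.
have Lpq := (L2_ind_itv pq).1; have Lqs := (L2_ind_itv qs).1; have Lps := (L2_ind_itv ps).1.
apply/eqP; rewrite -subr_eq0 -FtD; [|exact: intC_ind..].
rewrite -FtB; [|by apply: intCD; exact: intC_ind|exact: intC_ind].
apply/eqP/(Ft_null ps); first by apply: L2B => //; exact: L2D.
  move=> x nx; rewrite !fctE !indC_off ?addr0 ?subrr//;
    by move: nx; rewrite /= !in_itv/=; apply: contra_not => /andP[? ?]; apply/andP; split; lra.
pose g : R -> C := indC `]p, q[ + indC `]q, s[ - indC `]p, s[.
have mg : measC g by apply: L2_meas; apply: L2B => //; exact: L2D.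
have g0 x : ~ [set q] x -> (0 : R -> C) x = g x.
  move=> /eqP xq; apply/esym/complex_ext; rewrite /g !fctE !indCE ?ReB ?ReD ?ImB ?ImD /=; last first.
    by rewrite addr0 subr0.
  rewrite !indicE !mem_setE !in_itv/=; move: xq; rewrite neq_lt => /orP[xq|xq].
    by rewrite xq (lt_le_trans xq qs) (ltNge q) (ltW xq) !andbT addr0 subrr.
  by rewrite xq (le_lt_trans pq xq) (ltNge x q) (ltW xq) !andbF/= add0r subrr.
have [_ <-] := n2_ae (L2_0 R) mg (measurable_set1 q) (lebesgue_measure_set1 q) g0.
exact: n2_0.
Qed.

(** The squared norm is additive on adjacent intervals, so the cross term vanishes. *)
Lemma ip_h_adjacent (p q s : R) : p <= q -> q <= s -> ip (h p q) (h q s) = 0.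
Proof.
move=> pq qs; have ps := le_trans pq qs.
have Lpq := Ft_ind_L2 pq; have Lqs := Ft_ind_L2 qs; have Lps := Ft_ind_L2 ps.
have E := n2_sqrD Lpq Lqs; rewrite (Ft_ind_add pq qs) in E.
have key (A B D z P : R) : A = P * (s - p) -> B = P * (q - p) -> D = P * (s - q) ->
  A = B + 2 * z + D -> z = 0 by clear; move=> -> -> -> ?; lra.
exact: key (Ft_ind_n2 ps) (Ft_ind_n2 pq) (Ft_ind_n2 qs) E.
Qed.

Lemma ip_h_disjoint (p q r s : R) : p <= q -> q <= r -> r <= s -> ip (h p q) (h r s) = 0.
Proof.
move=> pq qr rs; have qs := le_trans qr rs.
have := ip_h_adjacent pq qs; rewrite -(Ft_ind_add qr rs).
rewrite (ipDr (Ft_ind_L2 pq) (Ft_ind_L2 qr) (Ft_ind_L2 rs)).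
by rewrite (ip_h_adjacent pq qr) add0r.
Qed.

(** Plancherel's formula for intervals starting at 0: the transform of the part of the
    larger interval beyond the smaller one is orthogonal. *)
Lemma ip_h_ind (x y : R) : 0 <= x -> 0 <= y ->
  ip (h 0 x) (h 0 y) = planch * ip (indC `]0, x[) (indC `]0, y[).
Proof.
wlog xy : x y / x <= y => [H|] x0 y0.
  by have [xy|/ltW yx] := leP x y; [exact: H|rewrite ipC H// ipC].
have Lx := Ft_ind_L2 x0; have Lxy := Ft_ind_L2 xy.
rewrite -(Ft_ind_add x0 xy) (ipDr Lx Lx Lxy) (ip_h_adjacent x0 xy) addr0 (ip_sqr Lx).
rewrite (Ft_ind_n2 x0) -(L2_ind_itv x0).2 -(ip_sqr (L2_ind_itv x0).1).
congr (_ * _); apply: eq_Rint => z; rewrite !indCE /rip /= mulr0 !addr0 !indicE !mem_setE !in_itv/=.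
case: (ltP 0 z) => z0 //=; case: (ltP z x) => zx /=; last by rewrite !mul0r.
by rewrite (lt_le_trans zx xy).
Qed.

(** The imaginary part of the Hermitian product of [u] and [v]. *)
Definition rix (u v : C) : R := complex.Im u * complex.Re v - complex.Re u * complex.Im v.

Lemma rip_cmul2 (a a' u v : C) :
  rip (cmul a u) (cmul a' v) = rip a a' * rip u v - rix a a' * rix u v.
Proof. rewrite /rip /rix /=; ring. Qed.

Lemma rix_le (u v : C) : `|rix u v| <= `|u| * `|v|.
Proof.
rewrite -(@ler_pXn2r _ 2) ?nnegrE ?mulr_ge0// real_normK ?num_real// exprMn.
rewrite -!rip_sqr /rip /rix -subr_ge0.
rewrite (_ : _ - _ = rip u v ^+ 2); first exact: sqr_ge0.
rewrite /rip; ring.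
Qed.

Lemma L2_cmul (a : C) f : L2 setT f ->
  L2 setT (fun x => cmul a (f x)) /\ n2 (fun x => cmul a (f x)) = `|a| * n2 f.
Proof.
move=> Lf; have [mf iF] := (L2_sqr_int f).1 Lf.
have E x : `|cmul a (f x)| ^+ 2 = `|a| ^+ 2 * `|f x| ^+ 2 by rewrite cmul_norm exprMn.
have L : L2 setT (fun x => cmul a (f x)).
  apply/L2_sqr_int; split.
    by apply: measCM => //; split; exact: measurable_cst.
  by under eq_fun do rewrite E; exact: intRZ.
split=> //; apply/eqP; rewrite -(@eqrXn2 _ 2) ?mulr_ge0 ?n2_ge0// exprMn !n2_sqr// -RintZ//.
by apply/eqP/eq_Rint.
Qed.

Lemma continuous_ReIm (f : R -> C) : continuous f ->
  continuous (fun x => complex.Re (f x)) /\ continuous (fun x => complex.Im (f x)).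
Proof.
move=> cf; split=> x; apply/cvgrPdist_le => e e0; have /cvgrPdist_le/(_ _ e0) := cf x;
  apply: filterS => y; apply: le_trans; first by rewrite -ReB; exact: Re_le_norm.
by rewrite -ImB; exact: Im_le_norm.
Qed.

(** Transforms of real functions are Hermitian, so this part integrates to 0. *)
Lemma Rint_rix (p q r s : R) : p <= q -> r <= s ->
  intR (fun x => rix (h p q x) (h r s x)) /\ (\int[mu]_x rix (h p q x) (h r s x) = 0)%R.
Proof.
move=> pq rs; have L1 := Ft_ind_L2 pq; have L2' := Ft_ind_L2 rs.
have [c1 c2] := continuous_ReIm (@Ft_continuous _ th _ (intC_ind pq)).
have [c3 c4] := continuous_ReIm (@Ft_continuous _ th _ (intC_ind rs)).
have cr : continuous (fun x => rix (h p q x) (h r s x)).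
  by move=> x; apply: cvgB; apply: cvgM; [exact: c2|exact: c3|exact: c1|exact: c4].
have ir : intR (fun x => rix (h p q x) (h r s x)).
  apply: (intR_le (continuous_measurable_fun cr) _ (normM_int L1 L2')) => x.
  exact: rix_le.
split => //; apply: Rint_odd => // x.
have [E1 E2] := Ft_ind_opp p q x; have [E3 E4] := Ft_ind_opp r s x.
by rewrite /rix E1 E2 E3 E4; ring.
Qed.

Lemma ip_cmul_h (a a' : C) (p q r s : R) : p <= q -> r <= s ->
  ip (fun x => cmul a (h p q x)) (fun x => cmul a' (h r s x)) =
  rip a a' * ip (h p q) (h r s).
Proof.
move=> pq rs; have L1 := Ft_ind_L2 pq; have L2' := Ft_ind_L2 rs.
have [ir r0] := Rint_rix pq rs.
rewrite /ip (eq_Rint (fun x => rip_cmul2 a a' (h p q x) (h r s x))).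
rewrite RintB; [|by apply: intRZ; exact: rip_int|exact: intRZ].
by rewrite !RintZ//; [rewrite r0 mulr0 subr0|exact: rip_int].
Qed.

Lemma ip_cmul_ind (a a' : C) (A B : set R) : measurable A -> measurable B ->
  L2 setT (indC A : R -> C) -> L2 setT (indC B : R -> C) ->
  ip (fun x => cmul a (indC A x)) (fun x => cmul a' (indC B x)) =
  rip a a' * ip (indC A) (indC B).
Proof.
move=> mA mB LA LB; rewrite /ip -RintZ; last exact: rip_int.
by apply: eq_Rint => x; rewrite rip_cmul2 /rix !indCE /=; ring.
Qed.

(** Pythagoras. *)
Lemma orth_sum (f : nat -> R -> C) n : (forall i, L2 setT (f i)) ->
  (forall i j, (i < j)%N -> ip (f i) (f j) = 0) ->
  L2 setT (\sum_(0 <= i < n) f i) /\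
  n2 (\sum_(0 <= i < n) f i) ^+ 2 = \sum_(0 <= i < n) n2 (f i) ^+ 2.
Proof.
move=> Lf orth.
have LS m : L2 setT (\sum_(0 <= i < m) f i).
  by elim: m => [|m IH]; [rewrite big_geq//; exact: L2_0|rewrite big_nat_recr//=; exact: L2D].
split => //; elim: n => [|n IH]; first by rewrite !big_geq// n2_0 expr0n.
rewrite !big_nat_recr//= -IH.
set S := \sum_(_ <= _ < _) _; have Sf : ip S (f n) = 0.
  rewrite /S; have : (n <= n)%N by [].
  elim: {1 3}n => [_|m IHm mn]; first by rewrite big_geq// /ip (eq_Rint (g := fun=> 0)) ?Rintegral_cst ?mul0r// => x; rewrite /rip /= !mul0r addr0.
  by rewrite big_nat_recr//= ipDl// IHm ?add0r ?orth// ltnW.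
by rewrite n2_sqrD//; [rewrite Sf mulr0 addr0|exact: LS].
Qed.
End fourier_intervals.

(** * Boundedness of the transform *)

Section transform_bound.
Context {R : realType} (th : R).
Local Notation C := (Rcomplex R).
Local Notation mu := (@lebesgue_measure R).
Local Notation Ft := (wave_transform th).
Local Notation h p q := (Ft (indC `]p, q[)).

Lemma Rint_cst0 : (\int[mu]_x (0 : R) = 0)%R.
Proof. by rewrite Rintegral_cst// mul0r. Qed.

Lemma expi_lipschitz (x y : R) : `|expi x - expi y : C| <= `|x - y|.
Proof.
rewrite -(@ler_pXn2r _ 2) ?nnegrE// real_normK ?num_real// -rip_sqr /rip ReB ImB /=.
have [xy|xy] := eqVneq (x - y) 0.
  by have -> : x = y by [lra]; rewrite !subrr !mulr0 addr0 expr0n.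
have s2 : 0 < (x - y) ^+ 2 by rewrite exprn_even_gt0.
have := Ft_ind_norm th (x - y) (@ler01 R); rewrite (negbTE xy) subr0 mulr1 => E.
have : (2 - 2 * cos (x - y)) / (x - y) ^+ 2 <= 1.
  by rewrite -E expr_le1// (le_trans (Ft_ind_le th (x - y) (@ler01 R)))// subr0.
rewrite ler_pdivrMr// mul1r cosB => {E s2 xy}.
have := cos2Dsin2 x; have := cos2Dsin2 y; nra.
Qed.

Lemma wave_lipschitz (om t s : R) : `|wave th om t - wave th om s| <= `|om| * `|t - s|.
Proof.
rewrite (le_trans (expi_lipschitz _ _))// -normrM distrC.
by rewrite (_ : _ - _ = om * (t - s))//; ring.
Qed.

(** On a short interval a wave is nearly constant, so the transform of a function
    with small support is nearly its integral times a wave. *)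
Lemma Ft_short (p q om : R) (v : R -> C) : p <= q -> intC v ->
  (forall x, ~ `]p, q[%classic x -> v x = 0) ->
  `|Ft v om - cmul (Cint v) (wave th om p)| <= `|om| * (q - p) * (\int[mu]_x `|v x|)%R.
Proof.
move=> pq iv v0.
have iw := intC_cmul_wave th om iv.
have ic : intC (fun x => cmul (wave th om p) (v x)).
  apply: (@intC_le _ _ (fun x => `|v x|)); last exact: intC_norm.
    by apply: measCM; [split; exact: measurable_cst|exact: intC_meas].
  by move=> x; rewrite cmul_norm wave_norm mul1r.
have -> : Ft v om - cmul (Cint v) (wave th om p) =
    Cint (fun x => cmul (v x) (wave th om x) + -1 *: cmul (wave th om p) (v x)).
  by rewrite CintD//; [rewrite CintZ// CintM// scaleN1r cmulC|exact: intCZ].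
rewrite -RintZ; last exact: intC_norm.
apply: le_trans (norm_Cint _) _; first by apply: intCD => //; exact: intCZ.
apply: le_Rint; first by apply: intC_norm; apply: intCD => //; exact: intCZ.
  by apply: intRZ; exact: intC_norm.
move=> x; rewrite scaleN1r (cmulC (wave th om p)).
have [xpq|/v0 ->] := pselect (`]p, q[%classic x); last first.
  rewrite normr0 mulr0 (_ : _ - _ = 0) ?normr0//.
  by apply: complex_ext; rewrite ReB ImB || rewrite ?ReB ?ImB /= !mul0r; ring.
have -> : cmul (v x) (wave th om x) - cmul (v x) (wave th om p) =
    cmul (v x) (wave th om x - wave th om p).
  by rewrite cmulDr -scaleN1r -cmulZr scaleN1r.
rewrite cmul_norm mulrC ler_wpM2r// (le_trans (wave_lipschitz _ _ _))// ler_wpM2l//.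
move: xpq; rewrite /= in_itv/= => /andP[px xq].
by rewrite ger0_norm ?subr_ge0 ?(ltW px)// lerD2r ltW.
Qed.

Lemma Cint_ind (p q : R) : p <= q -> Cint (indC `]p, q[) = Complex (q - p) 0 /\
  (\int[mu]_x `|indC `]p, q[ x| = q - p)%R.
Proof.
move=> pq; have E : (\int[mu]_x \1_(`]p, q[%classic) x = q - p)%R.
  have d1 (x : R) : is_derive x 1 (fun x : R => x) 1 by exact: is_derive_id.
  rewrite -(Rint_ind_FTC pq (fun x => @cvg_cst _ _ _ _ _) d1).
  by apply: eq_Rint => x; rewrite mulr1.
split; last by rewrite (eq_Rint (fun x => indC_norm _ x)).
apply: complex_ext.
  by rewrite -[RHS]E; apply: eq_Rint => x; rewrite indCE.
by rewrite -[RHS]Rint_cst0; apply: eq_Rint => x; rewrite indCE.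
Qed.

Lemma cmulZl1 (a : R) (z : C) : a *: z = cmul (Complex a 0) z.
Proof. by apply: complex_ext; rewrite ?ReZ ?ImZ /=; ring. Qed.

Section steps.
Variables (b : R) (w : R -> C) (N : nat).
Hypothesis b0 : 0 < b.
Hypothesis Lw : L2supp b w.

Let d := b / N.+1%:R.
Let t (j : nat) := j%:R * d.
Let piece j : R -> C := fun x => \1_(`]t j, t j.+1[%classic) x *: w x.
Let A j := Cint (piece j).
Let f j : R -> C := fun om => d^-1 *: cmul (A j) (h (t j) (t j.+1) om).

Let d0 : 0 < d. Proof. exact: divr_gt0. Qed.
Let tS j : t j.+1 = t j + d. Proof. by rewrite /t -addn1 natrD mulrDl mul1r. Qed.
Let tle j : t j <= t j.+1. Proof. by rewrite tS lerDl ltW. Qed.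
Let t_mono i j : (i <= j)%N -> t i <= t j.
Proof. by move=> ij; rewrite /t ler_pM2r// ler_nat. Qed.

Let Lpiece j : L2 setT (piece j) /\ n2 (piece j) <= n2 w.
Proof.
apply: n2_le; first exact: Lw.1.
  by apply: measCZ; [exact: measurable_indic|exact: L2_meas Lw.1].
move=> x; rewrite normrZ indicE; case: (x \in _); rewrite ?normr1 ?mul1r//.
by rewrite normr0 mul0r.
Qed.

Let piece_off j x : ~ `]t j, t j.+1[%classic x -> piece j x = 0.
Proof. by move=> nx; rewrite /piece indicE memNset// scale0r. Qed.

Let ipiece j : intC (piece j) /\ (\int[mu]_x `|piece j x| <= Num.sqrt d * n2 (piece j))%R.
Proof.
have := L1_le_L2 (tle j) (Lpiece j).1 (@piece_off j).
by rewrite tS addrAC subrr add0r.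
Qed.

Let A_le j : `|A j| <= Num.sqrt d * n2 (piece j).
Proof. by have [i1 i2] := ipiece j; apply: le_trans (norm_Cint i1) i2. Qed.

Let Lf j : L2 setT (f j) /\ n2 (f j) ^+ 2 <= planch th * n2 (piece j) ^+ 2.
Proof.
have [L1 E1] := L2_cmul (A j) (Ft_ind_L2 th (tle j)).
have fE : f j = d^-1 *: (fun om => cmul (A j) (h (t j) (t j.+1) om)) by [].
split; first by rewrite fE; exact: L2Z.
rewrite fE n2Z// E1 !exprMn (Ft_ind_n2 th (tle j)) tS (addrAC (t j)) subrr add0r.
rewrite real_normK ?num_real//.
have A2 : `|A j| ^+ 2 <= d * n2 (piece j) ^+ 2.
  rewrite -[X in X * _](sqr_sqrtr (ltW d0)) -exprMn ler_pXn2r ?nnegrE//.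
  by rewrite mulr_ge0// n2_ge0.
rewrite [leLHS](_ : _ = planch th * (d^-1 * `|A j| ^+ 2)); last first.
  by field; rewrite gt_eqF.
by rewrite ler_pM2l ?planch_gt0// ler_pdivrMl.
Qed.

Let orth_f i j : (i < j)%N -> ip (f i) (f j) = 0.
Proof.
move=> ij.
have [L1 _] := L2_cmul (A i) (Ft_ind_L2 th (tle i)).
have [L2' _] := L2_cmul (A j) (Ft_ind_L2 th (tle j)).
rewrite -[ip _ _]/(ip (d^-1 *: (fun om => cmul (A i) (h (t i) (t i.+1) om)))
  (d^-1 *: (fun om => cmul (A j) (h (t j) (t j.+1) om)))).
rewrite (ipZl _ L1 (L2Z d^-1 L2')) ipC (ipZl _ L2' L1) ipC.
rewrite (ip_cmul_h th _ _ (tle i) (tle j)).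
by rewrite (ip_h_disjoint th (tle i) (t_mono ij) (tle j)) !mulr0.
Qed.

Let orth_piece i j : (i < j)%N -> ip (piece i) (piece j) = 0.
Proof.
move=> ij; rewrite /ip (eq_Rint (g := fun=> 0)) ?Rintegral_cst ?mul0r// => x.
have [xi|xi] := ltP x (t i.+1).
  rewrite [X in rip _ X]piece_off ?/rip/= ?mulr0 ?addr0//= in_itv/= => /andP[jx _].
  by have := lt_trans jx xi; rewrite ltNge t_mono.
rewrite piece_off ?/rip/= ?mul0r ?addr0//= in_itv/= => /andP[_ ix].
by have := lt_le_trans ix xi; rewrite ltxx.
Qed.

Let piece_sum : exists Z, [/\ measurable Z, mu Z = 0%E &
  forall x, ~ Z x -> (\sum_(0 <= j < N.+1) piece j) x = w x].
Proof.
exists (range t); have cZ : countable (range t).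
  by apply: card_le_trans (card_image_le _ _) _; exact: countableP.
split.
- exact: countable_measurable.
- exact: countable_lebesgue_measure0.
move=> x nx; have nt j : x != t j by apply/eqP => E; apply: nx; exists j.
have H k : (\sum_(0 <= j < k) piece j) x = \1_(`]0, t k[%classic) x *: w x.
  elim: k => [|k IH].
    by rewrite big_geq// /t mul0r set_itvoo0 indic0 scale0r.
  rewrite big_nat_recr//= fctE IH /piece -scalerDl; congr (_ *: _).
  rewrite !indicE !mem_setE !in_itv/= -mulrnDr; congr (_ *+ _).
  have tk0 : 0 <= t k by rewrite /t mulr_ge0// ltW.
  have := nt k; rewrite neq_lt => /orP[xk|xk].
    by rewrite xk (lt_le_trans xk (tle k)) (ltNge (t k)) (ltW xk)/= !andbT addn0.
  by rewrite xk (le_lt_trans tk0 xk) (ltNge x (t k)) (ltW xk)/= add0n.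
rewrite H /t /d mulrC divfK ?pnatr_eq0//.
have [xb|xb] := boolP (x \in `]0, b[%classic); first by rewrite indicE xb scale1r.
by rewrite indicE (negbTE xb) scale0r Lw.2//; apply/negP; rewrite notin_setE in xb; apply/negP.
Qed.

Let step : R -> C := \sum_(0 <= j < N.+1) f j.

(** Replace the control by its averages on a subdivision: transforms of disjoint
    intervals are orthogonal, and by the Cauchy-Schwarz inequality averaging decreases
    the norm. *)
Lemma step_bound : exists s : R -> C, [/\ L2 setT s,
  n2 s ^+ 2 <= planch th * n2 w ^+ 2 &
  forall om, `|Ft w om - s om| <= 2 * `|om| * b * Num.sqrt d * n2 w].
Proof.
exists step; have [Ls nS] := orth_sum N.+1 (fun j => (Lf j).1) orth_f.
have [Lp np] := orth_sum N.+1 (fun j => (Lpiece j).1) orth_piece.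
have [Z [mZ Z0 Zw]] := piece_sum.
have nw : n2 (\sum_(0 <= j < N.+1) piece j) = n2 w.
  by have [] := n2_ae Lp (L2_meas Lw.1) mZ Z0 Zw.
split => //.
  rewrite nS -nw np mulr_sumr; apply: ler_sum => j _.
  exact: (Lf j).2.
move=> om.
have pT : 0 < t N.+1 by rewrite /t mulr_gt0.
have isum k : intC (\sum_(0 <= j < k) piece j).
  elim: k => [|k IH]; first by rewrite big_geq//; split; exact: (integrable0).
  by rewrite big_nat_recr//=; apply: intCD => //; exact: (ipiece k).1.
have -> : Ft w = Ft (\sum_(0 <= j < N.+1) piece j).
  have iw := (L1_le_L2 (ltW b0) Lw.1 Lw.2).1.
  apply/eqP; rewrite -subr_eq0 -FtB//; apply/eqP.
  apply: (Ft_null th (ltW b0)); first exact: L2B Lw.1 Lp.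
    move=> x nx; rewrite !fctE Lw.2// sub0r; apply/eqP; rewrite oppr_eq0; apply/eqP.
    elim: {1}N.+1 => [|k IH]; first by rewrite big_geq.
    by rewrite big_nat_recr//= fctE IH add0r /piece Lw.2// scaler0.
  have mg : measC (w - \sum_(0 <= j < N.+1) piece j) by apply: L2_meas; exact: L2B Lw.1 Lp.
  have g0 x : ~ Z x -> (0 : R -> C) x = (w - \sum_(0 <= j < N.+1) piece j) x.
    by move=> nZ; rewrite !fctE Zw// subrr.
  by have [_ <-] := n2_ae (L2_0 R) mg mZ Z0 g0; exact: n2_0.
have term j : `|Ft (piece j) om - f j om| <= 2 * `|om| * d * (Num.sqrt d * n2 w).
  have [i1 i2] := ipiece j.
  have tdj : t j.+1 - t j = d by rewrite tS addrAC subrr add0r.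
  have T2 := Ft_short om (tle j) i1 (@piece_off j).
  have T1 := Ft_short om (tle j) (intC_ind (tle j)) (@indC_off _ (t j) (t j.+1)).
  have [cI cN] := Cint_ind (tle j); rewrite cI cN tdj in T1; rewrite tdj in T2.
  have e1 : cmul (Complex d 0) (wave th om (t j)) = d *: wave th om (t j).
    by rewrite -cmulZl1.
  rewrite e1 in T1; set e := wave th om (t j) in T1 T2.
  have -> : Ft (piece j) om - f j om = (Ft (piece j) om - cmul (A j) e) -
      d^-1 *: cmul (A j) (h (t j) (t j.+1) om - d *: e).
    rewrite (_ : cmul (A j) (_ - _) = cmul (A j) (h (t j) (t j.+1) om) - d *: cmul (A j) e).
      by rewrite scalerBr scalerA mulVf ?gt_eqF// scale1r opprB subrKA.
    by rewrite cmulDr -scaleNr cmulZr scaleNr.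
  rewrite (le_trans (ler_normB _ _))// normrZ cmul_norm gtr0_norm ?invr_gt0//.
  have A1 : `|A j| <= Num.sqrt d * n2 w.
    by rewrite (le_trans (A_le j))// ler_wpM2l// (Lpiece j).2.
  have P1 : (\int[mu]_x `|piece j x| <= Num.sqrt d * n2 w)%R.
    by rewrite (le_trans i2)// ler_wpM2l// (Lpiece j).2.
  apply: le_trans (_ : `|om| * d * (Num.sqrt d * n2 w) + `|om| * d * (Num.sqrt d * n2 w) <= _).
    apply: lerD.
      by apply: le_trans T2 _; apply: ler_wpM2l => //; rewrite mulr_ge0// ltW.
    rewrite ler_pdivrMl//; apply: le_trans (ler_pM _ _ A1 T1) _ => //.
    by rewrite le_eqVlt; apply/orP; left; apply/eqP; ring.
  by rewrite le_eqVlt; apply/orP; left; apply/eqP; ring.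
have H k : `|Ft (\sum_(0 <= j < k) piece j) om - (\sum_(0 <= j < k) f j) om|
    <= k%:R * (2 * `|om| * d * (Num.sqrt d * n2 w)).
  elim: k => [|k IH].
    have := FtZ th 0 (isum 0%N); rewrite !scale0r !big_geq// => ->.
    by rewrite subrr normr0 mul0r.
  rewrite !big_nat_recr//= FtD//; last exact: (ipiece k).1.
  rewrite !fctE opprD addrACA (le_trans (ler_normD _ _))// -natr1 mulrDl mul1r.
  by rewrite lerD.
rewrite (le_trans (H N.+1))// le_eqVlt; apply/orP; left; apply/eqP.
have <- : N.+1%:R * d = b by rewrite /d mulrC divfK ?pnatr_eq0.
ring.
Qed.

End steps.

(** Half of Plancherel's formula: [step_bound] gives square-integrable approximations
    that converge at every frequency as the subdivision is refined, and Fatou's lemma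
    applies. *)
Theorem Ft_bound (b : R) (w : R -> C) : 0 < b -> L2supp b w ->
  L2 setT (Ft w) /\ n2 (Ft w) ^+ 2 <= planch th * n2 w ^+ 2.
Proof.
move=> b0 Lw; have /choice[s sP] N := step_bound N b0 Lw.
pose M := Num.sqrt (planch th) * n2 w.
have M0 : 0 <= M by rewrite mulr_ge0// n2_ge0.
have M2 : M ^+ 2 = planch th * n2 w ^+ 2 by rewrite exprMn sqr_sqrtr// ltW// planch_gt0.
have [|om|n|LF nF] := @n2_fatou _ s (Ft w) M M0.
- by move=> n; have [] := sP n.
- apply/cvgrPdist_le => e e0.
  have H : (2 * `|om| * b * n2 w) * Num.sqrt (b / n.+1%:R) @[n --> \oo] --> (2 * `|om| * b * n2 w) * Num.sqrt (b * 0).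
    apply: cvgMr; apply: cvg_comp; last exact: sqrt_continuous.
    by apply: cvgMr; exact: cvg_harmonic.
  rewrite mulr0 sqrtr0 mulr0 in H; move/cvgrPdist_le : H => /(_ e e0).
  apply: filterS => n; rewrite sub0r normrN => /(le_trans (ler_norm _)) ne.
  have [_ _ sn] := sP n; apply: le_trans (sn om) _.
  by apply: le_trans ne; rewrite le_eqVlt mulrAC eqxx.
- have [_ ns _] := sP n.
  by rewrite -(@ler_pXn2r _ 2) ?nnegrE ?n2_ge0// M2.
by split => //; rewrite -M2 ler_pXn2r ?nnegrE ?n2_ge0.
Qed.

End transform_bound.

(** * The adjoint of the transform *)

Section L2_limits.
Context {R : realType}.
Local Notation C := (Rcomplex R).
Local Notation mu := (@lebesgue_measure R).

Lemma n2_dominated (f : R -> C) (u : nat -> R -> C) (Z : set R) : L2 setT f ->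
  (forall n, measC (u n)) -> (forall n x, `|u n x| <= `|f x|) ->
  measurable Z -> mu Z = 0%E ->
  (forall x, ~ Z x -> u n x @[n --> \oo] --> (0 : C)) ->
  n2 (u n) @[n --> \oo] --> (0 : R).
Proof.
move=> Lf mu_ uf mZ Z0 u0.
pose v n x : C := \1_(~` Z) x *: u n x.
have mv n : measC (v n).
  by apply: measCZ => //; apply: measurable_indic; exact: measurableC.
have vf n x : `|v n x| <= `|f x|.
  by rewrite normrZ indicE; case: (x \in _); rewrite ?normr1 ?mul1r// normr0 mul0r.
have Lv n := (n2_le Lf (mv n) (vf n)).1.
have uv n : n2 (u n) = n2 (v n).
  have vu x : ~ Z x -> v n x = u n x.
    by move=> nZ; rewrite /v indicE mem_set// scale1r.
  by have [_ <-] := n2_ae (Lv n) (mu_ n) mZ Z0 vu.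
have v0 x : v n x @[n --> \oo] --> (0 : C).
  have [Zx|Zx] := pselect (Z x).
    rewrite (_ : (fun n => v n x) = (fun=> 0)); first exact: cvg_cst.
    by apply/funext => n; rewrite /v indicE memNset ?scale0r//; apply.
  rewrite (_ : (fun n => v n x) = (fun n => u n x)); first exact: u0.
  by apply/funext => n; rewrite /v indicE mem_set ?scale1r.
have [_ iF] := (L2_sqr_int f).1 Lf.
have H : (\int[mu]_x (`|v n x| ^+ 2)%:E)%E @[n --> \oo] --> (\int[mu]_x 0%:E)%E.
  apply: (@dominated_cvg _ _ _ mu setT measurableT (fun n x => (`|v n x| ^+ 2)%:E) _
    (fun x => (`|f x| ^+ 2)%:E)) => //.
  - by move=> n; apply/measurable_EFinP/measurable_funX; exact: measC_norm.
  - move=> x _; apply: cvg_EFin; first exact: nearW.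
    rewrite (_ : fine \o _ = (fun n => `|v n x| * `|v n x|)); last first.
      by apply/funext => n /=; rewrite expr2.
    have nv : `|v n x| @[n --> \oo] --> (0 : R) by rewrite -(normr0 C); exact: cvg_norm.
    by rewrite -(mulr0 (0 : R)); exact: cvgM.
  - by move=> n x _; rewrite lee_fin ger0_norm ?sqr_ge0// ler_pXn2r ?nnegrE.
rewrite integral0 in H.
have H2 : n2 (v n) ^+ 2 @[n --> \oo] --> (0 : R).
  rewrite (_ : (fun n => _) = fine \o (fun n => (\int[mu]_x (`|v n x| ^+ 2)%:E)%E)).
    exact: fine_cvg H.
  by apply/funext => n /=; rewrite (n2_sqr (Lv n)).
have H3 := cvg_comp _ _ H2 (@sqrt_continuous R 0); rewrite sqrtr0 in H3.
rewrite (_ : (fun n => _) = Num.sqrt \o (fun n => n2 (v n) ^+ 2))//.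
by apply/funext => n /=; rewrite sqrtr_sqr ger0_norm ?n2_ge0// uv.
Qed.

Definition trunc (n : nat) (f : R -> C) : R -> C :=
  fun x => \1_(`](- n%:R), n%:R[%classic) x *: f x.

Lemma trunc_L2 n f : L2 setT f -> L2 setT (trunc n f).
Proof.
move=> Lf; apply: (n2_le Lf _ _).1.
  by apply: measCZ; [exact: measurable_indic|exact: L2_meas].
move=> x; rewrite normrZ indicE; case: (x \in _); rewrite ?normr1 ?mul1r//.
by rewrite normr0 mul0r.
Qed.

Lemma trunc_cvg f : L2 setT f -> n2 (f - trunc n f) @[n --> \oo] --> (0 : R).
Proof.
move=> Lf; have E n x : (f - trunc n f) x = (1 - \1_(`](- n%:R), n%:R[%classic) x) *: f x.
  by rewrite !fctE /trunc scalerBl scale1r.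
apply: (@n2_dominated f _ set0) => //.
- by move=> n; apply: L2_meas; apply: L2B => //; exact: trunc_L2.
- move=> n x; rewrite E normrZ indicE; case: (x \in _); rewrite ?subrr ?subr0 ?normr1 ?normr0 ?mul1r// mul0r.
  by [].
- move=> x _; apply/cvgrPdist_le => e e0; near=> n.
  rewrite E indicE mem_set/= ?subrr ?scale0r ?subr0 ?normr0 ?ltW//.
  rewrite in_itv/= -ltr_norml; near: n; exact: nbhs_infty_gtr.
Unshelve. all: by end_near. Qed.

(** Lebesgue's differentiation theorem: all primitives vanish, hence so does the
    function almost everywhere. *)
Lemma ip_interval_test (b : R) (phi : R -> R) : intR phi ->
  (forall x, ~ `]0, b[%classic x -> phi x = 0) ->
  (forall x, 0 <= x <= b -> (\int[mu]_t (\1_(`]0, x[%classic) t * phi t) = 0)%R) ->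
  {ae mu, forall x, phi x = 0}.
Proof.
move=> ip0 supp H.
have [b0|b0] := ltP b 0.
  by apply: aeW => x; apply: supp; rewrite set_itv_ge ?bnd_simp -?leNgt ?ltW.
have intf y : mu.-integrable `]-oo, y] (EFin \o phi) by exact: integrableS ip0.
have locf : locally_integrable setT phi.
  by have := integrable_locally measurableT ip0; rewrite patch_setT.
have F0 x : (\int[mu]_(t in [set` `]-oo, x]]) phi t = 0)%R.
  rewrite -Rintegral_itv_bndo_bndc; last exact: integrableS ip0.
  pose x' := Num.min b (Num.max 0 x).
  have x'b : 0 <= x' <= b by rewrite /x' ge_min lexx/= le_min b0 le_max lexx.
  rewrite -(H x' x'b) Rintegral_mkcond; apply: eq_Rint => t.
  rewrite patchE indicE.
  have [tb|tb] := pselect (`]0, b[%classic t); last by rewrite supp// mulr0; case: ifP.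
  move: tb; rewrite !mem_setE /= !in_itv/= => /andP[t0 tb].
  rewrite t0 /x' lt_min tb lt_max (ltNge t 0) (ltW t0)/=.
  by case: ifP; rewrite ?mul1r ?mul0r.
have := FTC1Ny intf locf.
apply: filterS; first exact: (ae_filter_ringOfSetsType mu).
move=> x [_ <-].
rewrite (_ : (fun x => _) = cst 0); last by apply/funext => y; exact: F0.
by rewrite derive1E; exact: derive_cst.
Qed.

Lemma L2_interval_test (b : R) (f : R -> C) : 0 < b -> L2supp b f ->
  (forall x z, 0 <= x <= b -> ip f (fun t => cmul z (indC `]0, x[ t)) = 0) -> n2 f = 0.
Proof.
move=> b0 [Lf f0] H.
have [fr fi] := (L1_le_L2 (ltW b0) Lf f0).1.
have Hr : {ae mu, forall x, complex.Re (f x) = 0}.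
  apply: (@ip_interval_test b _ fr).
    by move=> x /f0 ->.
  move=> x xb; rewrite -[RHS](H x (Complex 1 0) xb); apply: eq_Rint => t.
  by rewrite cmul1 indCE /rip /= mulr0 addr0 mulrC.
have Hi : {ae mu, forall x, complex.Im (f x) = 0}.
  apply: (@ip_interval_test b _ fi).
    by move=> x /f0 ->.
  move=> x xb; rewrite -[RHS](H x (Complex 0 1) xb); apply: eq_Rint => t.
  by rewrite indCE /rip /=; ring.
case: Hr => Z1 [mZ1 Z10 sub1]; case: Hi => Z2 [mZ2 Z20 sub2].
have mZ : measurable (Z1 `|` Z2) by exact: measurableU.
have Z0 : mu (Z1 `|` Z2) = 0%E by rewrite measureU0.
have f00 x : ~ (Z1 `|` Z2) x -> (0 : R -> C) x = f x.
  move=> nZ; apply: complex_ext => /=.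
    by apply: esym; apply: contrapT => fx; apply: nZ; left; exact: sub1.
  by apply: esym; apply: contrapT => fx; apply: nZ; right; exact: sub2.
have [_ <-] := n2_ae (L2_0 R) (L2_meas Lf) mZ Z0 f00.
exact: n2_0.
Qed.

End L2_limits.

Section adjoint.
Context {R : realType} (th b : R).
Local Notation C := (Rcomplex R).
Local Notation mu := (@lebesgue_measure R).
Local Notation Ft := (wave_transform th).
Hypothesis b0 : 0 < b.

(** The adjoint of the transform, given by an integral when [g] is integrable. *)
Definition adj (g : R -> C) : R -> C := fun tau =>
  \1_(`]0, b[%classic) tau *: Cint (fun om => cmul (g om) (expi (om * (tau - th)))).

Let meas_e tau : measC (fun om : R => expi (om * (tau - th)) : C).
Proof.
apply: continuous_measC => x; apply: cvg_expi; apply: cvgMl; exact: cvg_id.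
Qed.

Let ie g tau : intC g -> intC (fun om => cmul (g om) (expi (om * (tau - th)))).
Proof.
move=> ig; apply: (@intC_le _ _ (fun om => `|g om|)); last exact: intC_norm.
  by apply: measCM; [exact: intC_meas|exact: meas_e].
by move=> x; rewrite cmul_norm norm_expi mulr1.
Qed.

Lemma adj_supp g : intC g -> L2supp b (adj g).
Proof.
move=> ig; split; last by move=> x nx; rewrite /adj indicE memNset ?scale0r.
have ci : continuous (fun tau => Cint (fun om => cmul (g om) (expi (om * (tau - th))))).
  apply: (@continuous_Cint _ _ (fun om => `|g om|)).
  - by move=> tau; apply: intC_meas; exact: ie.
  - exact: intC_norm.
  - by move=> tau om; rewrite cmul_norm norm_expi mulr1.
  - move=> om tau; apply: cvg_cmul; first exact: cvg_cst.
    apply: cvg_expi; apply: cvgMr; apply: cvgB; [exact: cvg_id|exact: cvg_cst].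
pose M := (\int[mu]_x `|g x|)%R.
have [Li _] := L2_ind_itv (ltW b0).
apply: (n2_le (L2Z M Li) _ _).1.
  by apply: measCZ; [exact: measurable_indic|exact: continuous_measC].
move=> x; rewrite !fctE !normrZ indC_norm.
have M0 : 0 <= M by exact: Rint_ge0.
rewrite (ger0_norm M0) indicE ger0_norm ?ler0n// mulrC; apply: ler_wpM2r; first exact: ler0n.
apply: le_trans (norm_Cint (ie x ig)) _.
by rewrite le_eqVlt; apply/orP; left; apply/eqP/eq_Rint => om; rewrite cmul_norm norm_expi mulr1.
Qed.

(** Fubini's theorem; integrability of [g] makes the double integral absolutely
    convergent. *)
Lemma adjP g w : intC g -> L2supp b w -> ip g (Ft w) = ip (adj g) w.
Proof.
move=> ig Lw.
have iw := (L1_le_L2 (ltW b0) Lw.1 Lw.2).1.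
pose H (p : R * R) : R := rip (g p.1) (cmul (w p.2) (wave th p.1 p.2)).
have mcomp1 (k : R -> R) : measurable_fun setT k -> measurable_fun setT (fun p : R * R => k p.1).
  by move=> mk; exact: measurableT_comp mk measurable_fst.
have mcomp2 (k : R -> R) : measurable_fun setT k -> measurable_fun setT (fun p : R * R => k p.2).
  by move=> mk; exact: measurableT_comp mk measurable_snd.
have mph : measurable_fun setT (fun p : R * R => p.1 * (th - p.2)).
  apply: measurable_funM; first exact: measurable_fst.
  by apply: measurable_funB => //; exact: measurable_snd.
have mcos : measurable_fun setT (fun p : R * R => cos (p.1 * (th - p.2))).
  apply: measurableT_comp mph; exact: continuous_measurable_fun (@continuous_cos R).
have msin : measurable_fun setT (fun p : R * R => sin (p.1 * (th - p.2))).
  apply: measurableT_comp mph; exact: continuous_measurable_fun (@continuous_sin R).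
have [mgr mgi] := intC_meas ig; have [mwr mwi] := intC_meas iw.
have mH : measurable_fun setT H.
  rewrite /H /rip /=; apply: measurable_funD; apply: measurable_funM.
  - exact: (mcomp1 _ mgr).
  - apply: measurable_funB; apply: measurable_funM => //.
      exact: (mcomp2 _ mwr).
    exact: (mcomp2 _ mwi).
  - exact: (mcomp1 _ mgi).
  - apply: measurable_funD; apply: measurable_funM => //.
      exact: (mcomp2 _ mwr).
    exact: (mcomp2 _ mwi).
have HE om tau : `|H (om, tau)| <= `|g om| * `|w tau|.
  by rewrite (le_trans (rip_le _ _))//= cmul_norm wave_norm mulr1.
have mng := measC_norm (intC_meas ig); have mnw := measC_norm (intC_meas iw).
have iG : (mu \x mu)%E.-integrable setT (fun p : R * R => (`|g p.1| * `|w p.2|)%:E).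
  have mG : measurable_fun setT (fun p : R * R => (`|g p.1| * `|w p.2|)%:E).
    apply/measurable_EFinP; apply: measurable_funM; [exact: (mcomp1 _ mng)|exact: (mcomp2 _ mnw)].
  apply/(integrable12ltyP mu mu mG) => /=.
  have W0 : (0 <= \int[mu]_y (`|w y|)%:E)%E by rewrite integral_ge0.
  have Wf : (\int[mu]_y (`|w y|)%:E)%E \is a fin_num by exact: integrable_fin_num (intC_norm iw).
  under eq_integral => x _.
    under eq_integral => y _ do rewrite ger0_norm ?mulr_ge0// EFinM.
    rewrite ge0_integralZl//; last exact/measurable_EFinP.
    rewrite -(fineK Wf) muleC; over.
  rewrite /= ge0_integralZl//; [|exact/measurable_EFinP|exact: fine_ge0].
  have Gf : (\int[mu]_y (`|g y|)%:E)%E \is a fin_num by exact: integrable_fin_num (intC_norm ig).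
  by rewrite -(fineK Gf) -EFinM ltry.
have iH : (mu \x mu)%E.-integrable setT (EFin \o H).
  apply: le_integrable iG => //; first exact/measurable_EFinP.
  move=> [om tau] _ /=; rewrite lee_fin (le_trans (HE _ _))//.
  by rewrite ger0_norm// mulr_ge0.
have FF := Fubini iH; rewrite /= in FF.
have iwv om := intC_cmul_wave th om iw.
have E1 om : (\int[mu]_tau (H (om, tau))%:E)%E = (rip (g om) (Ft w om))%:E.
  rewrite ripC (rip_Cint (g om) (iwv om)) /Rintegral fineK; last first.
    exact: integrable_fin_num (intR_rip (g om) (iwv om)).
  by apply: eq_integral => tau _; rewrite ripC.
have E2 tau : (\int[mu]_om (H (om, tau))%:E)%E = (rip (adj g tau) (w tau))%:E.
  have [tb|tb] := pselect (`]0, b[%classic tau); last first.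
    rewrite (Lw.2 tau tb) {1}/rip /= !mulr0 addr0.
    under eq_integral => om _ do rewrite /H (Lw.2 tau tb) /rip /= !mul0r subrr addr0 !mulr0 addr0.
    exact: integral0.
  rewrite /adj indicE mem_set// scale1r (rip_Cint (w tau) (ie tau ig)) /Rintegral fineK; last first.
    exact: integrable_fin_num (intR_rip (w tau) (ie tau ig)).
  apply: eq_integral => om _; congr EFin; rewrite /H /rip /=.
  have -> : om * (tau - th) = - (om * (th - tau)) by ring.
  by rewrite cosN sinN; ring.
rewrite /ip /Rintegral; congr fine.
under eq_integral => om _ do rewrite -E1.
by rewrite FF; apply: eq_integral => tau _; rewrite E2.
Qed.

End adjoint.

(** * The left inverse of the transform and Plancherel's formula *)

Section left_inverse.
Context {R : realType} (th b : R).
Local Notation C := (Rcomplex R).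
Local Notation mu := (@lebesgue_measure R).
Local Notation Ft := (wave_transform th).
Local Notation adj := (adj th b).
Local Notation planch := (planch th).
Hypothesis b0 : 0 < b.

Lemma L2supp_intC w : L2supp b w -> intC w.
Proof. by move=> [Lw w0]; exact: (L1_le_L2 (ltW b0) Lw w0).1. Qed.

Lemma L2suppD v w : L2supp b v -> L2supp b w -> L2supp b (v + w).
Proof.
move=> [Lv v0] [Lw w0]; split; first exact: L2D.
by move=> x nx; rewrite fctE v0// w0// addr0.
Qed.

Lemma L2suppZ (a : R) w : L2supp b w -> L2supp b (a *: w).
Proof.
move=> [Lw w0]; split; first exact: L2Z.
by move=> x nx; rewrite fctE w0// scaler0.
Qed.

Lemma L2suppB v w : L2supp b v -> L2supp b w -> L2supp b (v - w).
Proof. by move=> Lv Lw; rewrite -scaleN1r; apply: L2suppD => //; exact: L2suppZ. Qed.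

Lemma Ft_norm2 w : L2supp b w -> n2 (Ft w) <= Num.sqrt planch * n2 w.
Proof.
move=> Lw; have [L1 H] := Ft_bound th b0 Lw; move: H.
have p0 := ltW (planch_gt0 th).
rewrite -[X in X * _ ^+ 2](sqr_sqrtr p0) -exprMn ler_pXn2r// nnegrE.
  exact: n2_ge0.
by rewrite mulr_ge0 ?n2_ge0.
Qed.

(** The adjoint is bounded by the same constant as the transform: test it against
    itself. *)
Lemma n2_adj g : L2 setT g -> intC g -> n2 (adj g) <= Num.sqrt planch * n2 g.
Proof.
move=> Lg ig; have La := adj_supp th b0 ig.
have LF := (Ft_bound th b0 La).1.
have H : n2 (adj g) * n2 (adj g) <= (Num.sqrt planch * n2 g) * n2 (adj g).
  rewrite -expr2 -(ip_sqr La.1) -(adjP th b0 ig La).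
  apply: le_trans (ler_norm _) _; apply: le_trans (ip_le Lg LF) _.
  rewrite [Num.sqrt _ * _]mulrC -mulrA; apply: ler_wpM2l; first exact: n2_ge0.
  exact: Ft_norm2.
have [a0|a0] := eqVneq (n2 (adj g)) 0.
  by rewrite a0 mulr_ge0 ?n2_ge0.
by move: H; rewrite ler_pM2r// lt_neqAle eq_sym a0 n2_ge0.
Qed.

Lemma geometric_eq0 (x M : R) : (forall n, `|x| <= M * 2^-1 ^+ n) -> x = 0.
Proof.
move=> H; apply/eqP; rewrite -normr_le0.
have c1 : `|2^-1 : R| < 1 by rewrite ger0_norm// invf_lt1// ltr1n.
have l0 : M * 2^-1 ^+ n @[n --> \oo] --> (0 : R).
  by rewrite -(mulr0 M); apply: cvgMr; exact: cvg_expr.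
rewrite -(cvg_lim _ l0)//; apply: limr_ge; first by apply/cvg_ex; exists 0.
exact: nearW.
Qed.

Lemma adjB g g' : intC g -> intC g' -> adj (g - g') = adj g - adj g'.
Proof.
move=> ig ig'; apply/funext => tau; rewrite !fctE /adj -scalerBr; congr (_ *: _).
have ie f : intC f -> intC (fun om => cmul (f om) (expi (om * (tau - th)))).
  move=> fi; apply: (@intC_le _ _ (fun om => `|f om|)); last exact: intC_norm.
    apply: measCM; first exact: intC_meas.
    by apply: continuous_measC => x; apply: cvg_expi; apply: cvgMl; exact: cvg_id.
  by move=> x; rewrite cmul_norm norm_expi mulr1.
rewrite -scaleN1r -CintZ; last exact: ie.
rewrite -CintD; [|exact: ie|apply: intCZ; exact: ie].
apply: eq_Cint => om; rewrite -cmulZl scaleN1r; exact: cmulDl.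
Qed.

(** [s] is the left inverse of the transform at [f], in weak form: up to Plancherel's
    constant, the adjoint applied to [f]. *)
Definition left_inverse_at (f s : R -> C) := L2supp b s /\
  forall w, L2supp b w -> planch * ip s w = ip f (Ft w).

(** The adjoint is defined on truncations of [f] and extends by completeness. *)
Lemma left_inverse_exists f : L2 setT f -> exists s, left_inverse_at f s.
Proof.
move=> Lf; have := trunc_cvg Lf => /cvgrPdist_le H.
have /choice[m Hm] n : exists m, n2 (f - trunc m f) <= 2^-1 ^+ n.
  have /H[N _ /(_ N (leqnn N))] : 0 < (2^-1 : R) ^+ n by rewrite exprn_gt0.
  by rewrite sub0r normrN ger0_norm ?n2_ge0// => h; exists N.
pose g n := trunc (m n) f.
have Lg n : L2 setT (g n) by exact: trunc_L2.
have ig n : intC (g n).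
  apply: (@L1_le_L2 _ (- (m n)%:R) (m n)%:R _ _ (Lg n) _).1.
    by rewrite ge0_cp// ?oppr_le0.
  by move=> x nx; rewrite /g /trunc indicE memNset ?scale0r.
pose P := Num.sqrt planch.
have P0 : 0 <= P by exact: sqrtr_ge0.
pose w n := adj (g n).
have Lw n : L2supp b (w n) by exact: adj_supp.
have half01 : 0 <= (2^-1 : R) < 1 by rewrite invr_ge0 ler0n/= invf_lt1// ltr1n.
have wS n : n2 (w n.+1 - w n) <= (2 * P) * 2^-1 ^+ n.
  have igg : intC (g n.+1 - g n).
    by rewrite -scaleN1r; apply: intCD => //; exact: intCZ.
  rewrite /w -adjB//; apply: le_trans (n2_adj (L2B (Lg _) (Lg _)) igg) _.
  rewrite -/P [2 * P]mulrC -mulrA; apply: ler_wpM2l => //.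
  have -> : g n.+1 - g n = (f - g n) - (f - g n.+1).
    by rewrite opprB [RHS]addrC addrA subrK.
  apply: le_trans (n2B (L2B Lf (Lg _)) (L2B Lf (Lg _))) _.
  have h1 := Hm n; have h2 := Hm n.+1; rewrite -/(g n) in h1; rewrite -/(g n.+1) in h2.
  apply: le_trans (lerD h1 h2) _.
  rewrite exprS mulrDl mul1r lerD2l ler_piMl ?exprn_ge0//.
  by case/andP: half01 => _ /ltW.
have [l [Ll l0 lw]] := L2_complete (ltW b0) half01 (fun n => (Lw n).1) (fun n => (Lw n).2) wS.
exists (planch^-1 *: l); split; first by apply: L2suppZ.
move=> v Lv; have LF := (Ft_bound th b0 Lv).1.
rewrite ipZl//; last exact: Lv.1.
rewrite mulrA mulfV ?mul1r; last by rewrite gt_eqF// planch_gt0.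
apply/eqP; rewrite -subr_eq0; apply/eqP.
apply: (@geometric_eq0 _ (2 * P / (1 - 2^-1) * n2 v + n2 (Ft v))) => n.
have -> : ip l v - ip f (Ft v) = ip (l - w n) v - ip (f - g n) (Ft v).
  rewrite (ipBl Ll (Lw n).1 Lv.1) (ipBl Lf (Lg n) LF) (adjP th b0 (ig n) Lv) /w.
  by rewrite opprB addrA subrK.
apply: le_trans (ler_normB _ _) _; rewrite mulrDl; apply: lerD.
  apply: le_trans (ip_le (L2B Ll (Lw n).1) Lv.1) _.
  by rewrite mulrAC; apply: ler_wpM2r; [exact: n2_ge0|exact: lw].
apply: le_trans (ip_le (L2B Lf (Lg n)) LF) _.
by rewrite mulrC; apply: ler_wpM2l; [exact: n2_ge0|exact: Hm].
Qed.

Lemma left_inverse_bound f s : L2 setT f -> left_inverse_at f s ->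
  n2 s <= n2 f / Num.sqrt planch.
Proof.
move=> Lf [Ls H]; have p0 := planch_gt0 th; have LF := (Ft_bound th b0 Ls).1.
have P0 : 0 < Num.sqrt planch by rewrite sqrtr_gt0.
have K : planch * (n2 s * n2 s) <= n2 f * (Num.sqrt planch * n2 s).
  rewrite -expr2 -(ip_sqr Ls.1) H//.
  apply: le_trans (ler_norm _) _; apply: le_trans (ip_le Lf LF) _.
  by apply: ler_wpM2l; [exact: n2_ge0|exact: Ft_norm2].
have [s0|s0] := eqVneq (n2 s) 0; first by rewrite s0 divr_ge0 ?n2_ge0// ltW.
have s1 : 0 < n2 s by rewrite lt_neqAle eq_sym s0 n2_ge0.
rewrite ler_pdivlMr//.
have E : planch = Num.sqrt planch * Num.sqrt planch by rewrite -expr2 sqr_sqrtr ?ltW.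
move: K; rewrite {1}E !mulrA ler_pM2r// [n2 f * _]mulrC -!mulrA ler_pM2l// mulrC.
by [].
Qed.

Lemma left_inverse_test f s s' : L2supp b s' -> left_inverse_at f s ->
  (forall w, L2supp b w -> planch * ip s' w = ip f (Ft w)) -> n2 (s - s') = 0.
Proof.
move=> Ls' [Ls H] H'; have L := L2suppB Ls Ls'.
suff /eqP : n2 (s - s') ^+ 2 = 0 by rewrite expf_eq0 /= => /eqP.
rewrite -(ip_sqr L.1) (ipBl Ls.1 Ls'.1 L.1).
have p0 := planch_gt0 th.
have /(mulfI (lt0r_neq0 p0)) -> : planch * ip s (s - s') = planch * ip s' (s - s').
  by rewrite H// H'.
by rewrite subrr.
Qed.

Let cind (x : R) z : 0 <= x <= b -> L2supp b (fun t => cmul z (indC `]0, x[ t)).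
Proof.
move=> /andP[x0 xb]; split; first exact: (L2_cmul z (L2_ind_itv x0).1).1.
move=> t nt; rewrite indC_off; first by apply: complex_ext => /=; rewrite !mulr0 ?subrr ?addr0.
move: nt; rewrite /= !in_itv/= => nt /andP[t0 tx]; apply: nt.
by rewrite t0 (lt_le_trans tx).
Qed.

Let plancherel_steps (x y : R) (z z' : C) : 0 <= x <= b -> 0 <= y <= b ->
  ip (Ft (fun t => cmul z (indC `]0, x[ t))) (Ft (fun t => cmul z' (indC `]0, y[ t))) =
  planch * ip (fun t => cmul z (indC `]0, x[ t)) (fun t => cmul z' (indC `]0, y[ t)).
Proof.
move=> /andP[x0 xb] /andP[y0 yb].
have E (u : R) (v : C) : 0 <= u -> Ft (fun t => cmul v (indC `]0, u[ t)) =
    (fun om => cmul v (Ft (indC `]0, u[) om)).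
  by move=> u0; apply/funext => om; rewrite FtM//; exact: intC_ind.
rewrite !E// ip_cmul_h// ip_h_ind// ip_cmul_ind//; first by rewrite mulrCA.
  exact: (L2_ind_itv x0).1.
exact: (L2_ind_itv y0).1.
Qed.

Lemma ip_null (f g : R -> C) : L2 setT f -> L2 setT g -> n2 f = 0 -> ip f g = 0.
Proof.
move=> Lf Lg f0; apply/eqP; rewrite -normr_le0.
by apply: le_trans (ip_le Lf Lg) _; rewrite f0 mul0r.
Qed.

Let left_inverse_of_steps v s : L2supp b v -> left_inverse_at (Ft v) s ->
  (forall (x : R) (z : C), 0 <= x <= b -> ip (Ft v) (Ft (fun t => cmul z (indC `]0, x[ t))) =
    planch * ip v (fun t => cmul z (indC `]0, x[ t))) -> n2 (s - v) = 0.
Proof.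
move=> Lv [Ls Hs] H; apply: (L2_interval_test b0); first exact: L2suppB.
move=> x z xb; have Lc := cind z xb.
rewrite (ipBl Ls.1 Lv.1 Lc.1).
have /(mulfI (lt0r_neq0 (planch_gt0 th))) -> :
  planch * ip s (fun t => cmul z (indC `]0, x[ t)) =
  planch * ip v (fun t => cmul z (indC `]0, x[ t)) by rewrite Hs// H.
by rewrite subrr.
Qed.

Let plancherel_of_null (v s w : R -> C) : L2supp b v -> L2supp b w -> left_inverse_at (Ft v) s ->
  n2 (s - v) = 0 -> ip (Ft v) (Ft w) = planch * ip v w.
Proof.
move=> Lv Lw [Ls Hs] sv; rewrite -Hs//; congr (_ * _).
apply/eqP; rewrite -subr_eq0 -(ipBl Ls.1 Lv.1 Lw.1); apply/eqP.
by apply: ip_null => //; [apply: L2B; [exact: Ls.1|exact: Lv.1]|exact: Lw.1].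
Qed.

(** By polarity: the formula holds for indicators, which are enough to identify
    the left inverse of the transform of an indicator; this gives the formula with one
    indicator, and the same step once more gives the general case. *)
Theorem plancherel v w : L2supp b v -> L2supp b w ->
  ip (Ft v) (Ft w) = planch * ip v w.
Proof.
move=> Lv Lw; have [s Hs] := left_inverse_exists (Ft_bound th b0 Lv).1.
apply: (plancherel_of_null Lv Lw Hs); apply: (left_inverse_of_steps Lv Hs) => x z xb.
have Lc := cind z xb; have [s' Hs'] := left_inverse_exists (Ft_bound th b0 Lc).1.
rewrite ipC [ip v _]ipC; apply: (plancherel_of_null Lc Lv Hs').
by apply: (left_inverse_of_steps Lc Hs') => y z' yb; exact: plancherel_steps.
Qed.

End left_inverse.

(** * Bilinear pairings of the two components *)

(** Uniform continuity on a segment, from compactness; the second point may leave the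
    segment. *)
Lemma uniformly_continuous_itv {R : realType} {V : normedModType R} (f : R -> V) (a b e : R) :
  continuous f -> 0 < e -> exists2 d, 0 < d &
    forall t s, `[a, b]%classic t -> `|s - t| < d -> `|f s - f t| <= e.
Proof.
move=> cf e0.
have /compact_near_coveringP H := @segment_compact R a b.
have FF : Filter ((0 : R)^'+) by typeclasses eauto.
have := H R ((0 : R)^'+) (fun d t => forall s, `|s - t| < d -> `|f s - f t| <= e) FF.
case.
  move=> t _; have e2 : 0 < e / 2 by rewrite divr_gt0.
  have /cvgrPdist_le/(_ _ e2)/nbhs_ballP[d /= d0 Hd] := cf t.
  have d2 : 0 < d / 2 by rewrite divr_gt0.
  near=> t' d' => s st.
  have t't : `|t - t'| < d / 2 by near: t'; exact: nbhsx_ballx.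
  have dd : d' < d / 2.
    by near: d'; exact: nbhs_right_lt.
  have -> : f s - f t' = (f t - f t') - (f t - f s).
    by rewrite opprB [RHS]addrC addrA subrK.
  rewrite [leRHS]splitr; apply: le_trans (ler_normB _ _) _; apply: lerD; apply: Hd.
    by rewrite -ball_normE/= (lt_trans t't)// gtr_pMr// invf_lt1// ltr1n.
  rewrite -ball_normE/= [ltRHS]splitr.
  have -> : t - s = (t - t') - (s - t') by ring.
  apply: le_lt_trans (ler_normB _ _) _; apply: ltrD => //; exact: lt_trans dd.
move=> d /= d0 Hd; exists (d / 2); first exact: divr_gt0.
move=> t s tab st; apply: (Hd (d / 2)) => //=; rewrite ?divr_gt0//.
rewrite sub0r normrN gtr0_norm ?divr_gt0// gtr_pMr// invf_lt1// ltr1n//.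
Unshelve. all: by end_near. Qed.

Section pairings.
Context {R : realType}.
Local Notation C := (Rcomplex R).

(** The right-hand sides of both equations of the linear system solved by
    the states: a complex product for the first component, and minus the real part
    of a Hermitian product for the second one. *)
Definition pairing (c : bool) (z y : C) : C :=
  if c then cmul z y else Complex (- rip z y) 0.

Lemma pairing_norm c z y : `|pairing c z y| <= `|z| * `|y|.
Proof.
case: c; first by rewrite /= cmul_norm.
rewrite /= Rcomplex_normE /= [0 ^+ 2]expr0n addr0 sqrtr_sqr normrN; exact: rip_le.
Qed.

Lemma pairingDl c z z' y : pairing c (z + z') y = pairing c z y + pairing c z' y.
Proof.
case: c; first exact: cmulDl.
by apply: complex_ext; rewrite /= ?ripDl ?opprD ?addr0.
Qed.

Lemma pairingDr c z y y' : pairing c z (y + y') = pairing c z y + pairing c z y'.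
Proof.
case: c; first exact: cmulDr.
by apply: complex_ext; rewrite /= ?[rip z _]ripC ?ripDl ?opprD ?addr0.
Qed.

Lemma pairingZl c (a : R) z y : pairing c (a *: z) y = a *: pairing c z y.
Proof.
case: c; first exact: cmulZl.
by apply: complex_ext; rewrite /= ?ripZl ?mulrN ?mulr0.
Qed.

Lemma pairingZr c (a : R) z y : pairing c z (a *: y) = a *: pairing c z y.
Proof.
case: c; first exact: cmulZr.
by apply: complex_ext; rewrite /= ?[rip z _]ripC ?ripZl ?mulrN ?mulr0.
Qed.

Lemma measC_pairing c f g : measC f -> measC g -> measC (fun x => pairing c (f x) (g x)).
Proof.
move=> mf mg; case: c; first exact: measCM.
split => /=; last exact: measurable_cst.
by apply: measurableT_comp => //; exact: rip_meas.
Qed.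

Lemma cvg_ReIm {T : Type} {F : set_system T} {FF : Filter F} (f : T -> C) (a : C) :
  f @ F --> a -> complex.Re (f x) @[x --> F] --> complex.Re a /\
    complex.Im (f x) @[x --> F] --> complex.Im a.
Proof.
move=> /cvgrPdist_le H; split; apply/cvgrPdist_le => e /H; apply: filterS => x; apply: le_trans.
  by rewrite -ReB; exact: Re_le_norm.
by rewrite -ImB; exact: Im_le_norm.
Qed.

Lemma cvg_pairing {T : Type} {F : set_system T} {FF : Filter F} c (f g : T -> C) (a b : C) :
  f @ F --> a -> g @ F --> b -> pairing c (f x) (g x) @[x --> F] --> pairing c a b.
Proof.
move=> fa gb; case: c; first exact: cvg_cmul.
have [fr fi] := cvg_ReIm fa; have [gr gi] := cvg_ReIm gb.
apply: cvg_complex => /=; last exact: cvg_cst.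
by apply: cvgN; apply: cvgD; apply: cvgM.
Qed.

Lemma Cint_pairing c f y : intC f -> Cint (fun x => pairing c (f x) y) = pairing c (Cint f) y.
Proof.
move=> fi; case: c.
  rewrite /pairing [RHS]cmulC -CintM//; apply: eq_Cint => x; exact: cmulC.
apply: complex_ext => /=; last exact: Rint_cst0.
rewrite rip_Cint// -mulN1r -RintZ; last exact: intR_rip.
by apply: eq_Rint => x; rewrite mulN1r.
Qed.

End pairings.

Lemma pairing_trueE {R : realType} (z y : Rcomplex R) : pairing true z y = cmul z y.
Proof. by []. Qed.

Lemma pairing_falseE {R : realType} (z y : Rcomplex R) :
  pairing false z y = Complex (- rip z y) 0.
Proof. by []. Qed.

(** * Superposition of states against a control *)

#[local] Opaque pairing.

Section finite_sums.
Context {R : realType}.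
Local Notation C := (Rcomplex R).
Local Notation mu := (@lebesgue_measure R).

Lemma intC_sum (F : nat -> R -> C) n : (forall j, intC (F j)) ->
  intC (fun x => \sum_(0 <= j < n) F j x) /\
  Cint (fun x => \sum_(0 <= j < n) F j x) = \sum_(0 <= j < n) Cint (F j).
Proof.
move=> iF; elim: n => [|n [I1 I2]].
  rewrite big_geq//; have E : (fun x => \sum_(0 <= j < 0) F j x) = (fun=> 0).
    by apply/funext => x; rewrite big_geq.
  rewrite E; split; first by split; exact: integrable0.
  by apply: complex_ext => /=; exact: Rint_cst0.
have E : (fun x => \sum_(0 <= j < n.+1) F j x) =
    (fun x => \sum_(0 <= j < n) F j x + F n x).
  by apply/funext => x; rewrite big_nat_recr.
rewrite E; split; first exact: intCD.
by rewrite CintD// I2 big_nat_recr.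
Qed.

Lemma n2_sum (F : nat -> R -> C) (M : nat -> R) n :
  (forall j, L2 setT (F j)) -> (forall j, n2 (F j) <= M j) ->
  L2 setT (fun x => \sum_(0 <= j < n) F j x) /\
  n2 (fun x => \sum_(0 <= j < n) F j x) <= \sum_(0 <= j < n) M j.
Proof.
move=> LF FM; elim: n => [|n [I1 I2]].
  rewrite big_geq//; have E : (fun x => \sum_(0 <= j < 0) F j x) = (0 : R -> C).
    by apply/funext => x; rewrite big_geq.
  by rewrite E; split; [exact: L2_0|rewrite n2_0].
have E : (fun x => \sum_(0 <= j < n.+1) F j x) =
    (fun x => \sum_(0 <= j < n) F j x) + F n.
  by apply/funext => x; rewrite big_nat_recr.
rewrite E; split; first exact: L2D.
rewrite [leRHS]big_nat_recr//=.
by apply: le_trans (n2D I1 (LF n)) _; apply: lerD.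
Qed.

Lemma Rint_sum (F : nat -> R -> R) n : (forall j, intR (F j)) ->
  intR (fun x => \sum_(0 <= j < n) F j x) /\
  (\int[mu]_x (\sum_(0 <= j < n) F j x) = \sum_(0 <= j < n) \int[mu]_x F j x)%R.
Proof.
move=> iF; elim: n => [|n [I1 I2]].
  rewrite big_geq//; have E : (fun x => \sum_(0 <= j < 0) F j x) = (fun=> 0).
    by apply/funext => x; rewrite big_geq.
  by rewrite E; split; [exact: integrable0|exact: Rint_cst0].
have E : (fun x => \sum_(0 <= j < n.+1) F j x) =
    (fun x => \sum_(0 <= j < n) F j x + F n x).
  by apply/funext => x; rewrite big_nat_recr.
rewrite E; split; first exact: intRD.
by rewrite RintD// I2 [RHS]big_nat_recr.
Qed.

End finite_sums.

Section superposition.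
Context {R : realType} (th b : R).
Local Notation C := (Rcomplex R).
Local Notation mu := (@lebesgue_measure R).
Local Notation Ft := (wave_transform th).
Hypothesis b0 : 0 < b.

Definition path : set (R -> L2Cb R) := [set f |
  continuous f /\ exists B, forall t, `|f t| <= B].

Definition superpose (c : bool) (w : R -> C) (f : R -> L2Cb R) : R -> C := fun om =>
  Cint (fun tau => pairing c (cmul (w tau) (wave th om tau)) (f tau om)).

Lemma superposeE c w f om : superpose c w f om =
  Cint (fun tau => pairing c (cmul (w tau) (wave th om tau)) (f tau om)).
Proof. by []. Qed.

Lemma path_cvg f om t : path f -> f s om @[s --> t] --> f t om.
Proof.
move=> [cf _]; apply/cvgrPdist_le => e e0; have /cvgrPdist_le/(_ e e0) := cf t.
by apply: filterS => s; apply: le_trans; exact: (L2Cb_ler_norm (f t - f s) om).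
Qed.

Lemma superpose_int c w f om : L2supp b w -> path f ->
  intC (fun tau => pairing c (cmul (w tau) (wave th om tau)) (f tau om)).
Proof.
move=> Lw pf; have iw := L2supp_intC b0 Lw; have [_ [B fB]] := pf.
apply: (@intC_le _ _ (fun tau => B * `|w tau|)).
- apply: measC_pairing; last by apply: continuous_measC => t; exact: path_cvg.
  by apply: intC_meas; exact: intC_cmul_wave.
- move=> tau; rewrite (le_trans (pairing_norm _ _ _))// cmul_norm wave_norm mulr1 mulrC.
  by apply: ler_wpM2r => //; apply: le_trans (fB tau); exact: L2Cb_ler_norm.
- by apply: intRZ; exact: intC_norm.
Qed.

Lemma superpose_norm c w f M om : L2supp b w -> path f ->
  (forall t, `|f t om| <= M) -> `|superpose c w f om| <= M * (\int[mu]_x `|w x|)%R.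
Proof.
move=> Lw pf fM; have iw := L2supp_intC b0 Lw; have ii := superpose_int c om Lw pf.
apply: le_trans (norm_Cint ii) _; rewrite -RintZ; last exact: intC_norm.
apply: le_Rint; [exact: intC_norm|by apply: intRZ; exact: intC_norm|].
move=> tau; rewrite (le_trans (pairing_norm _ _ _))// cmul_norm wave_norm mulr1 mulrC.
exact: ler_wpM2r.
Qed.

Lemma superpose_continuous c w f : L2supp b w -> path f -> continuous (superpose c w f).
Proof.
move=> Lw pf; have iw := L2supp_intC b0 Lw; have [_ [B fB]] := pf.
apply: (@continuous_Cint _ _ (fun tau => B * `|w tau|)).
- by move=> om; apply: intC_meas; exact: superpose_int.
- by apply: intRZ; exact: intC_norm.
- move=> om tau; rewrite (le_trans (pairing_norm _ _ _))// cmul_norm wave_norm mulr1 mulrC.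
  by apply: ler_wpM2r => //; apply: le_trans (fB tau); exact: L2Cb_ler_norm.
- move=> tau om; apply: cvg_pairing.
    by apply: cvg_cmul; [exact: cvg_cst|exact: continuous_wave].
  by have [_ + _] := L2CbP (f tau); exact.
Qed.

Section riemann_sums.
Variables (c : bool) (w : R -> C) (f : R -> L2Cb R) (N : nat).
Hypothesis Lw : L2supp b w.
Hypothesis pf : path f.
Let d := b / N.+1%:R.
Let t (j : nat) := j%:R * d.
Let piece j : R -> C := fun x => \1_(`[t j, t j.+1[%classic) x *: w x.

Let d0 : 0 < d. Proof. exact: divr_gt0. Qed.
Let tS j : t j.+1 = t j + d. Proof. by rewrite /t -addn1 natrD mulrDl mul1r. Qed.

Let ind_sum n x : \sum_(0 <= j < n) \1_(`[t j, t j.+1[%classic) x = \1_(`[0, t n[%classic) x :> R.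
Proof.
elim: n => [|n IH]; first by rewrite big_geq// /t mul0r set_itvco0 indic0.
rewrite big_nat_recr//= IH !indicE !mem_setE /= !in_itv/=.
have tn0 : 0 <= t n by rewrite mulr_ge0// ltW.
have := tS n; move: tn0 d0; clear; move: (t n) (t n.+1) => u v u0 dd E.
case: (lerP 0 x) => x0; case: (ltrP x u) => xu; case: (ltrP x v) => xv //=;
  rewrite ?addr0 ?add0r//; exfalso; lra.
Qed.

Let off x : ~ `[0, t N.+1[%classic x -> w x = 0.
Proof.
have -> : t N.+1 = b by rewrite /t /d mulrC divfK.
move=> nx; apply: Lw.2; apply: contra_not nx; rewrite /= !in_itv/=.
by move=> /andP[/ltW -> ->].
Qed.

Let piece_sum x : \sum_(0 <= j < N.+1) piece j x = w x.
Proof.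
rewrite /piece -scaler_suml ind_sum indicE.
have [xi|xi] := pselect (`[0, t N.+1[%classic x); first by rewrite mem_set// scale1r.
by rewrite (off xi) scaler0.
Qed.

Let norm_piece j x : `|piece j x| = \1_(`[t j, t j.+1[%classic) x * `|w x|.
Proof. by rewrite normrZ ger0_norm// indicE. Qed.

Let norm_piece_sum x : \sum_(0 <= j < N.+1) `|piece j x| = `|w x|.
Proof.
under eq_bigr do rewrite norm_piece.
rewrite -mulr_suml ind_sum indicE.
have [xi|xi] := pselect (`[0, t N.+1[%classic x); first by rewrite mem_set// mul1r.
by rewrite (off xi) normr0 mulr0.
Qed.

Let Lpiece j : L2supp b (piece j).
Proof.
split; last by move=> x nx; rewrite /piece Lw.2 ?scaler0.
apply: (n2_le Lw.1 _ _).1.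
  by apply: measCZ; [exact: measurable_indic|exact: L2_meas Lw.1].
move=> x; rewrite norm_piece indicE; case: (_ \in _); rewrite ?mul1r// mul0r.
exact: normr_ge0.
Qed.

Let frozen om := \sum_(0 <= j < N.+1) pairing c (Ft (piece j) om) (f (t j) om).

Let int_piece j := L2supp_intC b0 (Lpiece j).

(** The triangle inequality for a Riemann sum: on each piece the state is frozen, and
    only the transform of the piece depends on the control. *)
Lemma frozen_n2 M : (forall t, n2 (f t) <= M) ->
  L2 setT frozen /\ n2 frozen <= M * (\int[mu]_x `|w x|)%R.
Proof.
move=> fM.
have H j : L2 setT (fun om => pairing c (Ft (piece j) om) (f (t j) om)) /\
   n2 (fun om => pairing c (Ft (piece j) om) (f (t j) om)) <=
     M * (\int[mu]_x `|piece j x|)%R.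
  have [Lf cf _] := L2CbP (f (t j)).
  set A := (\int[mu]_x `|piece j x|)%R; have A0 : 0 <= A by exact: Rint_ge0.
  have [||L1 L2] := n2_le (f := fun om => pairing c (Ft (piece j) om) (f (t j) om)) (L2Z A Lf).
  - by apply: measC_pairing; [exact/continuous_measC/Ft_continuous|exact: continuous_measC].
  - move=> x; rewrite (le_trans (pairing_norm _ _ _))// !fctE normrZ ger0_norm//.
    by apply: ler_wpM2r => //; exact: Ft_norm.
  split=> //; apply: le_trans L2 _; rewrite n2Z// ger0_norm// mulrC.
  exact: ler_wpM2r.
have [L1 L2] := n2_sum N.+1 (fun j => (H j).1) (fun j => (H j).2).
split=> //; apply: le_trans L2 _.
rewrite -mulr_sumr le_eqVlt; apply/orP; left; apply/eqP; congr (_ * _).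
have [_ <-] := Rint_sum N.+1 (fun j => intC_norm (int_piece j)).
by apply: eq_Rint => x; exact: norm_piece_sum.
Qed.

(** On each piece the state is close to its frozen value, by uniform continuity. *)
Lemma frozen_close e om : (forall u s, `[0, b]%classic u -> `|s - u| < d + d -> `|f s - f u| <= e) ->
  `|superpose c w f om - frozen om| <= e * (\int[mu]_x `|w x|)%R.
Proof.
move=> He.
pose g j tau := pairing c (cmul (piece j tau) (wave th om tau)) (f tau om - f (t j) om).
have mg j : measC (g j).
  apply: measC_pairing.
    by apply: intC_meas; exact: intC_cmul_wave.
  apply: continuous_measC => s; apply: cvgB; [exact: path_cvg|exact: cvg_cst].
have gle j tau : (j < N.+1)%N -> `|g j tau| <= e * `|piece j tau|.
  move=> jN; rewrite (le_trans (pairing_norm _ _ _))// cmul_norm wave_norm mulr1 mulrC.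
  rewrite norm_piece indicE.
  have [ti|ti] := pselect (`[t j, t j.+1[%classic tau); last by rewrite memNset// !(mul0r, mulr0).
  rewrite mem_set// mul1r; apply: ler_wpM2r => //.
  apply: le_trans (L2Cb_ler_norm (f tau - f (t j)) om) _; apply: He.
    rewrite /= in_itv/= mulr_ge0 ?(ltW d0)//=.
    by rewrite /t /d mulrCA ler_piMr ?(ltW b0)// ler_pdivrMr// mul1r ler_nat ltnW.
  move: ti; rewrite /= in_itv/= tS => /andP[h1 h2].
  rewrite ger0_norm ?subr_ge0// ltrBlDl; apply: lt_trans h2 _.
  by rewrite ltrD2l ltrDl.
have pcst : path (fun=> f (t _)) by move=> j; split; [exact: cst_continuous|exists `|f (t j)|].
have i1 j := superpose_int c om (Lpiece j) pf.
have i2 j := superpose_int c om (Lpiece j) (pcst j).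
have Eg j : Cint (g j) = superpose c (piece j) f om - pairing c (Ft (piece j) om) (f (t j) om).
  rewrite FtE -Cint_pairing; last by apply: intC_cmul_wave; exact: int_piece.
  rewrite -scaleN1r -CintZ// -CintD//; last exact: intCZ.
  by apply: eq_Cint => tau; rewrite /g -scaleN1r pairingDr pairingZr.
have ig j : intC (g j).
  apply: (@intC_le _ _ (fun tau => `|pairing c (cmul (piece j tau) (wave th om tau)) (f tau om)| +
    `|pairing c (cmul (piece j tau) (wave th om tau)) (f (t j) om)|)) => //.
    by move=> tau; rewrite /g -scaleN1r pairingDr pairingZr scaleN1r ler_normB.
  by apply: intRD; exact: intC_norm.
have Es : superpose c w f om = \sum_(0 <= j < N.+1) superpose c (piece j) f om.
  have [_ <-] := intC_sum N.+1 i1; apply: eq_Cint => tau.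
  rewrite -{1}(piece_sum tau) (big_morph (fun z => pairing c (cmul z (wave th om tau)) (f tau om))
    (id1 := 0) (op1 := +%R))//.
    by move=> z z'; rewrite cmulDl pairingDl.
  have := cmulZl 0 (0 : C) (wave th om tau); rewrite !scale0r => ->.
  by have := pairingZl c 0 (0 : C) (f tau om); rewrite !scale0r.
rewrite Es /frozen -sumrB; under eq_bigr do rewrite -Eg.
apply: le_trans (ler_norm_sum _ _ _) _.
have -> : (\int[mu]_x `|w x|)%R = \sum_(0 <= j < N.+1) (\int[mu]_x `|piece j x|)%R.
  have [_ <-] := Rint_sum N.+1 (fun j => intC_norm (int_piece j)).
  by apply: eq_Rint => x; rewrite norm_piece_sum.
rewrite mulr_sumr !big_nat; apply: ler_sum => j /andP[_ jN].
apply: le_trans (norm_Cint (ig j)) _; rewrite -RintZ; last exact: intC_norm.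
apply: le_Rint; [exact: intC_norm|apply: intRZ; exact: intC_norm|].
by move=> tau; exact: gle.
Qed.

End riemann_sums.

(** Minkowski's inequality in integral form, obtained from Riemann sums in the
    time variable and Fatou's lemma. *)
Lemma superpose_n2 c w f M : L2supp b w -> path f -> (forall t, n2 (f t) <= M) ->
  L2 setT (superpose c w f) /\ n2 (superpose c w f) <= M * (\int[mu]_x `|w x|)%R.
Proof.
move=> Lw pf fM; set A := (\int[mu]_x `|w x|)%R; have A0 : 0 <= A by exact: Rint_ge0.
have M0 : 0 <= M by exact: le_trans (n2_ge0 _) (fM 0).
have FN N := frozen_n2 c N Lw fM.
apply: (@n2_fatou _ _ _ (M * A) (mulr_ge0 M0 A0) (fun N => (FN N).1) _ (fun N => (FN N).2)).
move=> om; apply/cvgrPdist_le => e e0.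
have e1 : 0 < e / (A + 1) by rewrite divr_gt0// ltr_wpDl.
have [del del0 Hdel] := uniformly_continuous_itv 0 b pf.1 e1.
near=> N.
have FC := frozen_close c (w := w) (f := f) (N := N) (e := e / (A + 1)) Lw pf om.
apply: le_trans (FC _) _.
  move=> u s ub us; apply: Hdel => //; apply: lt_trans us _.
  rewrite -mulrDl ltr_pdivrMr ?ltr0n// mulrC -ltr_pdivrMr//.
  by apply: lt_trans (_ : N%:R < _); [near: N; exact: nbhs_infty_gtr|rewrite ltr_nat].
by rewrite -/A mulrAC ler_pdivrMr ?ltr_wpDl// ler_wpM2l ?(ltW e0)// lerDl.
Unshelve. all: by end_near. Qed.

End superposition.

(** * Operators into bounded continuous square-integrable functions *)

#[local] Opaque superpose.

Section operators.
Context {R : realType} (T : R).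
Local Notation C := (Rcomplex R).
Local Notation mu := (@lebesgue_measure R).
Local Notation X := (L2Cb R).
Local Notation Ft := (wave_transform T).
Local Notation superpose := (superpose T).
Local Notation planch := (planch T).
Hypothesis T0 : 0 < T.

(** The junk value 0 outside the space avoids membership proofs in the definitions below. *)
Definition in_L2Cb (f : R -> C) : X := insubd (0 : X) f.

Lemma in_L2CbE f : L2 setT f -> continuous f -> bounded_on setT f ->
  in_L2Cb f = f :> (R -> C).
Proof.
move=> Lf cf bf; have H : f \in @L2Cb_pred R by rewrite inE.
exact: insubdK H.
Qed.

(** The two parts of the norm. Estimates hold for each of them separately, which
    yields the contraction for the L2 norm alone. *)
Definition nu (c : bool) (x : X) : R := if c then n2 x else supnorm x.

Lemma nuD c x y : nu c (x + y) <= nu c x + nu c y.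
Proof.
have [Lx _ bx] := L2CbP x; have [Ly _ yb] := L2CbP y.
case: c; first exact: (n2D Lx Ly).
by apply: supnorm_le => t; apply: le_trans (ler_normD _ _) _; apply: lerD; exact: supnorm_ub.
Qed.

Lemma norm_L2Cb (x : X) : `|x| = nu true x + nu false x. Proof. by []. Qed.

Lemma nu_ge0 c x : 0 <= nu c x.
Proof.
by have [_ _ bx] := L2CbP x; case: c; [exact: n2_ge0|exact: supnorm_ge0].
Qed.

Lemma nu_le c x : nu c x <= `|x|.
Proof. by rewrite norm_L2Cb; case: c; rewrite ?lerDl ?lerDr nu_ge0. Qed.

Lemma nuZ c (a : R) x : nu c (a *: x) = `|a| * nu c x.
Proof.
have [Lx _ bx] := L2CbP x.
have E2 : nu true (a *: x) = `|a| * nu true x by exact: (n2Z a Lx).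
case: c => //; have := normrZ a x; rewrite !norm_L2Cb E2 mulrDr.
exact: addrI.
Qed.

Lemma nu_sup (x : X) (M : R) : 0 <= M -> (forall t, `|x t| <= M) <-> nu false x <= M.
Proof.
move=> M0; have [_ _ bx] := L2CbP x; split; first exact: supnorm_le.
by move=> h t; apply: le_trans h; exact: supnorm_ub.
Qed.

Lemma L1_bound w : L2supp T w -> (\int[mu]_x `|w x| <= Num.sqrt T * n2 w)%R.
Proof. by move=> [Lw w0]; have := (L1_le_L2 (ltW T0) Lw w0).2; rewrite subr0. Qed.

Definition transform (w : R -> C) : X := in_L2Cb (Ft w).

Lemma transformE w : L2supp T w -> transform w = Ft w :> (R -> C).
Proof.
move=> Lw; have iw := L2supp_intC T0 Lw; apply: in_L2CbE.
- exact: (Ft_bound T T0 Lw).1.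
- exact: Ft_continuous.
- by exists (\int[mu]_x `|w x|)%R => x _; exact: Ft_norm.
Qed.

(** A bound for the ratio between the size of the transform of [w] and [sqrt T] times the norm of
    [w]. *)
Definition kappa (c : bool) : R := if c then Num.sqrt planch / Num.sqrt T else 1.

Lemma sqrtT0 : 0 < Num.sqrt T. Proof. by rewrite sqrtr_gt0. Qed.

Lemma transform_nu c w : L2supp T w -> nu c (transform w) <= kappa c * (Num.sqrt T * n2 w).
Proof.
move=> Lw; have := transformE Lw; move: (transform w) => y yE.
case: c.
  rewrite /nu /kappa yE mulrA divfK; first exact: (Ft_norm2 T T0 Lw).
  by rewrite gt_eqF// sqrtT0.
rewrite /kappa mul1r; apply/nu_sup.
  by rewrite mulr_ge0 ?n2_ge0// ltW// sqrtT0.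
move=> t; rewrite yE; apply: le_trans (L1_bound Lw).
by apply: Ft_norm; exact: (L2supp_intC T0 Lw).
Qed.

Lemma transformD (a : R) w w' : L2supp T w -> L2supp T w' ->
  transform (a *: w + w') = a *: transform w + transform w'.
Proof.
move=> Lw Lw'; apply/val_inj; have Law := L2suppZ a Lw.
rewrite [LHS](transformE (L2suppD Law Lw')) FtD; [|exact: (L2supp_intC T0)..].
rewrite FtZ; last exact: (L2supp_intC T0).
by rewrite -(transformE Lw) -(transformE Lw').
Qed.

Definition integral_op c (w : R -> C) (f : R -> X) : X := in_L2Cb (superpose c w f).

Lemma integral_opE c w f : L2supp T w -> path f ->
  integral_op c w f = superpose c w f :> (R -> C).
Proof.
move=> Lw pf; have [B fB] := pf.2; apply: in_L2CbE.
- by apply: (superpose_n2 T T0 c Lw pf (M := B) _).1 => t; exact: le_trans (nu_le true _) (fB t).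
- exact: (@superpose_continuous _ _ _ T0 c _ _ Lw pf).
- exists (B * (\int[mu]_x `|w x|)%R) => x _; apply: (@superpose_norm _ _ _ T0 c _ _ _ x Lw pf) => t.
  exact: le_trans (L2Cb_ler_norm _ _) (fB t).
Qed.

Lemma integral_op_nu d c w f M : L2supp T w -> path f -> (forall t, nu d (f t) <= M) ->
  nu d (integral_op c w f) <= Num.sqrt T * n2 w * M.
Proof.
move=> Lw pf fM; have M0 : 0 <= M := le_trans (nu_ge0 d _) (fM 0).
have E := integral_opE c Lw pf; move: (integral_op c w f) E => y yE.
have L : M * (\int[mu]_x `|w x|)%R <= Num.sqrt T * n2 w * M.
  by rewrite mulrC; apply: ler_wpM2r => //; exact: L1_bound.
apply: le_trans L; case: d fM => fM.
  by rewrite /nu yE; exact: (superpose_n2 T T0 c Lw pf fM).2.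
apply/nu_sup; first by rewrite mulr_ge0// Rint_ge0.
move=> t; rewrite yE; apply: (@superpose_norm _ _ _ T0 c _ _ _ t Lw pf) => s.
exact: ((nu_sup (f s) M0).2 (fM s) t).
Qed.

Lemma pathP (a : R) f g : path f -> path g -> path (fun t => a *: f t + g t).
Proof.
move=> [cf [B fB]] [cg [B' gB]]; split.
  by move=> t; apply: cvgD; [apply: cvgZr; exact: cf|exact: cg].
exists (`|a| * B + B') => t; apply: le_trans (ler_normD _ _) _; apply: lerD => //.
by rewrite normrZ ler_wpM2l.
Qed.

Lemma integral_opDr c w (a : R) f g : L2supp T w -> path f -> path g ->
  integral_op c w (fun t => a *: f t + g t) = a *: integral_op c w f + integral_op c w g.
Proof.
move=> Lw pf pg; apply/val_inj.
rewrite [LHS](integral_opE c Lw (pathP a pf pg)).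
have -> : val (a *: integral_op c w f + integral_op c w g) =
  a *: superpose c w f + superpose c w g.
  by rewrite -(integral_opE c Lw pf) -(integral_opE c Lw pg).
apply/funext => om; rewrite !fctE !superposeE.
have i1 := superpose_int T T0 c om Lw pf; have i2 := superpose_int T T0 c om Lw pg.
rewrite -CintZ// -CintD//; last exact: intCZ.
by apply: eq_Cint => tau; rewrite pairingDr pairingZr.
Qed.

Lemma integral_opDl c w w' (a : R) f : L2supp T w -> L2supp T w' -> path f ->
  integral_op c (a *: w + w') f = a *: integral_op c w f + integral_op c w' f.
Proof.
move=> Lw Lw' pf; apply/val_inj; have L := L2suppD (L2suppZ a Lw) Lw'.
rewrite [LHS](integral_opE c L pf).
have -> : val (a *: integral_op c w f + integral_op c w' f) =
  a *: superpose c w f + superpose c w' f.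
  by rewrite -(integral_opE c Lw pf) -(integral_opE c Lw' pf).
apply/funext => om; rewrite !fctE !superposeE.
have i1 := superpose_int T T0 c om Lw pf; have i2 := superpose_int T T0 c om Lw' pf.
rewrite -CintZ// -CintD//; last exact: intCZ.
by apply: eq_Cint => tau; rewrite cmulDl cmulZl pairingDl pairingZl.
Qed.

(** The control up to time [t]: it makes the integrals up to [t] integrals over the
    line. *)
Definition cut (t : R) (w : R -> C) : R -> C := fun x => \1_(`]-oo, t]%classic) x *: w x.

Lemma cut_le t w x : `|cut t w x| <= `|w x|.
Proof.
by rewrite normrZ indicE; case: (_ \in _); rewrite ?normr1 ?mul1r// normr0 mul0r.
Qed.

Lemma cut_L2supp t w : L2supp T w -> L2supp T (cut t w).
Proof.
move=> [Lw w0]; split; last by move=> x nx; rewrite /cut w0 ?scaler0.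
apply: (n2_le Lw _ (cut_le t w)).1.
by apply: measCZ; [exact: measurable_indic|exact: L2_meas].
Qed.

Lemma cut_n2 t w : L2supp T w -> n2 (cut t w) <= n2 w.
Proof.
move=> Lw; apply: (n2_le Lw.1 _ (cut_le t w)).2; exact: L2_meas (cut_L2supp t Lw).1.
Qed.

Lemma cutD t (a : R) w w' : cut t (a *: w + w') = a *: cut t w + cut t w'.
Proof. by apply/funext => x; rewrite /cut !fctE scalerDr !scalerA mulrC. Qed.

Lemma cutB t w w' : cut t (w - w') = cut t w - cut t w'.
Proof. by apply/funext => x; rewrite /cut !fctE scalerBr. Qed.

Lemma cut_full w : L2supp T w -> cut T w = w.
Proof.
move=> Lw; apply/funext => x; rewrite /cut indicE mem_setE /= in_itv/=.
case: leP => xT; first by rewrite scale1r.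
by rewrite Lw.2 ?scaler0// /= in_itv/= => /andP[_]; rewrite ltNge (ltW xT).
Qed.

(** Dominated convergence. *)
Lemma cut_continuous w t : L2supp T w ->
  n2 (cut s w - cut t w) @[s --> t] --> (0 : R).
Proof.
move=> Lw; apply/(@cvg_nbhsP _ R^o) => u ut.
apply: (@n2_dominated _ w (fun n => cut (u n) w - cut t w) [set t]) => //.
- exact: Lw.1.
- move=> n; apply: L2_meas; apply: L2B; exact: (cut_L2supp _ Lw).1.
- move=> n x; rewrite !fctE /cut -scalerBl normrZ !indicE.
  by case: (_ \in _); case: (_ \in _); rewrite ?subrr ?subr0 ?sub0r ?normrN ?normr1 ?normr0 ?mul1r ?mul0r.
- exact: lebesgue_measure_set1.
- move=> x /= /eqP xt; apply/cvgrPdist_le => e e0.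
  have d0 : 0 < `|x - t| by rewrite normr_gt0 subr_eq0.
  have /cvgrPdist_lt/(_ _ d0) := ut; apply: filterS => n h.
  rewrite !fctE /cut !indicE !mem_setE /= !in_itv/=.
  have -> : (x <= u n) = (x <= t).
    case: (lerP x t) => h'.
      have lt : x < t by rewrite lt_neqAle xt.
      move: h; rewrite [ltRHS]ltr0_norm ?subr_lt0// ltr_norml => /andP[_].
      by rewrite opprB ltrD2l ltrN2 => /ltW ->.
    move: h; rewrite [ltRHS]gtr0_norm ?subr_gt0// ltr_norml => /andP[+ _].
    by rewrite opprB ltrD2l ltrN2 leNgt => ->.
  by rewrite subrr subr0 normr0 ltW.
Qed.

End operators.

(** * The linear system of the states *)

#[local] Opaque transform integral_op.

Lemma sub_via (V : zmodType) (a b p q : V) : p - q = (a - b) - (a - p) + (b - q).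
Proof. by rewrite opprB [(a - b) + _]addrC !addrA !subrK. Qed.

Section state_equation.
Context {R : realType} (T : R).
Local Notation C := (Rcomplex R).
Local Notation mu := (@lebesgue_measure R).
Local Notation X := (L2Cb R).
Local Notation Ft := (wave_transform T).
Local Notation planch := (planch T).
Local Notation transform := (transform T).
Local Notation integral_op := (integral_op T).
Hypothesis T0 : 0 < T.

Definition sinv (x : X) : R -> C := get [set s | left_inverse_at T T x s].

Lemma sinvP (x : X) : left_inverse_at T T x (sinv x).
Proof.
have [Lx _ _] := L2CbP x; apply: (@getPex _ [set s | left_inverse_at T T x s]).
by have [s Hs] := left_inverse_exists T T0 Lx; exists s.
Qed.

Let sinvL (x : X) : L2supp T (sinv x). Proof. exact: (sinvP x).1. Qed.

(** Representatives are chosen, so linearity holds up to null functions only; the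
    operators below do not see null functions. *)
Lemma sinv_lin (a : R) (x x' : X) :
  n2 (sinv (a *: x + x') - (a *: sinv x + sinv x')) = 0.
Proof.
have L := L2suppD (L2suppZ a (sinvL x)) (sinvL x').
have [Lx _ _] := L2CbP x; have [Lx' _ _] := L2CbP x'.
apply: (@left_inverse_test _ T T (a *: x + x' : X) _ _ L (sinvP _)) => w Lw.
have LF := (Ft_bound T T0 Lw).1.
have Lw2 := Lw.1.
rewrite (ipDl (L2suppZ a (sinvL x)).1 (sinvL x').1 Lw2) ipZl//; last exact: (sinvL x).1.
have E1 := (sinvP x).2 w Lw; have E2 := (sinvP x').2 w Lw.
have -> : ip (a *: x + x' : X) (Ft w) = a * ip x (Ft w) + ip x' (Ft w).
  by rewrite -(ipZl a Lx LF) -(ipDl (L2Z a Lx) Lx' LF).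
by rewrite -E1 -E2 mulrDr [a * (_ * _)]mulrCA.
Qed.

(** By Plancherel's formula. *)
Lemma sinv_transform w : L2supp T w -> n2 (sinv (transform w) - w) = 0.
Proof.
move=> Lw; apply: (@left_inverse_test _ T T (transform w) _ _ Lw (sinvP _)) => v Lv.
by rewrite (transformE T0 Lw) (plancherel T T0 Lw Lv).
Qed.

(** Normalised so that [q (transform w)] is the product of [sqrt T] and of the
    norm of [w]: the smallness condition on [w] then reads [q x < 1 / 6]. *)
Definition control_norm (x : X) : R := Num.sqrt T * n2 (sinv x).
Local Notation q := control_norm.

Lemma n2_close w w' : L2supp T w -> L2supp T w' -> n2 (w - w') = 0 -> n2 w = n2 w'.
Proof.
move=> Lw Lw' E; apply/eqP; rewrite eq_le; apply/andP; split.
  have -> : w = (w - w') + w' by rewrite subrK.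
  by apply: le_trans (n2D (L2B Lw.1 Lw'.1) Lw'.1) _; rewrite E add0r.
have -> : w' = w - (w - w') by rewrite opprB addrC subrK.
by apply: le_trans (n2B Lw.1 (L2B Lw.1 Lw'.1)) _; rewrite E addr0.
Qed.

Lemma control_norm_transform w : L2supp T w -> q (transform w) = Num.sqrt T * n2 w.
Proof. by move=> Lw; rewrite /q (n2_close (sinvL _) Lw (sinv_transform Lw)). Qed.

Let st0 : 0 <= Num.sqrt T. Proof. exact: sqrtr_ge0. Qed.

Lemma control_normD x y : q (x + y) <= q x + q y.
Proof.
have := sinv_lin 1 x y; rewrite !scale1r => E.
rewrite /q (n2_close (sinvL _) (L2suppD (sinvL x) (sinvL y)) E) -mulrDr.
by apply: ler_wpM2l => //; apply: n2D; exact: (sinvL _).1.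
Qed.

Lemma sinv0 : n2 (sinv 0) = 0.
Proof.
apply/eqP; rewrite eq_le n2_ge0 andbT.
have [L0 _ _] := L2CbP (0 : X).
have := left_inverse_bound T0 L0 (sinvP 0).
have E0 : n2 (0 : X) = 0 by exact: n2_0.
by rewrite E0 mul0r.
Qed.

Lemma control_normZ a x : q (a *: x) = `|a| * q x.
Proof.
have E := sinv_lin a x 0; rewrite addr0 in E.
rewrite /q (n2_close (sinvL _) (L2suppD (L2suppZ a (sinvL x)) (sinvL 0)) E) mulrCA; congr (_ * _).
rewrite -(n2Z a (sinvL x).1); apply: n2_close.
- exact: (L2suppD (L2suppZ a (sinvL x)) (sinvL 0)).
- exact: L2suppZ.
- by rewrite addrAC subrr add0r sinv0.
Qed.

Lemma control_norm_n2 x : q x <= Num.sqrt T / Num.sqrt planch * n2 x.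
Proof.
have [Lx _ _] := L2CbP x; rewrite /q -mulrA; apply: ler_wpM2l => //.
by rewrite mulrC; exact: (left_inverse_bound T0 Lx (sinvP x)).
Qed.

Lemma eq_of_nu (x y : X) : (forall c, nu c (x - y) <= 0) -> x = y.
Proof.
move=> H; apply/eqP; rewrite -subr_eq0 -normr_le0 norm_L2Cb -(addr0 0).
exact: lerD.
Qed.

Lemma transformB w w' : L2supp T w -> L2supp T w' ->
  transform (w - w') = transform w - transform w'.
Proof.
move=> Lw Lw'; have E : w - w' = (-1) *: w' + w by rewrite scaleN1r addrC.
by rewrite E transformD// scaleN1r addrC.
Qed.

Lemma integral_opB c w w' f : L2supp T w -> L2supp T w' -> path f ->
  integral_op c (w - w') f = integral_op c w f - integral_op c w' f.
Proof.
move=> Lw Lw' pf; have E : w - w' = (-1) *: w' + w by rewrite scaleN1r addrC.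
by rewrite E integral_opDl// scaleN1r addrC.
Qed.

Lemma transform_eq w w' : L2supp T w -> L2supp T w' -> n2 (w - w') = 0 ->
  transform w = transform w'.
Proof.
move=> Lw Lw' E; apply: eq_of_nu => c; rewrite -transformB//.
have := transform_nu T0 c (L2suppB Lw Lw').
by rewrite E !mulr0.
Qed.

Lemma integral_op_eq c w w' f : L2supp T w -> L2supp T w' -> path f -> n2 (w - w') = 0 ->
  integral_op c w f = integral_op c w' f.
Proof.
move=> Lw Lw' pf E; apply: eq_of_nu => d; rewrite -integral_opB//.
have [B fB] := pf.2.
have := integral_op_nu T0 c (d := d) (M := B) (L2suppB Lw Lw') pf.
rewrite E mulr0 mul0r; apply => t; exact: le_trans (nu_le d _) (fB t).
Qed.

Lemma cut_eq t w w' : L2supp T w -> L2supp T w' -> n2 (w - w') = 0 ->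
  n2 (cut t w - cut t w') = 0.
Proof.
move=> Lw Lw' E; rewrite -cutB; apply/eqP; rewrite eq_le n2_ge0 andbT -E.
exact: (cut_n2 _ (L2suppB Lw Lw')).
Qed.

(** States are indexed by a component and a time. The component [true] is the
    solution seen in the rotating frame, the component [false] is the square root of the
    equation minus 1; the latter starts from 0 and has no source. *)
Definition state_src (w : R -> C) (i : bool * R) : X :=
  if i.1 then transform (cut i.2 w) else 0.

(** Each component is driven by the other one. *)
Definition state_op (w : R -> C) (y : bool * R -> X) (i : bool * R) : X :=
  integral_op i.1 (cut i.2 w) (fun s => y (~~ i.1, s)).

Definition states : set (bool * R -> X) := [set y | forall c, path (fun t => y (c, t))].

(** An operator that is bounded on controls gives paths that are continuous in time,
    by strong continuity of [cut]. *)
Lemma cut_path (F : (R -> C) -> X) (B : R) w :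
  (forall w w', L2supp T w -> L2supp T w' -> F (w - w') = F w - F w') ->
  (forall w, L2supp T w -> `|F w| <= B * n2 w) -> L2supp T w ->
  path (fun t => F (cut t w)).
Proof.
move=> FB Fn Lw; split; last first.
  exists (`|B| * n2 w) => t; apply: le_trans (Fn _ (cut_L2supp t Lw)) _.
  apply: (@le_trans _ _ (`|B| * n2 (cut t w))).
    by apply: ler_wpM2r; [exact: n2_ge0|exact: ler_norm].
  by apply: ler_wpM2l => //; exact: (cut_n2 t Lw).
move=> t; apply/cvgrPdist_le => e e0.
have H : B * n2 (cut s w - cut t w) @[s --> t] --> (0 : R).
  by rewrite -(mulr0 B); apply: cvgMr; exact: (cut_continuous t Lw).
have /cvgrPdist_le/(_ e e0) := H; apply: filterS => s.
rewrite sub0r normrN => h; rewrite distrC -FB; [|exact: (cut_L2supp _ Lw)..].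
apply: le_trans (Fn _ _) (le_trans (ler_norm _) h).
apply: L2suppB; exact: (cut_L2supp _ Lw).
Qed.

Lemma state_src_states w : L2supp T w -> states (state_src w).
Proof.
move=> Lw [|]; last by split; [exact: cst_continuous|exists 0 => t; rewrite normr0].
rewrite /state_src /=.
apply: (@cut_path _ (kappa T true * Num.sqrt T + kappa T false * Num.sqrt T)) => //.
- by move=> *; exact: transformB.
- move=> v Lv; rewrite norm_L2Cb -mulrDl -[leRHS]mulrA mulrDl.
  have h1 := transform_nu T0 true Lv; have h2 := transform_nu T0 false Lv.
  exact: lerD h1 h2.
Qed.

Lemma state_op_states w y : L2supp T w -> states y -> states (state_op w y).
Proof.
move=> Lw sy c; rewrite /state_op /=; have pf := sy (~~ c); have [B fB] := pf.2.
apply: (@cut_path (fun w => integral_op c w (fun s => y (~~ c, s)))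
  (Num.sqrt T * B + Num.sqrt T * B)) => //.
- by move=> *; exact: integral_opB.
- move=> v Lv; rewrite norm_L2Cb mulrDl -!mulrA [B * _]mulrC !mulrA.
  apply: lerD; apply: integral_op_nu => // t; exact: le_trans (nu_le _ _) (fB t).
Qed.

Lemma state_src_eq w w' : L2supp T w -> L2supp T w' -> n2 (w - w') = 0 ->
  state_src w = state_src w'.
Proof.
move=> Lw Lw' E; apply/funext => -[[|] t]; rewrite /state_src //=.
by apply: transform_eq; [exact: (cut_L2supp t Lw)|exact: (cut_L2supp t Lw')|exact: (cut_eq t Lw Lw' E)].
Qed.

Lemma state_op_eq w w' y : L2supp T w -> L2supp T w' -> states y -> n2 (w - w') = 0 ->
  state_op w y = state_op w' y.
Proof.
move=> Lw Lw' sy E; apply/funext => -[c t]; rewrite /state_op /=.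
by apply: integral_op_eq => //; [exact: (cut_L2supp t Lw)|exact: (cut_L2supp t Lw')|exact: (cut_eq t Lw Lw' E)].
Qed.

Lemma states_lin a y z : states y -> states z -> states (a *: y + z).
Proof. by move=> sy sz c; exact: pathP. Qed.

Lemma states_bounded y : states y -> exists B, forall i, `|y i| <= B.
Proof.
move=> sy; have [B HB] := (sy true).2; have [B' HB'] := (sy false).2.
exists (Num.max B B') => -[[|] t].
  by apply: le_trans (HB t) _; rewrite le_max lexx.
by apply: le_trans (HB' t) _; rewrite le_max lexx orbT.
Qed.

Lemma states_lim (u : nat -> bool * R -> X) y : (forall n, states (u n)) ->
  (forall e, 0 < e -> \forall n \near \oo, forall i, `|u n i - y i| <= e) -> states y.
Proof.
move=> su uy c; split.
  move=> t; apply/cvgrPdist_le => e e0; have e3 : 0 < e / 3 by rewrite divr_gt0.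
  have [n Hn] : exists n, forall i, `|u n i - y i| <= e / 3.
    by have [n _ Hn] := uy _ e3; exists n; exact: Hn n (leqnn n).
  have /cvgrPdist_le/(_ _ e3) := (su n c).1 t; apply: filterS => s h.
  have -> : y (c, t) - y (c, s) = (u n (c, t) - u n (c, s)) - (u n (c, t) - y (c, t))
     + (u n (c, s) - y (c, s)).
    exact: sub_via.
  have -> : e = e / 3 + e / 3 + e / 3 by field.
  apply: le_trans (ler_normD _ _) _; apply: lerD => //.
  by apply: le_trans (ler_normB _ _) _; apply: lerD.
have [n _ Hn] := uy 1 ltr01; have [B HB] := (su n c).2.
exists (B + 1) => t; have -> : y (c, t) = u n (c, t) - (u n (c, t) - y (c, t)).
  by rewrite opprB addrC subrK.
by apply: le_trans (ler_normB _ _) _; apply: lerD => //; exact: Hn n (leqnn n) _.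
Qed.

Definition control_src x := state_src (sinv x).
Definition control_op x := state_op (sinv x).

Lemma control_op_linr x a y z : states y -> states z ->
  control_op x (a *: y + z) = a *: control_op x y + control_op x z.
Proof.
move=> sy sz; apply/funext => -[c t]; rewrite !fctE /control_op /state_op /=.
rewrite -integral_opDr//; exact: (cut_L2supp t (sinvL x)).
Qed.

Lemma control_op_linl a x x' y : states y ->
  control_op (a *: x + x') y = a *: control_op x y + control_op x' y.
Proof.
move=> sy; rewrite /control_op.
rewrite (state_op_eq (sinvL _) (L2suppD (L2suppZ a (sinvL x)) (sinvL x')) sy (sinv_lin a x x')).
apply/funext => -[c t]; rewrite !fctE /state_op /= cutD.
rewrite integral_opDl//; exact: (cut_L2supp t (sinvL _)).
Qed.

Lemma control_op_bound c x y M : states y -> (forall i, nu c (y i) <= M) ->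
  forall i, nu c (control_op x y i) <= q x * M.
Proof.
move=> sy yM [d t]; rewrite /control_op /state_op /=.
have M0 : 0 <= M := le_trans (nu_ge0 c _) (yM (true, 0)).
apply: le_trans (integral_op_nu (M := M) T0 d (cut_L2supp t (sinvL x)) _ _) _ => //.
by apply: ler_wpM2r => //; apply: ler_wpM2l => //; exact: (cut_n2 t (sinvL x)).
Qed.

Lemma control_src_lin a x x' :
  control_src (a *: x + x') = a *: control_src x + control_src x'.
Proof.
rewrite /control_src.
rewrite (state_src_eq (sinvL _) (L2suppD (L2suppZ a (sinvL x)) (sinvL x')) (sinv_lin a x x')).
apply/funext => -[[|] t]; rewrite !fctE /state_src /=; last by rewrite scaler0 addr0.
rewrite cutD transformD//; exact: (cut_L2supp t (sinvL _)).
Qed.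

Lemma kappa_ge0 c : 0 <= kappa T c.
Proof. by case: c => //=; rewrite divr_ge0 ?sqrtr_ge0. Qed.

Lemma control_src_bound c x i : nu c (control_src x i) <= kappa T c * q x.
Proof.
case: i => [[|] t]; rewrite /control_src /state_src /=.
  apply: le_trans (transform_nu T0 c (cut_L2supp t (sinvL x))) _.
  apply: ler_wpM2l; first exact: kappa_ge0.
  by apply: ler_wpM2l => //; exact: (cut_n2 t (sinvL x)).
have : nu c (0 *: (0 : X)) = 0 by rewrite nuZ normr0 mul0r.
by rewrite scale0r => ->; rewrite mulr_ge0 ?kappa_ge0// mulr_ge0 ?n2_ge0.
Qed.

End state_equation.

(** * Conservation of the norm *)

Section conservation.
Context {R : realType}.
Local Notation C := (Rcomplex R).
Local Notation mu := (@lebesgue_measure R).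

(** The function [A] is a control of the increments of [E] which adds up along
    subdivisions; it replaces the integral of the modulus of a derivative. *)
Lemma constant_of_small_increments (E A : R -> R) (a b : R) : a <= b ->
  (forall e, 0 < e -> exists2 d, 0 < d & forall s t, a <= s -> s <= t -> t <= b -> t - s < d ->
     `|E t - E s| <= e * (A t - A s)) -> E b = E a.
Proof.
move=> ab H.
have K e : 0 < e -> `|E b - E a| <= e * (A b - A a).
  move=> e0; have [d d0 Hd] := H e e0.
  have [N NE] : exists N : nat, (b - a) / d < N%:R.
    by exists (Num.truncn ((b - a) / d)).+1; exact: truncnS_gt.
  pose h := (b - a) / N.+1%:R; pose t (j : nat) := a + j%:R * h.
  have h0 : 0 <= h by rewrite divr_ge0 ?subr_ge0.
  have hd : h < d.
    rewrite ltr_pdivrMr ?ltr0n// mulrC -ltr_pdivrMr//.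
    by apply: lt_trans NE _; rewrite ltr_nat.
  have tS j : t j.+1 = t j + h by rewrite /t -addn1 natrD mulrDl mul1r addrA.
  have tN : t N.+1 = b by rewrite /t /h mulrC divfK ?pnatr_eq0// addrC subrK.
  have ta j : a <= t j by rewrite lerDl mulr_ge0.
  have tb j : (j <= N.+1)%N -> t j <= b.
    by move=> jN; rewrite -tN /t lerD2l ler_wpM2r// ler_nat.
  have step j : (j <= N.+1)%N -> `|E (t j) - E a| <= e * (A (t j) - A a).
    elim: j => [|j IH] jN; first by rewrite /t mul0r addr0 !subrr normr0 mulr0.
    have -> : E (t j.+1) - E a = (E (t j.+1) - E (t j)) + (E (t j) - E a) by rewrite addrA subrK.
    have -> : A (t j.+1) - A a = (A (t j.+1) - A (t j)) + (A (t j) - A a) by rewrite addrA subrK.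
    rewrite mulrDr; apply: le_trans (ler_normD _ _) _; apply: lerD; last by apply: IH; exact: ltnW.
    apply: Hd => //; first by rewrite tS lerDl.
      exact: tb.
    by rewrite tS addrC addKr.
  by have := step N.+1 (leqnn _); rewrite tN.
have A0 : 0 <= A b - A a by have := K 1 ltr01; rewrite mul1r; exact: le_trans.
apply/eqP; rewrite -subr_eq0 -normr_le0; apply/ler_addgt0Pr => e e0; rewrite add0r.
have e1 : 0 < e / (A b - A a + 1) by rewrite divr_gt0// ltr_wpDl.
apply: le_trans (K _ e1) _.
by rewrite mulrAC ler_pdivrMr ?ltr_wpDl// ler_wpM2l ?(ltW e0)// lerDl.
Qed.

Variables (a u : R -> C) (m : R -> R) (B T : R).
Hypothesis ia : intC a.
Hypothesis a0 : forall x, x <= 0 -> a x = 0.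
Hypothesis T0 : 0 <= T.
Hypothesis cu : continuous u.
Hypothesis cm : continuous m.
Hypothesis uB : forall t, `|u t| <= B.
Hypothesis mB : forall t, `|m t| <= B.
Local Notation i t := (\1_(`]-oo, t]%classic) : R -> R).
Hypothesis uE : forall t, u t = Cint (fun x => m x *: (i t x *: a x)).
Hypothesis mE : forall t, m t = 1 - (\int[mu]_x rip (i t x *: a x) (u x))%R.

Let ii t : intC (fun x => i t x *: a x).
Proof.
apply: (@intC_le _ _ (fun x => `|a x|)); last exact: intC_norm.
  by apply: measCZ; [exact: measurable_indic|exact: intC_meas].
by move=> x; rewrite normrZ indicE; case: (_ \in _); rewrite ?normr1 ?mul1r// normr0 mul0r.
Qed.

Let B0 : 0 <= B. Proof. exact: le_trans (normr_ge0 _) (uB 0). Qed.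

Let im (f : R -> C) : intC f -> intC (fun x => m x *: f x).
Proof.
move=> fi; apply: (@intC_le _ _ (fun x => B * `|f x|)).
- by apply: measCZ; [exact: continuous_measurable_fun|exact: intC_meas].
- by move=> x; rewrite normrZ ler_wpM2r.
- by apply: intRZ; exact: intC_norm.
Qed.

Let iu (f : R -> C) : intC f -> intR (fun x => rip (f x) (u x)).
Proof.
move=> fi; apply: (@intR_le _ _ (fun x => B * `|f x|)).
- by apply: rip_meas; [exact: intC_meas|exact: continuous_measC].
- by move=> x; rewrite (le_trans (rip_le _ _))// mulrC ler_wpM2r.
- by apply: intRZ; exact: intC_norm.
Qed.

Section increment.
Variables (s t d : R).
Hypothesis st : s <= t.
Hypothesis d0 : 0 <= d.
Hypothesis ud : forall x, s <= x <= t -> `|u x - u s| <= d.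
Hypothesis md : forall x, s <= x <= t -> `|m x - m s| <= d.
Let v x : C := (i t x - i s x) *: a x.
Let V := (\int[mu]_x `|v x|)%R.

Let iv : intC v.
Proof.
rewrite (_ : v = fun x => i t x *: a x + -1 *: (i s x *: a x)).
  by apply: intCD => //; exact: intCZ.
by apply/funext => x; rewrite /v scalerBl scaleN1r.
Qed.

Let v_off x : ~ (s <= x <= t) -> v x = 0.
Proof.
move=> nx; rewrite /v !indicE !mem_setE /= !in_itv/=.
case: (leP x t) => xt; case: (leP x s) => xs //=; rewrite ?subrr ?scale0r//.
  by exfalso; apply: nx; rewrite xt (ltW xs).
by exfalso; have := lt_le_trans xt (le_trans xs st); rewrite ltxx.
Qed.

Let V0 : 0 <= V. Proof. exact: Rint_ge0. Qed.

Let uI : u t - u s = Cint (fun x => m x *: v x).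
Proof.
rewrite !uE -scaleN1r -CintZ; last exact: im.
rewrite -CintD; [|exact: im|by apply: intCZ; exact: im].
by apply: eq_Cint => x; rewrite /v scalerBl scalerBr scaleN1r.
Qed.

Let mI : m t - m s = - (\int[mu]_x rip (v x) (u x))%R.
Proof.
have key (p q : R) : 1 - p - (1 - q) = - (p - q) by ring.
rewrite !mE key -RintB; [|exact: iu..].
congr (- _); apply: eq_Rint => x.
by rewrite -ripBl -scalerBl.
Qed.

(** The terms of first order of the increment cancel when the states are frozen at
    time [s]; what remains is of order [d]. *)
Lemma increment_bound :
  `|(`|u t| ^+ 2 + m t ^+ 2) - (`|u s| ^+ 2 + m s ^+ 2)| <= 6 * B * d * V.
Proof.
have hu : `|u t - u s| <= B * V.
  rewrite uI /V -RintZ; last exact: intC_norm.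
  apply: le_trans (norm_Cint (im iv)) _; apply: le_Rint.
  - by apply: intC_norm; exact: im.
  - by apply: intRZ; exact: intC_norm.
  - by move=> x; rewrite normrZ ler_wpM2r.
have hm : `|m t - m s| <= B * V.
  rewrite mI normrN /V -RintZ; last exact: intC_norm.
  apply: le_trans (normr_Rint (iu iv)) _; apply: le_Rint.
  - by apply: intR_norm; exact: iu.
  - by apply: intRZ; exact: intC_norm.
  - by move=> x; rewrite (le_trans (rip_le _ _))// mulrC ler_wpM2r.
have tt : s <= t <= t by rewrite st lexx.
have hu2 := ud tt; have hm2 := md tt.
have hx : `|rip (u t - u s) (u s) + (m t - m s) * m s| <= 2 * B * d * V.
  rewrite uI mI (rip_Cint (u s) (im iv)) mulNr mulrC -RintZ; last exact: iu.
  rewrite -RintB; [|exact: (intR_rip (u s) (im iv))|by apply: intRZ; exact: iu].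
  have iI : intR (fun x => rip (m x *: v x) (u s) - m s * rip (v x) (u x)).
    by apply: intRB; [exact: (intR_rip (u s) (im iv))|apply: intRZ; exact: iu].
  apply: le_trans (normr_Rint iI) _; rewrite /V -RintZ; last exact: intC_norm.
  apply: le_Rint; [exact: intR_norm|by apply: intRZ; exact: intC_norm|move=> x].
  have [xst|xst] := pselect (s <= x <= t); last first.
    by rewrite v_off// scaler0 normr0 mulr0 /rip /= !mul0r addr0 mulr0 subrr normr0.
  have -> : rip (m x *: v x) (u s) - m s * rip (v x) (u x) =
      (m x - m s) * rip (v x) (u s) - m s * rip (v x) (u x - u s).
    by rewrite ripZl [rip (v x) (_ - _)]ripC ripBl ![rip (u _) _]ripC; ring.
  apply: le_trans (ler_normB _ _) _.
  have -> : 2 * B * d * `|v x| = d * (`|v x| * B) + B * (`|v x| * d) by ring.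
  rewrite !normrM; apply: lerD; apply: ler_pM => //.
  - exact: md.
  - by apply: le_trans (rip_le _ _) _; apply: ler_wpM2l.
  - by apply: le_trans (rip_le _ _) _; apply: ler_wpM2l => //; exact: ud.
have -> : `|u t| ^+ 2 + m t ^+ 2 - (`|u s| ^+ 2 + m s ^+ 2) =
   `|u t - u s| ^+ 2 + (m t - m s) ^+ 2 + 2 * (rip (u t - u s) (u s) + (m t - m s) * m s).
  by rewrite -!rip_sqr /rip !ReB !ImB; ring.
have q1 : `|u t - u s| ^+ 2 <= d * (B * V) by rewrite expr2; exact: ler_pM.
have q2 : (m t - m s) ^+ 2 <= d * (B * V).
  by rewrite -real_normK ?num_real// expr2; exact: ler_pM.
move: hx q1 q2 (sqr_ge0 (`|u t - u s|)) (sqr_ge0 (m t - m s)).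
rewrite !ler_norml.
move: (`|u t - u s| ^+ 2) ((m t - m s) ^+ 2) (rip _ _ + _) => p q r /andP[r1 r2] p1 q1 p2 q2.
move: r1 r2 p1 q1 p2 q2; move: V0 B0 d0; move: V => W.
have -> : d * (B * W) = B * d * W by ring.
have -> : 2 * B * d * W = 2 * (B * d * W) by ring.
have -> : 6 * B * d * W = 6 * (B * d * W) by ring.
move: (B * d * W) => z *; apply/andP; split; lra.
Qed.

End increment.

(** The derivative of [|u|^2 + m^2] cancels; as the density [a] is only
    integrable, this is used through increments. *)
Lemma conservation t : 0 <= t -> `|u t| ^+ 2 + m t ^+ 2 = 1.
Proof.
move=> t0; have i00 x : i 0 x *: a x = 0.
  rewrite indicE mem_setE /= in_itv/=; case: leP => x0; last by rewrite scale0r.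
  by rewrite a0// scaler0.
have u0 : u 0 = 0.
  rewrite uE (eq_Cint (g := fun=> 0)); last by move=> x; rewrite i00 scaler0.
  by apply: complex_ext => /=; exact: Rint_cst0.
have m0 : m 0 = 1.
  rewrite mE (eq_Rint (g := fun=> 0)); first by rewrite Rint_cst0 subr0.
  by move=> x; rewrite i00 /rip /= !mul0r addr0.
pose E t := `|u t| ^+ 2 + m t ^+ 2; pose A t := (\int[mu]_x `|i t x *: a x|)%R.
have <- : E 0 = 1 by rewrite /E u0 m0 normr0 expr0n expr1n add0r.
apply: (@constant_of_small_increments E A) => // e e0.
pose d := e / (6 * B + 1).
have B1 : 0 < 6 * B + 1 by rewrite ltr_wpDl// mulr_ge0.
have d0 : 0 < d by rewrite divr_gt0.
have [d1 d10 H1] := uniformly_continuous_itv 0 t cu d0.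
have [d2 d20 H2] := uniformly_continuous_itv 0 t cm d0.
exists (Num.min d1 d2); first by rewrite lt_min d10.
move=> s r s0 sr rt; rewrite lt_min => /andP[h1 h2].
have s_in : `[0, t]%classic s by rewrite /= in_itv/= s0 (le_trans sr).
have near_s x : s <= x <= r -> `|x - s| < d1 /\ `|x - s| < d2.
  move=> /andP[sx xr]; rewrite ger0_norm ?subr_ge0//.
  by split; [apply: le_lt_trans h1|apply: le_lt_trans h2]; rewrite lerD2r.
apply: le_trans (increment_bound sr (ltW d0) _ _) _.
- by move=> x /near_s[x1 _]; exact: H1.
- by move=> x /near_s[_ x2]; exact: H2.
have <- : (\int[mu]_x `|(i r x - i s x) *: a x|)%R = A r - A s.
  rewrite /A -RintB; [|exact: intC_norm..].
  apply: eq_Rint => x; rewrite !normrZ !indicE !mem_setE /= !in_itv/=.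
  case: (leP x s) => xs.
    by rewrite (le_trans xs sr) subrr normr0 mul0r subrr.
  by rewrite subr0 normr0 mul0r subr0.
apply: ler_wpM2r; first exact: Rint_ge0.
rewrite /d mulrA ler_pdivrMr// mulrC ler_pM2l// lerDl//.
Qed.

End conservation.

(** * Uniqueness for the equation with a square root *)

Section square_root_equation.
Context {R : realType}.
Local Notation C := (Rcomplex R).
Local Notation mu := (@lebesgue_measure R).

Lemma sqrt_1msqr_le1 (z : C) : `|Num.sqrt (1 - `|z| ^+ 2)| <= 1.
Proof.
by rewrite ger0_norm ?sqrtr_ge0// -[leRHS]sqrtr1 ler_wsqrtr// gerBl sqr_ge0.
Qed.

(** Both square roots are at least [1 / 2], and the difference of the squares is at
    most the difference of the moduli. *)
Lemma sqrt_1msqr_lipschitz (z z' : C) : `|z| <= 2^-1 -> `|z'| <= 2^-1 ->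
  `|Num.sqrt (1 - `|z| ^+ 2) - Num.sqrt (1 - `|z'| ^+ 2)| <= `|z - z'|.
Proof.
move=> hz hz'; apply: le_trans (ler_dist_dist _ _).
move: (`|z|) (`|z'|) (normr_ge0 z) (normr_ge0 z') hz hz' => p r p0 r0 hp hr.
have half (x : R) : 0 <= x -> x <= 2^-1 -> 2^-1 <= Num.sqrt (1 - x ^+ 2).
  move=> x0 x1; rewrite -(@ler_pXn2r _ 2)// ?nnegrE ?sqrtr_ge0// ?invr_ge0// sqr_sqrtr; nra.
have sq (x : R) : 0 <= x -> x <= 2^-1 -> Num.sqrt (1 - x ^+ 2) ^+ 2 = 1 - x ^+ 2.
  by move=> x0 x1; rewrite sqr_sqrtr//; nra.
have pa := half p p0 hp; have rb := half r r0 hr; have Ea := sq p p0 hp; have Eb := sq r r0 hr.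
set a := Num.sqrt (1 - p ^+ 2) in pa Ea *; set b := Num.sqrt (1 - r ^+ 2) in rb Eb *.
have ab : 1 <= a + b by lra.
apply: (@le_trans _ _ (`|a - b| * (a + b))); first exact: ler_peMr.
have pr : p + r <= 1 by lra.
apply: (@le_trans _ _ (`|p - r| * (p + r))); last by apply: ler_piMr.
have Nab : a + b = `|a + b| by rewrite ger0_norm//; lra.
have Npr : p + r = `|p + r| by rewrite ger0_norm//; lra.
rewrite Nab Npr -!normrM -!subr_sqr Ea Eb -normrN le_eqVlt; apply/orP; left; apply/eqP.
by congr `|_|; ring.
Qed.

Lemma sqrt_1msqr_meas (u : R -> C) : measC u ->
  measurable_fun setT (fun x => Num.sqrt (1 - `|u x| ^+ 2)).
Proof.
move=> mu_; apply: measurableT_comp.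
  by apply: continuous_measurable_fun; exact: sqrt_continuous.
by apply: measurable_funB => //; apply: measurable_funX; exact: measC_norm.
Qed.

Lemma sqrt_1msqr_int (u a : R -> C) : measC u -> intC a ->
  intC (fun x => Num.sqrt (1 - `|u x| ^+ 2) *: a x).
Proof.
move=> mu_ ia; apply: (@intC_le _ _ (fun x => `|a x|)); last exact: intC_norm.
  by apply: measCZ; [exact: sqrt_1msqr_meas|exact: intC_meas].
by move=> x; rewrite normrZ ler_piMl// sqrt_1msqr_le1.
Qed.

Variables (a : R -> C) (T : R).
Hypothesis ia : intC a.
Hypothesis a0 : forall x, ~ `]0, T[%classic x -> a x = 0.
Hypothesis a_small : (\int[mu]_x `|a x| <= 2^-1)%R.
Local Notation i t := (\1_(`]-oo, t]%classic) : R -> R).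

Let ii t : intC (fun x => i t x *: a x) /\ forall x, `|i t x *: a x| <= `|a x|.
Proof.
have le x : `|i t x *: a x| <= `|a x|.
  by rewrite normrZ indicE; case: (_ \in _); rewrite ?normr1 ?mul1r// normr0 mul0r.
split => //; apply: (@intC_le _ _ (fun x => `|a x|)) => //; last exact: intC_norm.
by apply: measCZ; [exact: measurable_indic|exact: intC_meas].
Qed.

(** Both solutions have modulus at most [1 / 2], where the square root is 1-Lipschitz;
    the difference is halved at each application of the equation. *)
Lemma sqrt_equation_unique (u u' : R -> C) : measC u -> measC u' ->
  (forall t, 0 <= t <= T -> u t = Cint (fun x => Num.sqrt (1 - `|u x| ^+ 2) *: (i t x *: a x))) ->
  (forall t, 0 <= t <= T -> u' t = Cint (fun x => Num.sqrt (1 - `|u' x| ^+ 2) *: (i t x *: a x))) ->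
  forall t, 0 <= t <= T -> u t = u' t.
Proof.
move=> mu_ mu' uE uE'.
have bound (z : R -> C) : measC z ->
    (forall t, 0 <= t <= T -> z t = Cint (fun x => Num.sqrt (1 - `|z x| ^+ 2) *: (i t x *: a x))) ->
    forall t, 0 <= t <= T -> `|z t| <= 2^-1.
  move=> mz zE t tT; rewrite zE//; have I := sqrt_1msqr_int mz (ii t).1.
  apply: le_trans (norm_Cint I) _; apply: le_trans a_small.
  apply: le_Rint; [exact: intC_norm|exact: intC_norm|move=> x].
  rewrite normrZ; apply: le_trans _ ((ii t).2 x).
  by rewrite ler_piMl// sqrt_1msqr_le1.
have bu := bound u mu_ uE; have bu' := bound u' mu' uE'.
have contraction n : forall t, 0 <= t <= T -> `|u t - u' t| <= 1 * 2^-1 ^+ n.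
  elim: n => [|n IH] t tT.
    rewrite expr0 mulr1; apply: le_trans (ler_normB _ _) _.
    by rewrite [leRHS]splitr mul1r; apply: lerD; [exact: bu|exact: bu'].
  have I := sqrt_1msqr_int mu_ (ii t).1; have I' := sqrt_1msqr_int mu' (ii t).1.
  have J : intC (fun x => Num.sqrt (1 - `|u x| ^+ 2) *: (i t x *: a x) +
      -1 *: (Num.sqrt (1 - `|u' x| ^+ 2) *: (i t x *: a x))).
    by apply: intCD => //; exact: intCZ.
  rewrite uE// uE'// -scaleN1r -CintZ// -CintD//; last exact: intCZ.
  apply: le_trans (norm_Cint J) _.
  apply: (@le_trans _ _ (\int[mu]_x (1 * 2^-1 ^+ n * `|a x|))%R).
    apply: le_Rint; [exact: intC_norm|by apply: intRZ; exact: intC_norm|move=> x].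
    rewrite scaleN1r -scalerBl normrZ.
    have [xT|xT] := pselect (`]0, T[%classic x); last by rewrite a0// scaler0 !normr0 !mulr0.
    have xT' : 0 <= x <= T by move: xT; rewrite /= in_itv/= => /andP[/ltW -> /ltW ->].
    apply: ler_pM => //; last exact: (ii t).2.
    by apply: le_trans (sqrt_1msqr_lipschitz _ _) (IH x xT'); [exact: bu|exact: bu'].
  rewrite RintZ; last exact: intC_norm.
  rewrite exprSr mulrA; apply: ler_wpM2l a_small.
  by rewrite mul1r exprn_ge0.
by move=> t tT; apply/eqP; rewrite -subr_eq0 -normr_eq0; apply/eqP;
  apply: (@geometric_eq0 _ _ 1) => n; rewrite normr_id; exact: contraction.
Qed.

End square_root_equation.

(** * The integral equation in the rotating frame *)

Section equation.
Context {R : realType} (T : R).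
Local Notation C := (Rcomplex R).
Local Notation mu := (@lebesgue_measure R).
Local Notation X := (L2Cb R).
Hypothesis T0 : 0 < T.
Local Notation i t := (\1_(`]-oo, t]%classic) : R -> R).

(** The end points of the interval are negligible; the control is unspecified there. *)
Lemma Cintegral_itv (t : R) (g h : R -> C) : measC h ->
  (forall x, `]0, t[%classic x -> g x = h x) -> (forall x, ~ `[0, t]%classic x -> h x = 0) ->
  Cintegral `[0, t] g = Cint h.
Proof.
move=> [mr mi] gh h0.
have part (p : C -> R) : p 0 = 0 -> measurable_fun setT (fun x => p (h x)) ->
    (\int[mu]_(x in `[0, t]) p (g x) = \int[mu]_x p (h x))%R.
  move=> p0 mp.
  have E : (\int[mu]_(x in `[0, t]) p (g x) = \int[mu]_(x in `[0, t]) p (h x))%R.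
    rewrite /Rintegral; congr fine.
    have mo : measurable_fun (`]0, t[%classic : set R) (fun x => (p (h x))%:E).
      by apply/measurable_EFinP; exact: measurable_funTS.
    have mog : measurable_fun (`]0, t[%classic : set R) (fun x => (p (g x))%:E).
      by apply: eq_measurable_fun mo => x; rewrite inE => xt; rewrite gh.
    rewrite (integral_itv_bndoo true false mog) (integral_itv_bndoo true false mo).
    by apply: eq_integral => x; rewrite inE => xt; rewrite gh.
  rewrite E [LHS]Rintegral_mkcond; apply: eq_Rint => x; rewrite patchE.
  case: ifPn => // /negP xt; rewrite h0 ?p0// => xt'; apply: xt; exact: mem_set.
by apply: complex_ext => /=; apply: part.
Qed.

Variable w0 : R -> C.

(** The control of the linear problem: the sign turns the equation into one
    without a sign, and the extension by zero makes it a function on the line. *)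
Definition control : R -> C := fun x => - (\1_(`]0, T[%classic) x *: w0 x).
Local Notation w := control.
Hypothesis Lw : L2supp T w.
Local Notation a om := (fun x => cmul (w x) (wave T om x)).

(** The change of frame [Z s = U s * exp (- i om (T - s))] preserves the modulus and
    turns the right-hand side of the equation into an integral over the line against
    [wave]. *)
Lemma equation_equiv (om : R) (Z U : R -> C) (t : R) : measC U ->
  (forall s, 0 <= s <= T -> Z s = cmul (U s) (expi (- (om * (T - s))))) -> 0 <= t <= T ->
  - Cintegral `[0, t] (fun tau => Num.sqrt (1 - `|Z tau| ^+ 2) *: w0 tau * expi (- (om * tau)))
    * expi (om * t) =
  cmul (Cint (fun x => Num.sqrt (1 - `|U x| ^+ 2) *: (i t x *: a om x)))
    (expi (- (om * (T - t)))).
Proof.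
move=> mU ZU /andP[t0 tT].
have ia := intC_cmul_wave T om (L2supp_intC T0 Lw).
have iia : intC (fun x => i t x *: a om x).
  apply: (@intC_le _ _ (fun x => `|a om x|)); last exact: intC_norm.
    by apply: measCZ; [exact: measurable_indic|exact: intC_meas].
  by move=> x; rewrite normrZ indicE; case: (_ \in _); rewrite ?normr1 ?mul1r// normr0 mul0r.
pose g x := Num.sqrt (1 - `|U x| ^+ 2) *: (i t x *: a om x).
have ig : intC g by exact: sqrt_1msqr_int.
pose e : C := - expi (- (om * T)).
have H : Cintegral `[0, t] (fun tau => Num.sqrt (1 - `|Z tau| ^+ 2) *: w0 tau * expi (- (om * tau)))
    = Cint (fun x => cmul e (g x)).
  apply: Cintegral_itv.
  - by apply: measCM; [exact: continuous_measC (fun x => cvg_cst _)|exact: intC_meas].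
  - move=> x; rewrite /= in_itv/= => /andP[x0 xt].
    have xT : x < T by exact: lt_le_trans tT.
    rewrite ZU; last by rewrite !ltW.
    rewrite cmul_norm norm_expi mulr1 cmulE /g /control !indicE !mem_setE /= !in_itv/=.
    rewrite x0 xT (ltW xt) /= !scale1r !cmulZr cmulZl; congr (_ *: _).
    have -> : - (om * x) = - (om * T) + om * (T - x) by ring.
    rewrite expiD /wave /e; move: (expi _) (expi _) => z z'.
    by apply: complex_ext; case: z z' (w0 x) => [? ?] [? ?] [? ?] /=; ring.
  - move=> x nx; rewrite /g; suff -> : i t x *: a om x = 0.
      by rewrite scaler0; apply: complex_ext; rewrite /= !mulr0 ?subrr ?addr0.
    rewrite indicE mem_setE /= in_itv/=; case: leP => xt; last by rewrite scale0r.
    rewrite scale1r (_ : w x = 0).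
      by apply: complex_ext; rewrite /= !mul0r ?subrr ?addr0.
    apply: Lw.2; apply: contra_not nx; rewrite /= !in_itv/= => /andP[x0 _].
    by rewrite (ltW x0).
rewrite H (CintM e ig) cmulE.
have -> : - (om * (T - t)) = - (om * T) + om * t by ring.
rewrite expiD /e; move: (Cint g) (expi _) (expi _) => [? ?] [? ?] [? ?].
by apply: complex_ext => /=; ring.
Qed.

End equation.

(** * The first component solves the equation with a square root *)

Section flow.
Context {R : realType} (T : R).
Local Notation C := (Rcomplex R).
Local Notation mu := (@lebesgue_measure R).
Local Notation X := (L2Cb R).
Hypothesis T0 : 0 < T.
Local Notation i t := (\1_(`]-oo, t]%classic) : R -> R).
Variables (w : R -> C) (y : bool * R -> X).
Hypothesis Lw : L2supp T w.
Hypothesis w_small : Num.sqrt T * n2 w <= 1 / 6.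
Hypothesis sy : states y.
Hypothesis yE : y = state_src T w + state_op T w y.
Local Notation a om := (fun x => cmul (w x) (wave T om x)).
Local Notation m om := (fun x => 1 + complex.Re (y (false, x) om)).

Let ia om : intC (a om). Proof. by apply: intC_cmul_wave; exact: (L2supp_intC T0 Lw). Qed.

Let icut t om x : cmul (cut t w x) (wave T om x) = i t x *: a om x.
Proof. by rewrite /cut cmulZl. Qed.

Let iia t om : intC (fun x => i t x *: a om x).
Proof.
apply: (@intC_le _ _ (fun x => `|a om x|)); last exact: intC_norm.
  by apply: measCZ; [exact: measurable_indic|exact: intC_meas].
by move=> x; rewrite normrZ indicE; case: (_ \in _); rewrite ?normr1 ?mul1r// normr0 mul0r.
Qed.

Let cy c om : continuous (fun t => y (c, t) om).
Proof. by move=> t; apply: (path_cvg (f := fun t => y (c, t))); exact: sy. Qed.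

Lemma flow_false t om : y (false, t) om =
  Complex (- (\int[mu]_x rip (i t x *: a om x) (y (true, x) om))%R) 0.
Proof.
rewrite {1}yE -[LHS]/((0 + state_op T w y (false, t) : X) om) add0r /state_op /=.
rewrite (integral_opE T0 false (cut_L2supp t Lw) (sy true)) superposeE.
have iR : intR (fun x => rip (i t x *: a om x) (y (true, x) om)).
  have [B yB] := (sy true).2.
  apply: (@intR_le _ _ (fun x => B * `|i t x *: a om x|)).
  - by apply: rip_meas; [exact: intC_meas|apply: continuous_measC; exact: cy].
  - move=> x; rewrite (le_trans (rip_le _ _))// mulrC ler_wpM2r//.
    by apply: le_trans (yB x); exact: L2Cb_ler_norm.
  - by apply: intRZ; exact: intC_norm.
apply: complex_ext => /=.
  rewrite -[RHS]mulN1r -RintZ//; apply: eq_Rint => x.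
  by rewrite pairing_falseE icut mulN1r.
rewrite -[RHS](@Rint_cst0 R); apply: eq_Rint => x.
by rewrite pairing_falseE.
Qed.

Lemma flow_true t om : y (true, t) om = Cint (fun x => m om x *: (i t x *: a om x)).
Proof.
rewrite {1}yE -[LHS]/((state_src T w (true, t) : R -> C) om + state_op T w y (true, t) om).
rewrite /state_src /state_op /= (transformE T0 (cut_L2supp t Lw)) FtE.
rewrite (integral_opE T0 true (cut_L2supp t Lw) (sy false)) superposeE -CintD.
- apply: eq_Cint => x; rewrite pairing_trueE !icut flow_false scalerDl scale1r; congr (_ + _).
  rewrite [RHS](_ : _ = cmul (Complex (complex.Re (y (false, x) om)) 0) (i t x *: a om x)).
    by rewrite flow_false cmulC.
  rewrite flow_false; exact: cmulZl1.
- by apply: intC_cmul_wave; exact: (L2supp_intC T0 (cut_L2supp t Lw)).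
- exact: (superpose_int T T0 true om (cut_L2supp t Lw) (sy false)).
Qed.

Let cm om : continuous (m om).
Proof.
move=> t; apply: cvgD; first exact: cvg_cst.
by have [h _] := cvg_ReIm (@cy false om t).
Qed.

Lemma flow_conservation om t : 0 <= t -> `|y (true, t) om| ^+ 2 + m om t ^+ 2 = 1.
Proof.
have [B1 yB1] := (sy true).2; have [B2 yB2] := (sy false).2.
apply: (@conservation _ (a om) (fun t => y (true, t) om) (m om) (Num.max B1 (1 + B2))) => //.
- move=> x x0; rewrite Lw.2; last by rewrite /= in_itv/= ltNge x0.
  by apply: complex_ext; rewrite /= !mul0r ?subrr ?addr0.
- by move=> s; rewrite le_max (le_trans (L2Cb_ler_norm _ _) (yB1 s)).
- move=> s; rewrite le_max; apply/orP; right; apply: le_trans (ler_normD _ _) _.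
  rewrite normr1 lerD2l; apply: le_trans (Re_le_norm _) _.
  exact: le_trans (L2Cb_ler_norm _ _) (yB2 s).
- by move=> s; exact: flow_true.
- by move=> s; rewrite flow_false.
Qed.

Lemma flow_norm_le1 om t : 0 <= t -> `|y (true, t) om| <= 1.
Proof.
move=> t0; rewrite -(@ler_pXn2r _ 2) ?nnegrE// expr1n -(flow_conservation om t0).
by rewrite lerDl sqr_ge0.
Qed.

(** The second component stays close to its initial value [1], so it is the
    nonnegative square root. *)
Lemma flow_positive om t : 0 <= m om t.
Proof.
have iR x : `|rip (i t x *: a om x) (y (true, x) om)| <= `|w x|.
  have [x0|x0] := leP 0 x; last first.
    rewrite Lw.2; last by rewrite /= in_itv/= ltNge (ltW x0).
    rewrite (_ : cmul 0 _ = 0); last by apply: complex_ext; rewrite /= !mul0r ?subrr ?addr0.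
    by rewrite scaler0 /rip /= !mul0r addr0 !normr0.
  apply: le_trans (rip_le _ _) _; rewrite -[leRHS]mulr1; apply: ler_pM => //; last exact: flow_norm_le1.
  rewrite normrZ cmul_norm wave_norm mulr1 indicE.
  by case: (_ \in _); rewrite ?normr1 ?mul1r// normr0 mul0r.
have iw := L2supp_intC T0 Lw.
have iI : intR (fun x => rip (i t x *: a om x) (y (true, x) om)).
  apply: (intR_le _ iR (intC_norm iw)).
  by apply: rip_meas; [exact: intC_meas|apply: continuous_measC; exact: cy].
have : `|\int[mu]_x rip (i t x *: a om x) (y (true, x) om)|%R <= 1 / 6.
  apply: le_trans (normr_Rint iI) _; apply: le_trans w_small; apply: le_trans (L1_bound T0 Lw).
  by apply: le_Rint => //; [exact: intR_norm|exact: intC_norm].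
rewrite flow_false /= ler_norml => /andP[_ h].
by rewrite subr_ge0 (le_trans h)// ler_pdivrMr// mul1r ler1n.
Qed.

(** Conservation of the norm identifies the factor [1 + y (false, x)] of the linear
    system with the square root of the nonlinear equation. *)
Lemma flow_sqrt om t : y (true, t) om =
  Cint (fun x => Num.sqrt (1 - `|y (true, x) om| ^+ 2) *: (i t x *: a om x)).
Proof.
rewrite flow_true; apply: eq_Cint => x.
have [x0|x0] := leP 0 x; last first.
  rewrite Lw.2; last by rewrite /= in_itv/= ltNge (ltW x0).
  rewrite (_ : cmul 0 _ = 0); last by apply: complex_ext; rewrite /= !mul0r ?subrr ?addr0.
  by rewrite !scaler0.
congr (_ *: _).
have -> : 1 - `|y (true, x) om| ^+ 2 = m om x ^+ 2.
  by rewrite -[X in X - _](flow_conservation om x0) addrAC subrr add0r.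
by rewrite sqrtr_sqr ger0_norm// flow_positive.
Qed.

End flow.

(** * The end point map *)

Section end_point.
Context {R : realType} (T : R).
Local Notation C := (Rcomplex R).
Local Notation mu := (@lebesgue_measure R).
Local Notation X := (L2Cb R).
Hypothesis T0 : 0 < T.
Variables (w0 : R -> C) (y : bool * R -> X).
Local Notation w := (control T w0).
Hypothesis Lw : L2supp T w.
Hypothesis w_small : Num.sqrt T * n2 w <= 1 / 6.
Hypothesis sy : states y.
Hypothesis yE : y = state_src T w + state_op T w y.
Local Notation i t := (\1_(`]-oo, t]%classic) : R -> R).
Local Notation a om := (fun x => cmul (w x) (wave T om x)).
Local Notation u := (fun t => y (true, t)).

Let phase (t om : R) : C := expi (- (om * (T - t))).
(** Back to the original frame. *)
Definition solution (t om : R) : C := cmul (u t om) (phase t om).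

Lemma phase_continuous t om : expi (- (p.2 * (T - p.1))) @[p --> (t, om)] --> (phase t om : C).
Proof.
apply: cvg_expi; apply: cvgN; apply: cvgM; first exact: cvg_snd.
by apply: cvgB; [exact: cvg_cst|exact: cvg_fst].
Qed.

Let mphase t : measC (phase t).
Proof.
apply: continuous_measC => om; apply: cvg_expi; apply: cvgN; apply: cvgMl; exact: cvg_id.
Qed.

Let norm_phase t om : `|phase t om| = 1. Proof. exact: norm_expi. Qed.

Let Lsol t : L2 setT (solution t).
Proof.
have [Lu cu _] := L2CbP (u t); apply: (n2_le Lu _ _).1.
  by apply: measCM; [exact: continuous_measC|exact: mphase].
by move=> om; rewrite cmul_norm norm_phase mulr1.
Qed.

(** The motion of the state is continuous in norm; the rotation of a fixed state is
    continuous by dominated convergence. *)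
Lemma solution_L2_continuous t : n2 (solution s - solution t) @[s --> t] --> (0 : R).
Proof.
have [Lu cu _] := L2CbP (u t).
pose rot s om : C := cmul (u t om) (phase s om - phase t om).
have mrot s : measC (rot s).
  apply: measCM; first exact: continuous_measC.
  have -> : (fun om => phase s om - phase t om) = (fun om => phase s om + (-1) *: phase t om).
    by apply/funext => om; rewrite scaleN1r.
  apply: measCD; first exact: mphase.
  by apply: (measCZ (h := fun=> -1)) => //; exact: mphase.
have rot_le s om : `|rot s om| <= `|(2 *: (u t : R -> C)) om|.
  rewrite cmul_norm !fctE normrZ mulrC; apply: ler_wpM2r => //.
  apply: le_trans (ler_normB _ _) _; rewrite !norm_phase ger0_norm//.
have L2u := L2Z 2 Lu.
have Lrot s : L2 setT (rot s) by exact: (n2_le L2u (mrot s) (rot_le s)).1.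
have rot0 : n2 (rot s) @[s --> t] --> (0 : R).
  apply/(@cvg_nbhsP _ R^o) => v vt.
  apply: (@n2_dominated _ _ _ set0 L2u (fun n => mrot (v n)) (fun n => rot_le (v n))) => //.
  move=> om _; have -> : (0 : C) = cmul (u t om) (phase t om - phase t om).
    by rewrite subrr; apply: complex_ext; rewrite /= !mulr0 ?subrr ?addr0.
  have h : phase (v n) om @[n --> \oo] --> phase t om.
    by apply: cvg_expi; apply: cvgN; apply: cvgMr; apply: cvgB; [exact: cvg_cst|exact: vt].
  apply: cvg_cmul; first exact: cvg_cst.
  exact: (cvgB h (cvg_cst (phase t om))).
have du : `|u s - u t| + n2 (rot s) @[s --> t] --> (0 : R).
  rewrite -(addr0 (0 : R)); apply: cvgD => //.
  have h : u s @[s --> t] --> u t by exact: (sy true).1 t.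
  apply/cvgrPdist_le => e e0; move/cvgrPdist_le : h => /(_ e e0); apply: filterS => s.
  by rewrite sub0r normrN normr_id distrC.
have n0 : (0 : R) @[s --> t] --> (0 : R) by exact: cvg_cst.
apply: squeeze_cvgr n0 du; near=> s; rewrite n2_ge0 /=.
pose mov om := cmul ((u s - u t) om) (phase s om).
have [Ld cd _] := L2CbP (u s - u t).
have mmov : measC mov by apply: measCM; [exact: continuous_measC|exact: mphase].
have [Lm nm] : L2 setT mov /\ n2 mov <= n2 (u s - u t).
  by apply: (n2_le Ld mmov) => om; rewrite cmul_norm norm_phase mulr1.
have -> : solution s - solution t = mov + rot s.
  apply/funext => om; rewrite !fctE /solution /mov /rot.
  have -> : (u s - u t) om = u s om + (-1) *: u t om by rewrite scaleN1r.
  have -> : phase s om - phase t om = phase s om + (-1) *: phase t om by rewrite scaleN1r.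
  by rewrite cmulDl cmulDr cmulZl cmulZr !scaleN1r addrA subrK.
apply: le_trans (n2D Lm (Lrot s)) _; apply: lerD => //.
apply: le_trans nm _; exact: nu_le true (u s - u t).
Unshelve. all: by end_near. Qed.

Lemma state_continuous2 t om : u p.1 p.2 @[p --> (t, om)] --> u t om.
Proof.
apply/cvgrPdist_le => e e0; have e2 : 0 < e / 2 by rewrite divr_gt0.
have [_ cu _] := L2CbP (u t).
have H1 : \forall p \near (t, om), `|u t - u p.1| <= e / 2.
  have /cvgrPdist_le/(_ _ e2) h := (sy true).1 t.
  have c1 : p.1 @[p --> (t, om)] --> t by exact: cvg_fst.
  exact: (c1 _ h).
have H2 : \forall p \near (t, om), `|u t om - u t p.2| <= e / 2.
  have /cvgrPdist_le/(_ _ e2) h := cu om.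
  have c2 : p.2 @[p --> (t, om)] --> om by exact: cvg_snd.
  exact: (c2 _ h).
near=> p.
have -> : u t om - u p.1 p.2 = (u t om - u t p.2) + (u t p.2 - u p.1 p.2) by rewrite addrA subrK.
rewrite [leRHS]splitr; apply: le_trans (ler_normD _ _) _; apply: lerD; first by near: p.
apply: le_trans (L2Cb_ler_norm (u t - u p.1) p.2) _; by near: p.
Unshelve. all: by end_near. Qed.

Lemma solution_in_space : solution_space T solution.
Proof.
split.
- by move=> t _; exact: Lsol.
- move=> t _; apply: cvg_within_filter.
  have -> : (fun s => L2norm setT (solution s - solution t)) =
      (fun s => (n2 (solution s - solution t))%:E).
    by apply/funext => s; rewrite L2norm_n2//; exact: L2B.
  apply: cvg_EFin; first exact: nearW.
  exact: solution_L2_continuous.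
- apply: continuous_subspaceT => -[t om]; apply: cvg_cmul; first exact: state_continuous2.
  exact: phase_continuous.
- have [B yB] := (sy true).2; exists B => -[t om] _ /=.
  rewrite cmul_norm norm_phase mulr1; exact: le_trans (L2Cb_ler_norm _ _) (yB t).
Qed.

Let mu_ om : measC (fun t => u t om).
Proof.
by apply: continuous_measC => t; apply: (path_cvg (f := fun t => y (true, t))); exact: sy.
Qed.

Lemma solution_solves : solves_equation T w0 solution.
Proof.
move=> t om; rewrite in_itv/= => tT.
rewrite (@equation_equiv _ _ T0 _ Lw om (fun s => solution s om) (fun s => u s om) t)//.
by rewrite -flow_sqrt.
Qed.

Let clamp (t : R) : R := Num.max 0 (Num.min t T).

Let clamp_in t : 0 <= clamp t <= T.
Proof. by rewrite /clamp le_max lexx/= ge_max (ltW T0)/= ge_min lexx orbT. Qed.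

Let clamp_id t : 0 <= t <= T -> clamp t = t.
Proof. by move=> /andP[t0 tT]; rewrite /clamp; move/min_idPl : tT => ->; exact/max_idPr. Qed.

(** At each frequency, a solution seen in the rotating frame solves the equation with
    a square root. Times are clamped to the segment to get functions on the line. *)
Lemma solution_unique (Z : R -> R -> C) : solution_space T Z -> solves_equation T w0 Z ->
  Z T = u T :> (R -> C).
Proof.
move=> [_ _ cZ _] eZ; apply/funext => om.
pose U t : C := cmul (Z (clamp t) om) (expi (om * (T - clamp t))).
have mU : measC U.
  apply: continuous_measC => t.
  have ct : clamp s @[s --> t] --> clamp t.
    apply: (@continuous_max R R (fun=> 0) (fun s => Num.min s T)); first exact: cvg_cst.
    by apply: (@continuous_min R R id (fun=> T)); [exact: cvg_id|exact: cvg_cst].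
  apply: cvg_cmul; last first.
    by apply: cvg_expi; apply: cvgMr; apply: cvgB => //; exact: cvg_cst.
  have /subspace_continuousP/(_ (clamp t, om)) := cZ.
  have tin : (`[0, T] `*` setT)%classic (clamp t, om) by split => //=; rewrite in_itv/= clamp_in.
  move=> /(_ tin) H.
  apply: (cvg_comp (fun s => (clamp s, om)) (fun p : R * R => Z p.1 p.2) _ H).
  have cp : (clamp s, om) @[s --> t] --> (clamp t, om) by exact: (cvg_pair ct (cvg_cst om)).
  move=> P /= wP; have h : \forall s \near t, (`[0, T] `*` setT)%classic (clamp s, om) -> P (clamp s, om) := cp _ wP.
  apply: filterS h => s; apply; split => //=; by rewrite in_itv/= clamp_in.
have EE s : cmul (expi (om * (T - s))) (expi (- (om * (T - s)))) = Complex 1 0 :> C.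
  by rewrite -expiD subrr expi0.
have ZU s : 0 <= s <= T -> Z s om = cmul (U s) (expi (- (om * (T - s)))).
  by move=> sT; rewrite /U clamp_id// -cmulA EE cmulC cmul1.
have UE t : 0 <= t <= T -> U t = Cint (fun x => Num.sqrt (1 - `|U x| ^+ 2) *: (i t x *: a om x)).
  move=> tT; rewrite {1}/U clamp_id// eZ; last by rewrite in_itv.
  rewrite (@equation_equiv _ _ T0 _ Lw om (fun s => Z s om) U t)//.
  by rewrite -cmulA [X in cmul _ X]cmulC EE cmulC cmul1.
have ia : intC (a om) by apply: intC_cmul_wave; exact: (L2supp_intC T0 Lw).
have TT : 0 <= T <= T by rewrite (ltW T0) lexx.
rewrite (ZU T TT).
rewrite (@sqrt_equation_unique _ (a om) T ia _ _ U (fun t => u t om) mU (mu_ om) UE)//.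
- by rewrite subrr mulr0 oppr0 expi0 cmulC cmul1.
- move=> x nx; rewrite Lw.2//.
  by apply: complex_ext; rewrite /= !mul0r ?subrr ?addr0.
- apply: (@le_trans _ _ (1 / 6)); last lra.
  apply: le_trans w_small; apply: le_trans (L1_bound T0 Lw).
  by apply: le_Rint; [exact: intC_norm|exact: intC_norm (L2supp_intC T0 Lw)|move=> x; rewrite cmul_norm wave_norm mulr1].
- by move=> t _; exact: flow_sqrt.
Qed.

(** The set in the definition of the end point map is the singleton of the final
    state. *)
Theorem end_point_mapE : end_point_map T w0 = u T.
Proof.
have uT : solution T = u T.
  by apply/funext => om; rewrite /solution /phase subrr mulr0 oppr0 expi0 cmulC cmul1.
have [Z sZ [eZ EZ]] : [set f : X | exists2 Z, solution_space T Z &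
    solves_equation T w0 Z /\ f = Z T :> (R -> C)] (end_point_map T w0).
  apply: getPex; exists (u T), solution; first exact: solution_in_space.
  by split; [exact: solution_solves|rewrite uT].
by apply/val_inj; rewrite [LHS]EZ; exact: solution_unique.
Qed.

End end_point.

(** * The image of the end point map is a graph *)

#[local] Opaque sinv volterra.

Section image.
Context {R : realType} (T : R).
Local Notation C := (Rcomplex R).
Local Notation mu := (@lebesgue_measure R).
Local Notation X := (L2Cb R).
Local Notation Ft := (wave_transform T).
Local Notation planch := (planch T).
Local Notation transform := (transform T).
Local Notation sinv := (sinv T).
Local Notation q := (control_norm T).
Hypothesis T0 : 0 < T.

(** The states driven by the control [sinv x]. *)
Definition flow (x : X) : bool * R -> X :=
  volterra (@states R) (control_op T) x (control_src T x).

Definition remainder : X -> X :=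
  volterra_rest (@states R) (control_op T) (control_src T) (true, T).

Definition projection (x : X) : X := transform (sinv x).

Let norm_nu (x : X) : `|x| <= nu true x + nu false x. Proof. by rewrite norm_L2Cb. Qed.

Lemma control_norm_L2Cb (x : X) : q x <= Num.sqrt T / Num.sqrt planch * `|x|.
Proof.
apply: le_trans (control_norm_n2 T0 x) _; apply: ler_wpM2l; last exact: nu_le true x.
by rewrite divr_ge0 ?sqrtr_ge0.
Qed.

Let sL x : L2supp T (sinv x). Proof. exact: (sinvP T0 x).1. Qed.
Let Sop x y : states y -> states (control_op T x y).
Proof. by move=> sy; exact: (state_op_states T0 (sL x) sy). Qed.
Let Ssrc x : states (control_src T x).
Proof. exact: (state_src_states T0 (sL x)). Qed.

Lemma flowP x : q x <= 1 / 6 ->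
  states (flow x) /\ flow x = control_src T x + control_op T x (flow x).
Proof.
move=> qx.
exact: (volterraP (nu := @nu R) (q := q) (@nuD R) (@nuZ R) (@nu_le R) norm_nu
  (@states_lin R) (@states_bounded R) (@states_lim R)
  Sop (control_op_linr T0) (control_op_bound T0) qx (Ssrc x)).
Qed.

Lemma remainder_C1 r : r <= 1 / 6 -> C1_on [set x : X | q x < r] remainder.
Proof.
exact: (volterra_rest_C1 (nu := @nu R) (q := q) (@nuD R) (@nuZ R) (@nu_le R) norm_nu
  (control_normD T0) (control_normZ T0) control_norm_L2Cb (kappa_ge0 T)
  (@states_lin R) (@states_bounded R) (@states_lim R)
  Sop (control_op_linr T0) (control_op_linl T0) (control_op_bound T0) Ssrc
  (control_src_lin T0) (control_src_bound T0) (true, T)).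
Qed.

Lemma remainder_nu c x x' : q x <= 1 / 6 -> q x' <= 1 / 6 ->
  nu c (remainder x - remainder x') <= 11 / 25 * (kappa T c * q (x - x')).
Proof.
exact: (volterra_rest_lipschitz (nu := @nu R) (q := q) (@nuD R) (@nuZ R) (@nu_le R) norm_nu
  (control_normD T0) (control_normZ T0) (kappa_ge0 T)
  (@states_lin R) (@states_bounded R) (@states_lim R)
  Sop (control_op_linr T0) (control_op_linl T0) (control_op_bound T0) Ssrc
  (control_src_lin T0) (control_src_bound T0) (true, T)).
Qed.

(** The seminorm of a difference is at most its L2 norm times [sqrt T / sqrt planch],
    which compensates [kappa]: the contraction constant is that of the Volterra
    equation. *)
Lemma remainder_lipschitz r : r <= 1 / 6 ->
  q_lipschitz q (11 / 25) (11 / 25 * (kappa T true + kappa T false)) [set x : X | q x < r] remainder.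
Proof.
move=> r6 x y qx qy.
have h c := remainder_nu c (le_trans (ltW qx) r6) (le_trans (ltW qy) r6).
have p0 := planch_gt0 T; split.
  apply: le_trans (control_norm_n2 T0 _) _.
  have := h true; move: (remainder x - remainder y) => z hz.
  have k0 : 0 < Num.sqrt T / Num.sqrt planch by rewrite divr_gt0// sqrtr_gt0.
  rewrite -ler_pdivlMl//; apply: le_trans hz _.
  by rewrite invf_div mulrCA [kappa T true * _]mulrC /kappa mulrC !mulrA.
rewrite norm_L2Cb; apply: le_trans (lerD (h true) (h false)) _.
by rewrite -mulrDr -mulrDl mulrA.
Qed.

Lemma remainder0 : remainder 0 = 0.
Proof.
have q00 : q 0 = 0 by have := control_normZ T0 0 0; rewrite scale0r normr0 mul0r.
have q06 : q 0 <= 1 / 6 by rewrite q00 divr_ge0.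
have [sy yE] := flowP q06; have [B yB] := states_bounded sy.
apply: eq_of_nu => c; rewrite subr0.
have -> : remainder 0 = control_op T 0 (flow 0) (true, T).
  rewrite /remainder /volterra_rest -/(flow 0) {1}yE.
  by rewrite -[(_ + _) (true, T)]/(control_src T 0 (true, T) + control_op T 0 (flow 0) (true, T)) addrC addKr.
have yM i : nu c (flow 0 i) <= B by exact: le_trans (nu_le c _) (yB i).
by have := @control_op_bound R T T0 c 0 (flow 0) B sy yM (true, T); rewrite q00 mul0r.
Qed.

Lemma projection_linear : linear projection.
Proof.
move=> a x y; rewrite /projection.
rewrite -(transformD T0 a (sL x) (sL y)).
apply: (transform_eq T0 (sL _) (L2suppD (L2suppZ a (sL x)) (sL y))).
exact: sinv_lin.
Qed.

Lemma projection_idem x : projection (projection x) = projection x.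
Proof. by apply: transform_eq => //; exact: sinv_transform. Qed.

Lemma projection_bound x : `|projection x| <= (kappa T true + kappa T false) * q x.
Proof. by rewrite norm_L2Cb mulrDl; apply: lerD; exact: transform_nu. Qed.

Lemma projection_transform w : L2supp T w -> projection (transform w) = transform w.
Proof. by move=> Lw; apply: transform_eq => //; exact: sinv_transform. Qed.

Lemma projection_nontrivial : exists2 e : X, e != 0 & projection e = e.
Proof.
have [L1 n1] := L2_ind_itv (ltW T0).
have Lw : L2supp T (indC `]0, T[) by split => // x nx; exact: indC_off.
exists (transform (indC `]0, T[)); last exact: projection_transform.
apply/eqP => E; have := control_norm_transform T0 Lw; rewrite E.
have -> : q 0 = 0 by have := control_normZ T0 0 0; rewrite scale0r normr0 mul0r.
move=> /esym/eqP; rewrite mulf_eq0 gt_eqF ?sqrtr_gt0//= => /eqP n0.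
by move: n1; rewrite n0 expr0n/= subr0 => T00; move: T0; rewrite -T00 ltxx.
Qed.

(** The transform of the indicator of an interval beyond [T]: by Plancherel's
    identity it is orthogonal to the transforms of all controls. *)
Definition far (k : nat) : X := in_L2Cb (Ft (indC `](k.+1%:R * T), (k.+2%:R * T)[)).

Let le_kT (k l : nat) : (k <= l)%N -> k%:R * T <= l%:R * T.
Proof. by move=> kl; rewrite ler_wpM2r ?(ltW T0)// ler_nat. Qed.

Lemma farE k : far k = Ft (indC `](k.+1%:R * T), (k.+2%:R * T)[) :> (R -> C).
Proof.
have h := le_kT (leqnSn k.+1); apply: in_L2CbE; first exact: Ft_ind_L2.
  by apply: Ft_continuous; exact: intC_ind.
by exists (k.+2%:R * T - k.+1%:R * T) => x _; exact: Ft_ind_le.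
Qed.

Lemma control_norm_far k : q (far k) = 0.
Proof.
have h := le_kT (leqnSn k.+1); have L0 : L2supp T (0 : R -> C) by split => //; exact: L2_0.
suff E : n2 (sinv (far k) - 0) = 0.
  by rewrite /control_norm (n2_close (sL _) L0 E) n2_0 mulr0.
apply: (@left_inverse_test _ T T (far k) _ _ L0 (sinvP T0 _)) => w Lw.
rewrite ip_null; [|exact: L2_0|exact: Lw.1|exact: n2_0].
rewrite mulr0 farE.
have b0 : 0 < k.+2%:R * T by rewrite mulr_gt0.
have Lv : L2supp (k.+2%:R * T) (indC `](k.+1%:R * T), (k.+2%:R * T)[ : R -> C).
  split; first exact: (L2_ind_itv h).1.
  move=> x nx; apply: indC_off; apply: contra_not nx; rewrite /= !in_itv/= => /andP[h1 ->].
  by rewrite andbT; apply: le_lt_trans h1; rewrite mulr_ge0// ltW.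
have Lw' : L2supp (k.+2%:R * T) w.
  split; first exact: Lw.1.
  move=> x nx; apply: Lw.2; apply: contra_not nx; rewrite /= !in_itv/= => /andP[-> h2].
  apply: lt_le_trans h2 _; rewrite -[leLHS]mul1r; exact: (le_kT (k := 1)).
rewrite (plancherel T b0 Lv Lw') [X in planch * X](_ : _ = 0) ?mulr0//.
rewrite -[RHS](@Rint_cst0 R); apply: eq_Rint => x.
have [xT|xT] := ltP x T; last first.
  rewrite Lw.2; first by rewrite /rip /= !mulr0 addr0.
  by rewrite /= in_itv/= => /andP[_]; rewrite ltNge xT.
rewrite indC_off; first by rewrite /rip /= !mul0r addr0.
rewrite /= in_itv/= => /andP[h1 _]; move: (lt_trans h1 xT).
by rewrite ltNge -[leLHS]mul1r (le_kT (k := 1)).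
Qed.

Lemma ip_far j k : ip (far j) (far k) = if j == k then planch * T else 0.
Proof.
have h l := le_kT (leqnSn l.+1).
have lt_case (l l' : nat) : (l < l')%N -> ip (far l) (far l') = 0.
  move=> ll; have h' : l.+2%:R * T <= l'.+1%:R * T by exact: le_kT.
  by rewrite (farE l) (farE l'); exact: (ip_h_disjoint T (h l) h' (h l')).
case: ltngtP => [jk|kj|->]; first exact: (lt_case _ _ jk).
  by rewrite ipC (lt_case _ _ kj).
have Lk : L2 setT (Ft (indC `](k.+1%:R * T), (k.+2%:R * T)[)) by exact: Ft_ind_L2.
rewrite !farE (ip_sqr Lk) Ft_ind_n2// -mulrBl -natrB// subSn// subnn mul1r.
by [].
Qed.

Lemma ip_sumZ n (a : 'I_n -> R) (v : 'I_n -> X) (f : X) :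
  ip (\sum_i a i *: v i : X) f = \sum_i a i * ip (v i) f.
Proof.
have [Lf _ _] := L2CbP f.
rewrite (big_morph (fun x : X => ip x f) (id1 := 0) (op1 := +%R)).
- by apply: eq_bigr => i _; have [Lv _ _] := L2CbP (v i); exact: (ipZl _ Lv Lf).
- by move=> x y; have [Lx _ _] := L2CbP x; have [Ly _ _] := L2CbP y; exact: (ipDl Lx Ly Lf).
- by apply: ip_null; [exact: L2_0|exact: Lf|exact: n2_0].
Qed.

(** Transforms of pairwise disjoint intervals beyond [T] are orthogonal to one another. *)
Lemma kernel_infinite n : exists v : 'I_n -> X, (forall i, q (v i) = 0) /\
  forall a : 'I_n -> R, \sum_i a i *: v i = 0 -> forall i, a i = 0.
Proof.
exists (fun i => far i); split; first by move=> i; exact: control_norm_far.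
move=> a E j; have := ip_sumZ a (fun i => far i) (far j); rewrite E.
rewrite (bigD1 j)//= big1; last first.
  by move=> i /negPf ij; rewrite ip_far (_ : (_ == _) = (i == j))// ij mulr0.
have [Lj _ _] := L2CbP (far j).
rewrite ip_null; [|exact: L2_0|exact: Lj|exact: n2_0].
rewrite ip_far eqxx addr0 => /esym/eqP.
by rewrite mulf_eq0 [_ * T == 0]mulf_eq0 (gt_eqF T0) (gt_eqF (planch_gt0 T)) !orbF => /eqP.
Qed.

Lemma L2norm_control (w0 : R -> C) :
  L2norm setT (control T w0) = L2norm `]0, T[ w0.
Proof.
rewrite /L2norm; congr (_ `^ _)%E; rewrite [RHS]integral_mkcond; apply: eq_integral => x _.
rewrite patchE /control normrN normrZ indicE ger0_norm//.
by case: (_ \in _); rewrite ?mul1r// mul0r expr0n.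
Qed.

Lemma control_L2supp (w0 : R -> C) : L2 `]0, T[ w0 -> L2supp T (control T w0).
Proof.
move=> [mr mi nf]; split; last first.
  by move=> x nx; rewrite /control indicE memNset ?scale0r ?oppr0.
have part (p : C -> R) : (forall a z, p (a *: z) = a * p z) ->
    measurable_fun `]0, T[ (fun x => p (w0 x)) ->
    measurable_fun setT (fun x => p (control T w0 x)).
  move=> pZ mp; have D : measurable (`]0, T[%classic : set R) by [].
  have := (measurable_restrictT (fun x => p (w0 x)) D).1 mp => mp'.
  rewrite (_ : (fun x => p (control T w0 x)) = fun x => -1 * ((fun x => p (w0 x)) \_ `]0, T[) x).
    exact: measurable_funM.
  apply/funext => x; rewrite /control -scaleN1r !pZ patchE indicE; congr (_ * _).
  by case: ifP => _; rewrite ?mul1r ?mul0r.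
split; last by rewrite L2norm_control.
  by apply: (part (@complex.Re R)) => // a z; exact: ReZ.
by apply: (part (@complex.Im R)) => // a z; exact: ImZ.
Qed.

Local Notation radius := (1 / (4 * Num.sqrt 3) : R).

Lemma radius_le : radius <= 1 / 6.
Proof.
have h : 3 / 2 <= Num.sqrt 3 :> R.
  rewrite -(@ler_pXn2r _ 2) ?nnegrE ?divr_ge0 ?sqrtr_ge0// sqr_sqrtr//; lra.
by rewrite !mul1r lef_pV2 ?posrE ?mulr_gt0 ?sqrtr_gt0//; lra.
Qed.

(** The ball of controls is the ball of [control_norm]. *)
Lemma radius_scale : Num.sqrt T * (1 / (4 * Num.sqrt (3 * T))) = radius.
Proof.
have sT : Num.sqrt T != 0 by rewrite gt_eqF// sqrtr_gt0.
have s3 : Num.sqrt 3 != 0 :> R by rewrite gt_eqF// sqrtr_gt0.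
rewrite sqrtrM//; field; exact/andP.
Qed.

(** The control of an element [x] of the range of the transform is minus [sinv x]; its
    end point is [x + remainder x]. *)
Lemma image_end_point_map :
  end_point_map T @` L2_ball `]0, T[ (1 / (4 * Num.sqrt (3 * T))) =
  (fun x : X => x + remainder x) @` [set x | q x < radius /\ projection x = x].
Proof.
have sT : 0 < Num.sqrt T by rewrite sqrtr_gt0.
have main w0 x : L2supp T (control T w0) -> n2 (control T w0 - sinv x) = 0 ->
    projection x = x -> q x < radius -> end_point_map T w0 = x + remainder x.
  move=> Lw E Px qx; have q6 : q x <= 1 / 6 by exact: le_trans (ltW qx) radius_le.
  have [sy yE] := flowP q6.
  rewrite (end_point_mapE T0 Lw _ sy).
  - rewrite /remainder /volterra_rest -/(flow x).
    have -> : control_src T x (true, T) = x.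
      by rewrite /control_src /state_src /= cut_full.
    by rewrite addrCA subrr addr0.
  - by rewrite (n2_close Lw (sL x) E).
  - by rewrite (state_src_eq T0 Lw (sL x) E) (state_op_eq T0 Lw (sL x) sy E).
apply/seteqP; split => [_ [w0 [Lw0 nw0] <-]|_ [x [qx Px] <-]].
  have Lw := control_L2supp Lw0; exists (transform (control T w0)).
    split; last exact: projection_transform.
    rewrite (control_norm_transform T0 Lw) -radius_scale ltr_pM2l//.
    by move: nw0; rewrite -L2norm_control (L2norm_n2 Lw.1) lte_fin.
  apply/esym; apply: main => //.
  - rewrite -opprB n2N; first exact: sinv_transform.
    by apply: L2B; [exact: (sL _).1|exact: Lw.1].
  - exact: projection_transform.
  - rewrite (control_norm_transform T0 Lw) -radius_scale ltr_pM2l//.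
    by move: nw0; rewrite -L2norm_control (L2norm_n2 Lw.1) lte_fin.
have Ew : control T (- sinv x) = sinv x.
  apply/funext => y; rewrite /control indicE.
  have [yT|yT] := pselect (`]0, T[%classic y); first by rewrite mem_set// scale1r opprK.
  by rewrite memNset// scale0r oppr0 (sL x).2.
exists (- sinv x); last by apply: main => //; rewrite Ew// subrr n2_0.
have Nx : L2norm `]0, T[ (- sinv x) = (n2 (sinv x))%:E.
  by rewrite -L2norm_control Ew L2norm_n2//; exact: (sL x).1.
have [mr mi _] := L2N (sL x).1.
split; last by rewrite Nx lte_fin -(ltr_pM2l sT) radius_scale.
by split; [exact: measurable_funTS|exact: measurable_funTS|rewrite Nx ltry].
Qed.

End image.

Theorem theorem2 (R : realType) (T : R) (hT : 0 < T) :
  let image : set (L2Cb R) :=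
    end_point_map T @` L2_ball `]0, T[ (1 / (4 * Num.sqrt (3 * T))) in
  [/\ C1_submanifold image,
      image <> setT,
      infinite_codim image &
      image <> tangent_space image 0].
Proof.
rewrite /= (image_end_point_map hT).
have qD := control_normD hT; have qZ := control_normZ hT.
have c01 : 0 <= (11 / 25 : R) < 1 by apply/andP; split; lra.
have k0 : 0 <= kappa T true + kappa T false by rewrite addr_ge0 ?kappa_ge0.
have C0 : 0 <= 11 / 25 * (kappa T true + kappa T false) by rewrite mulr_ge0.
have r0 : 0 < 1 / (4 * Num.sqrt 3) :> R by rewrite divr_gt0 ?mulr_gt0 ?sqrtr_gt0.
have LK := remainder_lipschitz hT radius_le.
have KC1 := remainder_C1 hT radius_le.
have K0 := remainder0 hT.
have linP := projection_linear hT; have PP := projection_idem hT.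
have PC := projection_bound hT.
split.
- exact: (graph_submanifold qD qZ (control_norm_L2Cb hT) c01 C0 LK KC1 linP PP k0 PC).
- exact: (graph_proper qD qZ c01 C0 LK r0 K0 linP k0 PC (kernel_infinite hT)).
- exact: (graph_infinite_codim qD qZ (control_norm_L2Cb hT) c01 C0 LK linP k0 PC (kernel_infinite hT)).
- exact: (graph_neq_tangent qD qZ (control_norm_L2Cb hT) c01 C0 LK r0 K0 linP k0 PC
    (projection_nontrivial hT)).
Qed.
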